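(* Let $G$ be a finite group and let $S\in\Omega^G$ be a tree with a $G$-action. Assume further that $S$ has at least two vertices and unary root vertex $v_r: G/G\cdot\Omega[1]\to\Omega[S]$. Then a lift (dashed map $\Omega[S]\to X$ in $\mathsf{dSet}^G$ making both triangles commute) exists in any commutative diagram $$\begin{array}{ccc}\Lambda^{r}[S]&\xrightarrow{\ f\ }&X\\ \downarrow&&\downarrow\\ \Omega[S]&\to&Y\end{array}$$ in $\mathsf{dSet}^G$ such that $X\to Y$ is a $G$-inner fibration between $G$-$\infty$-operads and $f(v_r)$ is an equivalence in the $\infty$-category $i^{*}(X^G)$.
   Context: $G$ is a finite group. Broad posets and trees. For a set $T$, $T^+$ is the free commutative monoid on $T$, with elements written as unordered tuples $\underline e=e_1\cdots e_n$; $\epsilon$ is the empty tuple; $e\in\underline e$ means $e$ is a letter of $\underline e$. A broad poset is a set $T$ (elements called edges) with a relation $\le$ from $T^+$ to $T$ such that: $e\le e$; $e\le f$ and $f\le e$ (with $e,f\in T$) imply $e=f$; if $f_1\cdots f_n\le e$ and $\underline g_i\le f_i$ for all $i$ then $\underline g_1\cdots\underline g_n\le e$. Maps are set maps preserving broad relations. It is simple if $e_1\cdots e_n\le e$ implies the $e_i$ are pairwise distinct. Write $f\le_d e$ if $f\in\underline f$ for some $\underline f\le e$; write $\underline f\le\underline e=e_1\cdots e_k$ if $\underline f=\underline f_1\cdots\underline f_k$ with $\underline f_i\le e_i$; write $\underline f<e$ if $\underline f\le e$, $\underline f\ne e$. An edge $e$ is a leaf if there is no $\underline f<e$; a node if there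 is a maximum $\underline f<e$ and it is $\neq\epsilon$; a stump if $\epsilon$ is the only $\underline f<e$. For nodes and stumps this maximum is denoted $e^{\uparrow}$, and the relation $e^\uparrow\le e$ is called the vertex at $e$. A tree is a finite simple broad poset in which every edge is a leaf, node or stump and which has a $\le_d$-maximum (the root). $\Omega$ is the category of trees (equivalent to the Moerdijk–Weiss category). An inner edge is one that is neither the root nor a leaf. $[n]$ also denotes the linear tree with edges $0,\dots,n$ and broad relations $i\le j$ for $i\leq j$, giving an inclusion $i:\Delta\to\Omega$; $\Omega[1]$ is the representable of $[1]$. A forest is a finite disjoint union of trees; $\Phi$ is the category of forests and broad poset maps. $\Omega_G\subset\Phi^G$ is the full subcategory of forests with $G$-action whose roots form a single $G$-orbit; its objects are called $G$-trees. $\Omega^G\subset\Omega_G$ consists of trees with a $G$-action. Presheaves. $\mathsf{dSet}=\mathsf{Set}^{\Omega^{op}}$, $\mathsf{dSet}^G=\mathsf{Set}^{\Omega^{op}\times G}$. $\Omega[T]$ is the representable of a tree $T$; for a forest $F=\amalg_i T_i$ set $\Omega[F]=\amalg_i\Omega[T_i]$. A face of a tree $T$ is a tree whose edge set is a subset of that of $T$ and whose inclusion is a map of trees; for a set $E'$ of inner edges, $T-E'$ is the face with edges $T\setminus E'$ and all broad relations of $T$ among them. For $E$ a set of inner edges of $T$, $\Lambda^E[T]\subset\Omega[T]$ is the union of the $\Omega[F]$ over all faces $F$ not of the form $T-E'$ with $E'\subset E$ ($E'=\emptyset$ included), extended to forests componentwise by coproducts. The generating $G$-inner horn inclusions are $\Lambda^{Ge}[T]\to\Omega[T]$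 with $T\in\Omega_G$ and $Ge$ the $G$-orbit of an inner edge $e$. A $G$-inner fibration is a map in $\mathsf{dSet}^G$ with the right lifting property against these, and $X$ is a $G$-$\infty$-operad if $X\to *$ is a $G$-inner fibration. $X^G$ is the dendroidal set of $G$-fixed points and $i^*:\mathsf{dSet}\to\mathsf{sSet}$ is restriction along $i$; for $X$ a $G$-$\infty$-operad $i^*(X^G)$ is an $\infty$-category (quasi-category). Root vertex and outer horn. The root vertex of $S$ is unary if $r^{\uparrow}$ is a single edge $a$, where $r$ is the root of $S$; $v_r$ is then the ($G$-fixed) face inclusion $\Omega[1]\to\Omega[S]$, $0\mapsto a$, $1\mapsto r$, which factors through $\Lambda^r[S]$, so $f(v_r)$ is a $1$-simplex of $i^*(X^G)$. $\Lambda^r[S]\subset\Omega[S]$ is the outer horn given by the union of $\Omega[F]$ over all faces $F$ of $S$ other than $S$ itself and the outer face obtained by removing $r$ (i.e. the face with edges $\{e: e\le_d a\}$ and all broad relations of $S$ among them). *)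

(* Defs.v *)
From HB Require Import structures.
From mathcomp Require Import all_boot all_fingroup.
From mathcomp Require Import boolp.
From mathcomp Require Import finmap multiset.

Set Implicit Arguments.
Unset Strict Implicit.
Unset Printing Implicit Defensive.

Local Open Scope mset_scope.
Local Open Scope nat_scope.

(** The free commutative monoid on [T] is [{mset T}], with unit [mset0] and
    product [`+`]; [mmap f] is the monoid map induced by [f]. *)
Definition mmap (T U : choiceType) (f : T -> U) (s : {mset T}) : {mset U} :=
  seq_mset [seq f x | x <- s].

Lemma perm_msetD (T : choiceType) (A B : {mset T}) :
  perm_eq (A `+` B : {mset T}) ((A : seq T) ++ (B : seq T)).
Proof.
by apply/allP => x _ /=; rewrite count_cat !count_mem_mset msetE2.
Qed.

Lemma seq_msetD (T : choiceType) (s t : seq T) :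
  seq_mset (s ++ t) = seq_mset s `+` seq_mset t.
Proof. by apply/msetP => x; rewrite msetE2 !mset_seqE count_cat. Qed.

Lemma mmap_seq (T U : choiceType) (f : T -> U) (s : seq T) :
  mmap f (seq_mset s) = seq_mset [seq f x | x <- s].
Proof. by apply/eq_seq_msetP/perm_map/perm_eq_seq_mset. Qed.

Lemma mmapD (T U : choiceType) (f : T -> U) (A B : {mset T}) :
  mmap f (A `+` B) = mmap f A `+` mmap f B.
Proof.
rewrite /mmap -seq_msetD -map_cat; apply/eq_seq_msetP/perm_map/perm_msetD.
Qed.

Lemma mmap0 (T U : choiceType) (f : T -> U) : mmap f mset0 = mset0.
Proof. by apply/msetP => x; rewrite /mmap enum_mset0 mset_seqE mset0E. Qed.

Lemma mmap1 (T U : choiceType) (f : T -> U) a : mmap f [mset a] = [mset f a].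
Proof.
by apply/msetP => x; rewrite /mmap enum_msetn mset_seqE msetnE /= addn0 eq_sym.
Qed.

Lemma mmapS (T U : choiceType) (f : T -> U) a (A : {mset T}) :
  mmap f (a +` A) = f a +` mmap f A.
Proof. by rewrite mmapD mmap1. Qed.

Lemma eq_mmap (T U : choiceType) (f g : T -> U) : f =1 g -> mmap f =1 mmap g.
Proof. by move=> fg A; rewrite /mmap (eq_map fg). Qed.

Lemma mmap_id (T : choiceType) (f : T -> T) : f =1 id -> mmap f =1 id.
Proof. by move=> fid A; rewrite /mmap map_id_in ?seq_mset_id // => x _; rewrite fid. Qed.

Lemma mmap_comp (T U V : choiceType) (f : U -> V) (g : T -> U) (A : {mset T}) :
  mmap f (mmap g A) = mmap (f \o g) A.
Proof. by rewrite {2}/mmap mmap_seq -map_comp. Qed.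

Lemma mem_mmap (T U : choiceType) (f : T -> U) (A : {mset T}) y :
  y \in mmap f A -> exists2 x, x \in A & y = f x.
Proof. by rewrite (perm_mem (perm_eq_seq_mset _)) => /mapP. Qed.

Lemma mmap_mem (T U : choiceType) (f : T -> U) (A : {mset T}) x :
  x \in A -> f x \in mmap f A.
Proof. by rewrite (perm_mem (perm_eq_seq_mset _)); exact: map_f. Qed.

Lemma mmap_inj (T U : choiceType) (f : T -> U) :
  injective f -> injective (mmap f).
Proof.
move=> fI A B /eq_seq_msetP /(perm_map_inj fI) /eq_seq_msetP.
by rewrite !seq_mset_id.
Qed.

Lemma mmap_surj (T U : choiceType) (f : T -> U) (A : {mset U}) :
  (forall y, y \in A -> exists x, f x = y) -> exists B, mmap f B = A.
Proof.
move=> H; have : forall y, y \in (A : seq U) -> exists x, f x = y by [].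
rewrite -{2}[A]seq_mset_id; elim: (A : seq U) => [|y s IH] Hs.
  by exists mset0; rewrite mmap0; apply/msetP => x; rewrite mset0E mset_seqE.
have [|B HB] := IH; first by move=> z zs; apply: Hs; rewrite inE zs orbT.
have [x fx] := Hs y (mem_head _ _).
by exists (x +` B); rewrite mmapS HB fx mset_cons.
Qed.

Lemma mset1_inj (T : choiceType) (x y : T) : [mset x] = [mset y] -> x = y.
Proof. by move=> E; apply/mset1P; rewrite -E mset11. Qed.

(** [blem le (f1 + ... + fk) (e1 ... ek)] when [le fi ei] for all [i]. *)
Inductive blem (T : choiceType) (le : {mset T} -> T -> Prop) :
    {mset T} -> {mset T} -> Prop :=
| blem_nil : blem le mset0 mset0
| blem_cons f e fs es :
    le f e -> blem le fs es -> blem le (f `+` fs) (e +` es).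

(** The set of edges is required to be finite, as it is for trees and forests. *)
Record broad_poset := BroadPoset {
  edge :> finType;
  ble : {mset edge} -> edge -> Prop;
  ble_refl : forall e, ble [mset e] e;
  ble_anti : forall e f, ble [mset e] f -> ble [mset f] e -> e = f;
  ble_trans : forall gs fs e, blem ble gs fs -> ble fs e -> ble gs e
}.

Section BroadPosetTheory.
Variable P : broad_poset.
Implicit Types (e f r : P) (s t : {mset P}).

Definition blt s e := ble s e /\ s <> [mset e].

Definition led f e := exists2 s : {mset P}, f \in s & ble s e.

Definition simple := forall s e, ble s e -> uniq s.

Definition is_up s e := blt s e /\ forall t, blt t e -> blem (@ble P) t s.

Definition is_leaf e := ~ exists s, blt s e.
Definition is_node e := exists2 s, is_up s e & s <> mset0.
Definition is_stump e := forall s, blt s e <-> s = mset0.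
Definition is_root r := forall e, led e r.

Definition is_tree :=
  [/\ simple, forall e, [\/ is_leaf e, is_node e | is_stump e]
    & exists r, is_root r].

Lemma blem_refl s : blem (@ble P) s s.
Proof.
rewrite -(seq_mset_id s); elim: (s : seq P) => [|x l IH].
  have -> : seq_mset [::] = mset0 :> {mset P}.
    by apply/msetP => x; rewrite mset_seqE mset0E.
  exact: blem_nil.
by rewrite mset_cons; apply: blem_cons => //; exact: ble_refl.
Qed.

End BroadPosetTheory.

Lemma blem0 (T : choiceType) (le : {mset T} -> T -> Prop) s :
  blem le s mset0 -> s = mset0.
Proof.
move E : mset0 => t H; case: H E => // f e fs es _ _ E.
by have := mset1D1 e es; rewrite -E in_mset0.
Qed.

Lemma blem1 (T : choiceType) (le : {mset T} -> T -> Prop) s x :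
  blem le s [mset x] -> le s x.
Proof.
move E : [mset x] => t H; case: H E => [|f e fs es fe H] E.
  by have := mset11 x; rewrite E in_mset0.
have ex : e = x by apply/mset1P; rewrite E mset1D1.
have es0 : es = mset0.
  have := msetD1K e es; rewrite -E ex => <-.
  by apply/msetP => y; rewrite msetB1E msetnE mset0E; case: eqP.
by move: H; rewrite es0 => /blem0 ->; rewrite msetD0 -ex.
Qed.

Lemma blem_mset1 (T : choiceType) (le : {mset T} -> T -> Prop) s x :
  le s x -> blem le s [mset x].
Proof.
by move=> H; have := blem_cons H (blem_nil le); rewrite !msetD0.
Qed.

Lemma led_anti (P : broad_poset) (e f : P) :
  simple P -> led e f -> led f e -> e = f.
Proof.
move=> sP [t et tf] [s fs se].
pose s' := s `\ f; pose t' := t `\ e.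
have sE : s = f +` s' by rewrite msetB1K.
have tE : t = e +` t' by rewrite msetB1K.
pose u := t' `+` s'.
have H1 : ble (e +` u) e.
  apply: ble_trans se; rewrite sE /u msetDA -tE.
  apply: blem_cons => //; exact: blem_refl.
have H2 : ble ((e +` u) `+` u) e.
  apply: ble_trans (H1); apply: blem_cons => //; exact: blem_refl.
have u0 : forall y, u y = 0.
  move=> y; apply/eqP; rewrite -leqn0 leqNgt; apply/negP => uy.
  have := count_mem_mset y ((e +` u) `+` u).
  rewrite (count_uniq_mem _ (sP _ _ H2)).
  have -> : ((e +` u) `+` u) y = [mset e] y + u y + u y by rewrite 2!msetE2.
  move=> E; have : (u y + u y <= 1)%N.
    apply: leq_trans (leq_b1 (y \in ((e +` u) `+` u : {mset P}))).
    rewrite E leq_add2r; exact: leq_addl.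
  by case: (u y) uy => // n _; rewrite addnS addSn.
have t0 : t' = mset0.
  by apply/msetP => y; have := u0 y; rewrite msetE2 mset0E => /eqP; rewrite addn_eq0 => /andP[/eqP].
have s0 : s' = mset0.
  by apply/msetP => y; have := u0 y; rewrite msetE2 mset0E => /eqP; rewrite addn_eq0 => /andP[_ /eqP].
move: tf se; rewrite tE sE t0 s0 !msetD0; exact: ble_anti.
Qed.

Record bmap (P Q : broad_poset) := BMap {
  bfun :> P -> Q;
  bmapP : forall s e, ble s e -> ble (mmap bfun s) (bfun e)
}.

Lemma bmap_eq (P Q : broad_poset) (f g : bmap P Q) : f =1 g -> f = g.
Proof.
case: f g => [f fP] [g gP] /= /funext E; subst g.
by congr BMap; exact: Prop_irrelevance.
Qed.

Lemma bid_subproof (P : broad_poset) s (e : P) :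
  ble s e -> ble (mmap id s) (id e).
Proof. by rewrite mmap_id. Qed.
Definition bid (P : broad_poset) : bmap P P := BMap (@bid_subproof P).

Lemma bcomp_subproof (P Q R : broad_poset) (g : bmap Q R) (f : bmap P Q) s e :
  ble s e -> ble (mmap (g \o f) s) ((g \o f) e).
Proof. by move=> H; rewrite -mmap_comp; do 2!apply: bmapP. Qed.
Definition bcomp (P Q R : broad_poset) (g : bmap Q R) (f : bmap P Q) : bmap P R :=
  BMap (bcomp_subproof g f).

Lemma bmap_led (P Q : broad_poset) (f : bmap P Q) x y :
  led x y -> led (f x) (f y).
Proof.
by move=> [s xs sy]; exists (mmap f s); [exact: mmap_mem | exact: bmapP].
Qed.

Lemma bmap_blem (P Q : broad_poset) (f : bmap P Q) s t :
  blem (@ble P) s t -> blem (@ble Q) (mmap f s) (mmap f t).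
Proof.
elim => [|a e fs es ae _ IH]; first by rewrite !mmap0; exact: blem_nil.
by rewrite mmapD mmapS; apply: blem_cons IH; exact: bmapP.
Qed.

Record tree := Tree { tree_bp :> broad_poset; treeP : is_tree tree_bp }.

Lemma root_exists (T : tree) : exists r : T, is_root r.
Proof. by case: (treeP T). Qed.
Definition troot (T : tree) : T := sval (cid (root_exists T)).
Lemma trootP (T : tree) : is_root (troot T).
Proof. exact: (svalP (cid (root_exists T))). Qed.

Lemma root_uniq (T : tree) (r r' : T) : is_root r -> is_root r' -> r = r'.
Proof.
by move=> rP rP'; case: (treeP T) => sT _ _; apply: led_anti sT _ _; auto.
Qed.

(** A forest is given as a finite family of trees; its underlying broad poset
    is the disjoint union of the family. *)
Record forest := Forest { fidx : finType; comp : fidx -> tree }.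

Section ForestPoset.
Variable F : forest.
Local Notation fedge := {i : fidx F & edge (comp i)}.

Definition fle (s : {mset fedge}) (e : fedge) :=
  exists2 t : {mset edge (comp (tag e))},
    s = mmap (Tagged (fun i => edge (comp i))) t & ble t (tagged e).

Lemma Tagged_inj i : injective (Tagged (fun i : fidx F => edge (comp i)) (i:=i)).
Proof. by move=> x y; exact: eq_from_Tagged. Qed.

Lemma fle_comp i (t : {mset edge (comp i)}) (x : comp i) :
  fle (mmap (Tagged (fun i => edge (comp i))) t)
      (Tagged (fun i : fidx F => edge (comp i)) x) <-> ble t x.
Proof.
split=> [[t' /= /(mmap_inj (@Tagged_inj i)) <-] //|H].
by exists t.
Qed.

Lemma fle_blem i s (t : {mset edge (comp i)}) :
  blem fle s (mmap (Tagged (fun i => edge (comp i))) t) ->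
  exists2 s', s = mmap (Tagged (fun i => edge (comp i))) s'
            & blem (@ble (comp i)) s' t.
Proof.
move Et: (mmap _ t) => t' H; elim: H t Et => [|f e fs es fe _ IH] t Et.
  exists mset0; rewrite ?mmap0 //.
  suff -> : t = mset0 by exact: blem_nil.
  by apply: (mmap_inj (@Tagged_inj i)); rewrite Et mmap0.
have : e \in mmap (Tagged (fun i : fidx F => edge (comp i))) t.
  by rewrite Et mset1D1.
case/mem_mmap => x xt eE.
have tE : t = x +` (t `\ x) by rewrite msetB1K.
have [|s' -> H'] := IH (t `\ x).
  by rewrite -(msetD1K e es) -Et {2}tE mmapS eE msetD1K.
rewrite eE in fe; case: fe => /= f' -> fx.
by exists (f' `+` s'); rewrite ?mmapD // tE; apply: blem_cons.
Qed.

Lemma fle_refl e : fle [mset e] e.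
Proof.
by case: e => i x; exists [mset x]; rewrite ?mmap1 //; exact: ble_refl.
Qed.

Lemma fle_anti e f : fle [mset e] f -> fle [mset f] e -> e = f.
Proof.
case: e f => [i x] [j y] [t Et Hx].
have : Tagged (fun i : fidx F => edge (comp i)) x \in
    mmap (Tagged (fun i : fidx F => edge (comp i))) t by rewrite -Et mset11.
case/mem_mmap => z _ /= E.
have ij : i = j by case: E.
subst j; rewrite -!(mmap1 (Tagged (fun i : fidx F => edge (comp i)))) in Et *.
have {}Et := mmap_inj (@Tagged_inj i) Et; subst t => /fle_comp yx.
by congr existT; exact: ble_anti.
Qed.

Lemma fle_trans gs fs e : blem fle gs fs -> fle fs e -> fle gs e.
Proof.
move=> H [t fsE te]; move: H; rewrite fsE => /fle_blem[s' -> Hs].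
by exists s' => //; exact: ble_trans te.
Qed.

Definition forest_bp : broad_poset :=
  @BroadPoset fedge fle fle_refl fle_anti fle_trans.

End ForestPoset.

Coercion forest_bp : forest >-> broad_poset.

Definition fincl_fun (F : forest) (i : fidx F) (x : comp i) : F :=
  Tagged (fun i => edge (comp i)) x.
Lemma fincl_subproof (F : forest) (i : fidx F) s (e : comp i) :
  ble s e -> @ble F (mmap (@fincl_fun F i) s) (fincl_fun e).
Proof. by move=> H; apply/fle_comp. Qed.
Definition fincl (F : forest) (i : fidx F) : bmap (comp i) F :=
  BMap (@fincl_subproof F i).

Lemma fincl_inj (F : forest) (i : fidx F) : injective (fincl i).
Proof. exact: Tagged_inj. Qed.

Lemma bmap_tag (U : tree) (F : forest) (h : bmap U F) (u : U) :
  tag (h u : {i : fidx F & edge (comp i)}) =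
  tag (h (troot U) : {i : fidx F & edge (comp i)}).
Proof.
have [s us /(bmapP h)[t Et _]] := trootP u.
have := mmap_mem h us; rewrite Et => /mem_mmap[x _ E].
by rewrite E.
Qed.

Definition split_fun (U : tree) (F : forest) (h : bmap U F) (u : U) :
    comp (tag (h (troot U) : {i : fidx F & edge (comp i)})) :=
  etagged (bmap_tag h u).

Lemma split_funK (U : tree) (F : forest) (h : bmap U F) u :
  fincl _ (split_fun h u) = h u.
Proof. exact: (etaggedK (T_ := fun i : fidx F => edge (comp i))). Qed.

Lemma split_subproof (U : tree) (F : forest) (h : bmap U F) s e :
  ble s e -> ble (mmap (split_fun h) s) (split_fun h e).
Proof.
move=> /(bmapP h) H; apply/fle_comp.
rewrite -/(fincl_fun _) -[fincl_fun _]/(fincl _ _) split_funK.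
rewrite (_ : mmap _ _ = mmap h s) // mmap_comp.
by apply: eq_mmap => x /=; rewrite -[RHS]split_funK.
Qed.

Definition fsplit (U : tree) (F : forest) (h : bmap U F) :
    {i : fidx F & bmap U (comp i)} :=
  existT _ _ (BMap (@split_subproof U F h)).

Definition fjoin (U : tree) (F : forest) (x : {i : fidx F & bmap U (comp i)}) :
    bmap U F := bcomp (fincl (tag x)) (tagged x).

Lemma fsplitK (U : tree) (F : forest) : cancel (@fsplit U F) (@fjoin U F).
Proof. by move=> h; apply: bmap_eq => u /=; exact: split_funK. Qed.

Lemma fjoin_inj (U : tree) (F : forest) : injective (@fjoin U F).
Proof.
move=> [i k] [j l] E.
have ij : i = j.
  have := congr1 (fun h : bmap U F => tag (h (troot U) : {i : fidx F & edge (comp i)})) E.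
  by [].
subst j; congr existT; apply: bmap_eq => u; apply: (@fincl_inj F i).
exact: (congr1 (fun h : bmap U F => h u) E).
Qed.

Lemma fjoinK (U : tree) (F : forest) : cancel (@fjoin U F) (@fsplit U F).
Proof. by move=> x; apply: fjoin_inj; rewrite fsplitK. Qed.

Record gaction (gT : finGroupType) (P : broad_poset) := GAction {
  gact :> gT -> bmap P P;
  gact1 : gact 1%g = bid P;
  gactM : forall g h, gact (g * h)%g = bcomp (gact g) (gact h)
}.

Section ActionTheory.
Variables (gT : finGroupType) (P : broad_poset) (rho : gaction gT P).

Lemma gactK g : cancel (rho g) (rho g^-1%g).
Proof.
move=> x; have := congr1 (fun f : bmap P P => f x) (gactM rho g^-1%g g).
by rewrite mulVg gact1.
Qed.
Lemma gactKV g : cancel (rho g^-1%g) (rho g).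
Proof. by move=> x; rewrite -{1}(invgK g) gactK. Qed.
Lemma gact_inj g : injective (rho g). Proof. exact: can_inj (gactK g). Qed.

Lemma gact_ble g s e : ble (mmap (rho g) s) (rho g e) -> ble s e.
Proof.
move=> /(bmapP (rho g^-1%g)); rewrite mmap_comp gactK mmap_id //; exact: gactK.
Qed.

End ActionTheory.

(** An object of [Omega^G]. *)
Record tree_act (gT : finGroupType) := TreeAct {
  ta_tree :> tree;
  ta_act : gaction gT ta_tree
}.

Definition is_froot (F : forest) (x : F) :=
  is_root (tagged (x : {i : fidx F & edge (comp i)})).

(** An object of [Omega_G]; the roots of the components form one orbit. *)
Record gtree (gT : finGroupType) := GTree {
  gt_forest :> forest;
  gt_act : gaction gT gt_forest;
  gt_orbit : exists x : gt_forest, forall y : gt_forest,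
    is_froot y <-> exists g, y = gt_act g x
}.

(** Presheaves on the category of trees and maps of broad posets. *)
Record dset := DSet {
  dob :> tree -> Type;
  dres : forall U V : tree, bmap U V -> dob V -> dob U;
  dres_id : forall (U : tree) (x : dob U), dres (bid U) x = x;
  dres_comp : forall (U V W : tree) (f : bmap V W) (k : bmap U V) (x : dob W),
    dres (bcomp f k) x = dres k (dres f x)
}.

Section Equivariant.
Variable gT : finGroupType.

Record gdset := GDSet {
  gd_dset :> dset;
  dact : forall U : tree, gT -> gd_dset U -> gd_dset U;
  dact1 : forall (U : tree) (x : gd_dset U), dact 1%g x = x;
  dactM : forall (U : tree) g h (x : gd_dset U),
    dact (g * h)%g x = dact g (dact h x);
  dact_res : forall (U V : tree) (f : bmap U V) g (x : gd_dset V),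
    dact g (dres f x) = dres f (dact g x)
}.

Record gmap (X Y : gdset) := GMap {
  gm :> forall U : tree, X U -> Y U;
  gm_res : forall (U V : tree) (f : bmap U V) (x : X V),
    gm (dres f x) = dres f (gm x);
  gm_act : forall (U : tree) g (x : X U), gm (dact g x) = dact g (gm x)
}.

Definition has_lift (A B X Y : gdset) (i : gmap A B) (p : gmap X Y)
    (f : gmap A X) (y : gmap B Y) :=
  exists l : gmap B X,
    (forall U (x : A U), l U (i U x) = f U x) /\
    (forall U (x : B U), p U (l U x) = y U x).

Definition commutes (A B X Y : gdset) (i : gmap A B) (p : gmap X Y)
    (f : gmap A X) (y : gmap B Y) :=
  forall U (x : A U), p U (f U x) = y U (i U x).

Definition has_rlp (A B X Y : gdset) (i : gmap A B) (p : gmap X Y) :=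
  forall (f : gmap A X) (y : gmap B Y), commutes i p f y -> has_lift i p f y.

Definition terminal_dset : dset :=
  @DSet (fun _ => unit) (fun _ _ _ x => x) (fun _ _ => erefl)
    (fun _ _ _ _ _ _ => erefl).
Definition terminal : gdset :=
  @GDSet terminal_dset (fun _ _ x => x) (fun _ _ => erefl)
    (fun _ _ _ _ => erefl) (fun _ _ _ _ _ => erefl).
Definition to_terminal (X : gdset) : gmap X terminal :=
  @GMap X terminal (fun _ _ => tt) (fun _ _ _ _ => erefl) (fun _ _ _ => erefl).

Record gsub (B : gdset) := GSub {
  gs_mem : forall U : tree, B U -> Prop;
  gs_res : forall (U V : tree) (f : bmap U V) (x : B V),
    gs_mem x -> gs_mem (dres f x);
  gs_act : forall (U : tree) g (x : B U), gs_mem x -> gs_mem (dact g x)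
}.

Section SubObject.
Variables (B : gdset) (A : gsub B).

Definition sub_ob (U : tree) := {x : B U | gs_mem A x}.
Definition sub_res (U V : tree) (f : bmap U V) (x : sub_ob V) : sub_ob U :=
  exist _ (dres f (sval x)) (gs_res f (svalP x)).

Lemma sub_eq (U : tree) (x y : sub_ob U) : sval x = sval y -> x = y.
Proof. by case: x y => [x p] [y q] /= E; exact: eq_exist. Qed.

Lemma sub_res_id (U : tree) (x : sub_ob U) : sub_res (bid U) x = x.
Proof. by apply: sub_eq; exact: dres_id. Qed.
Lemma sub_res_comp (U V W : tree) (f : bmap V W) (k : bmap U V) (x : sub_ob W) :
  sub_res (bcomp f k) x = sub_res k (sub_res f x).
Proof. by apply: sub_eq; exact: dres_comp. Qed.
Definition sub_dset : dset := DSet sub_res_id sub_res_comp.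

Definition sub_act (U : tree) (g : gT) (x : sub_dset U) : sub_dset U :=
  exist _ (dact g (sval x)) (gs_act g (svalP x)).
Lemma sub_act1 (U : tree) (x : sub_dset U) : sub_act 1%g x = x.
Proof. by apply: sub_eq; exact: dact1. Qed.
Lemma sub_actM (U : tree) g h (x : sub_dset U) :
  sub_act (g * h)%g x = sub_act g (sub_act h x).
Proof. by apply: sub_eq; exact: dactM. Qed.
Lemma sub_act_res (U V : tree) (f : bmap U V) g (x : sub_dset V) :
  sub_act g (dres f x) = dres f (sub_act g x).
Proof. by apply: sub_eq; exact: dact_res. Qed.
Definition sub_gdset : gdset := GDSet sub_act1 sub_actM sub_act_res.

Definition sub_incl : gmap sub_gdset B :=
  @GMap sub_gdset B (fun U x => sval x) (fun _ _ _ _ => erefl)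
    (fun _ _ _ => erefl).
End SubObject.

Section RepTree.
Variable S : tree_act gT.

Lemma rep_id (U : tree) (x : bmap U S) : bcomp x (bid U) = x.
Proof. exact: bmap_eq. Qed.
Lemma rep_comp (U V W : tree) (f : bmap V W) (k : bmap U V) (x : bmap W S) :
  bcomp x (bcomp f k) = bcomp (bcomp x f) k.
Proof. exact: bmap_eq. Qed.
Definition rep_dset : dset :=
  @DSet (fun U => bmap U S) (fun U V f x => bcomp x f) rep_id rep_comp.

Definition rep_act (U : tree) (g : gT) (x : rep_dset U) : rep_dset U :=
  bcomp (ta_act S g) x.
Lemma rep_act1 (U : tree) (x : rep_dset U) : rep_act 1%g x = x.
Proof. by rewrite /rep_act gact1; exact: bmap_eq. Qed.
Lemma rep_actM (U : tree) g h (x : rep_dset U) :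
  rep_act (g * h)%g x = rep_act g (rep_act h x).
Proof. by rewrite /rep_act gactM; exact: bmap_eq. Qed.
Lemma rep_act_res (U V : tree) (f : bmap U V) g (x : rep_dset V) :
  rep_act g (dres f x) = dres f (rep_act g x).
Proof. exact: bmap_eq. Qed.
Definition rep_tree : gdset := GDSet rep_act1 rep_actM rep_act_res.
End RepTree.

Section RepGTree.
Variable T : gtree gT.

(** [Omega[F]] is the coproduct of the [Omega[T_i]]; [G] acts by postcomposition
    with its action on [F], using that a map from a tree to [F] factors through
    a unique component ([fsplit], inverse to [fjoin]). *)
Definition repf_ob (U : tree) := {i : fidx T & bmap U (comp i)}.
Definition repf_res (U V : tree) (f : bmap U V) (x : repf_ob V) : repf_ob U :=
  existT _ (tag x) (bcomp (tagged x) f).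
Lemma repf_id (U : tree) (x : repf_ob U) : repf_res (bid U) x = x.
Proof. by case: x => i k; congr existT; exact: bmap_eq. Qed.
Lemma repf_comp (U V W : tree) (f : bmap V W) (k : bmap U V) (x : repf_ob W) :
  repf_res (bcomp f k) x = repf_res k (repf_res f x).
Proof. by congr existT; exact: bmap_eq. Qed.
Definition repf_dset : dset := DSet repf_id repf_comp.

Definition repf_act (U : tree) (g : gT) (x : repf_dset U) : repf_dset U :=
  fsplit (bcomp (gt_act T g) (fjoin x)).
Lemma repf_act1 (U : tree) (x : repf_dset U) : repf_act 1%g x = x.
Proof.
by apply: fjoin_inj; rewrite fsplitK gact1; exact: bmap_eq.
Qed.
Lemma repf_actM (U : tree) g h (x : repf_dset U) :
  repf_act (g * h)%g x = repf_act g (repf_act h x).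
Proof.
by apply: fjoin_inj; rewrite !fsplitK gactM; exact: bmap_eq.
Qed.
Lemma fjoin_res (U V : tree) (f : bmap U V) (x : repf_dset V) :
  fjoin (dres f x) = bcomp (fjoin x) f.
Proof. exact: bmap_eq. Qed.
Lemma repf_act_res (U V : tree) (f : bmap U V) g (x : repf_dset V) :
  repf_act g (dres f x) = dres f (repf_act g x).
Proof.
by apply: fjoin_inj; rewrite fjoin_res !fsplitK fjoin_res; exact: bmap_eq.
Qed.
Definition rep_gtree : gdset := GDSet repf_act1 repf_actM repf_act_res.
End RepGTree.

End Equivariant.

(** A face of [T] is given by a tree [F] and a map [i : F -> T] injective on
    edges; up to renaming the edges of [F] this is a tree on a subset of the
    edges of [T] whose inclusion is a map of trees.  [full_on i A] says that
    the face is the one with edge set [A] and all broad relations of [T] among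
    the edges in [A]. *)
Definition full_on (F T : tree) (i : bmap F T) (A : {set T}) :=
  (forall x, x \in A <-> exists y, i y = x) /\
  forall s e, ble (mmap i s) (i e) -> ble s e.

(** The union of the faces of [T] other than those which are full on some
    [A] with [excl A]. *)
Definition in_horn (T : tree) (excl : {set T} -> Prop) (U : tree)
    (h : bmap U T) :=
  exists (F : tree) (i : bmap F T) (k : bmap U F),
    [/\ injective i, forall A, excl A -> ~ full_on i A & h = bcomp i k].

Lemma in_horn_res (T : tree) (excl : {set T} -> Prop) (U V : tree)
    (f : bmap U V) (h : bmap V T) :
  in_horn excl h -> in_horn excl (bcomp h f).
Proof.
move=> [F [i [k [iI iX ->]]]]; exists F, i, (bcomp k f); split=> //.
exact: bmap_eq.
Qed.

Definition is_inner (T : tree) (e : T) := ~ is_root e /\ ~ is_leaf e.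

(** The edge sets of the faces [T - E'] with [E'] a subset of [E]. *)
Definition inner_excl (T : tree) (E : {set T}) (A : {set T}) :=
  exists2 E' : {set T}, E' \subset E & A = ~: E'.

Section InnerHorn.
Variables (gT : finGroupType) (T : gtree gT) (e : T).

Definition edge_orbit : {set T} := [set gt_act T g e | g : gT].

Definition orbit_in (i : fidx T) : {set comp i} :=
  [set x | fincl i x \in edge_orbit].

Definition ihorn_mem (U : tree) (x : rep_gtree T U) :=
  in_horn (inner_excl (orbit_in (tag x))) (tagged x).

Lemma edge_orbit_act g x : (gt_act T g x \in edge_orbit) = (x \in edge_orbit).
Proof.
have H h y : y \in edge_orbit -> gt_act T h y \in edge_orbit.
  case/imsetP => k _ ->; apply/imsetP; exists (h * k)%g => //.
  by rewrite gactM.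
by apply/idP/idP => [/(H g^-1%g)|]; [rewrite gactK | exact: H].
Qed.

Lemma ihorn_res (U V : tree) (f : bmap U V) (x : rep_gtree T V) :
  ihorn_mem x -> ihorn_mem (dres f x).
Proof. exact: in_horn_res. Qed.

Lemma ihorn_act (U : tree) g (x : rep_gtree T U) :
  ihorn_mem x -> ihorn_mem (dact g x).
Proof.
case: x => i h [F [j [k /= [jI jX hE]]]].
pose w := fsplit (bcomp (gt_act T g) (fjoin (existT _ i j)) : bmap F T).
have wE y : fincl _ (tagged w y) = gt_act T g (fincl i (j y)).
  have := congr1 (fun f : bmap F T => f y)
    (fsplitK (bcomp (gt_act T g) (fjoin (existT _ i j)) : bmap F T)).
  by [].
have E : @dact gT (rep_gtree T) U g (existT _ i h) =
    existT _ (tag w) (bcomp (tagged w) k).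
  apply: fjoin_inj; rewrite fsplitK; apply: bmap_eq => u.
  by apply/esym; apply: etrans (wE (k u)) _; rewrite hE.
suff H : @ihorn_mem U (existT _ (tag w) (bcomp (tagged w) k)).
  by rewrite -E in H.
exists F, (tagged w), k; split=> //=.
  move=> y z /(congr1 (fincl (tag w))); rewrite !wE.
  by move=> /gact_inj/fincl_inj/jI.
move=> A [E' E'sub AE] [wA wfull].
pose c := fsplit (bcomp (gt_act T g) (fincl i) : bmap (comp i) T).
have cE y : fincl _ (tagged c y) = gt_act T g (fincl i y).
  exact: (congr1 (fun f : bmap (comp i) T => f y)
    (fsplitK (bcomp (gt_act T g) (fincl i) : bmap (comp i) T))).
have ct : tag c = tag w.
  have := cE (j (troot F)); rewrite -wE => H.
  exact: (congr1 (fun z : {i : fidx T & edge (comp i)} => tag z) H).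
case: c ct cE => l c ct; change (l = tag w) in ct; subst l => cE0.
have cE y : fincl (tag w) (c y) = gt_act T g (fincl i y) := cE0 y.
have wc y : tagged w y = c (j y).
  by apply: (@fincl_inj T (tag w)); rewrite wE cE.
have cI : injective c.
  by move=> y z /(congr1 (fincl (tag w))); rewrite !cE => /gact_inj/fincl_inj.
apply: (jX (~: [set y | c y \in E'])); first (exists [set y | c y \in E']) => //.
  apply/subsetP => y; rewrite inE => /(subsetP E'sub).
  rewrite inE => cy; rewrite inE -(edge_orbit_act g).
  by rewrite -cE.
split=> [y|s y H].
  rewrite !inE; split.
    move=> H; have : c y \in A by rewrite AE inE.
    by move=> /wA[z]; rewrite wc => /cI <-; exists z.
  move=> [z <-]; rewrite -wc.
  have : tagged w z \in A by apply/wA; exists z.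
  by rewrite AE inE.
apply: wfull; rewrite wc (eq_mmap wc) -(mmap_comp c j).
exact: bmapP.
Qed.

Definition inner_horn : gsub (rep_gtree T) := GSub ihorn_res ihorn_act.

End InnerHorn.

Definition is_finner (F : forest) (e : F) :=
  is_inner (tagged (e : {i : fidx F & edge (comp i)})).

Definition g_inner_fibration (gT : finGroupType) (X Y : gdset gT)
    (p : gmap X Y) :=
  forall (T : gtree gT) (e : T), is_finner e ->
    has_rlp (sub_incl (inner_horn e)) p.

Definition g_inf_operad (gT : finGroupType) (X : gdset gT) :=
  g_inner_fibration (to_terminal X).

Section Linear.
Variable n : nat.

Definition lle (s : {mset 'I_n.+1}) (e : 'I_n.+1) :=
  exists2 i : 'I_n.+1, s = [mset i] & i <= e.

Lemma lle_refl e : lle [mset e] e. Proof. by exists e. Qed.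
Lemma lle_anti e f : lle [mset e] f -> lle [mset f] e -> e = f.
Proof.
move=> [i /mset1_inj <- ef] [j /mset1_inj <- fe].
by apply/val_inj/eqP; rewrite eqn_leq ef.
Qed.
Lemma lle_trans gs fs e : blem lle gs fs -> lle fs e -> lle gs e.
Proof.
move=> H [i E ie]; move: H; rewrite E => /blem1[j -> ji].
by exists j => //; exact: leq_trans ie.
Qed.
Definition linear_bp : broad_poset :=
  @BroadPoset 'I_n.+1 lle lle_refl lle_anti lle_trans.

Lemma linear_tree : is_tree linear_bp.
Proof.
split.
- by move=> s e [i -> _]; rewrite enum_msetn.
- move=> e; case: (posnP (e : 'I_n.+1)) => [e0|e0].
    apply: Or31 => -[s [[i -> ie]]]; apply.
    congr [mset _]; apply/val_inj/eqP.
    by rewrite eqn_leq ie /= e0.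
  apply: Or32; have e1 : (e : 'I_n.+1).-1 < n.+1.
    by apply: leq_ltn_trans (leq_pred _) (ltn_ord _).
  exists [mset (Ordinal e1 : linear_bp)]; last first.
    move=> E; have := mset11 (Ordinal e1 : linear_bp).
    by rewrite E in_mset0.
  split.
    split; first by exists (Ordinal e1) => //=; exact: leq_pred.
    move=> /mset1_inj/(congr1 val)/= E.
    by have := prednK e0; rewrite E => /eqP; rewrite -[X in _ == X]addn0 -addn1 eqn_add2l.
  move=> t [[i -> ie] /eqP ne].
  apply: blem_mset1; exists i => //=.
  rewrite -ltnS (prednK e0) ltn_neqAle ie andbT.
  by apply/negP => /eqP/val_inj E; case/eqP: ne; rewrite E.
- exists (ord_max : 'I_n.+1) => e; exists [mset e]; first by rewrite mset11.
  by exists e => //; exact: leq_ord.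
Qed.
Definition linear : tree := Tree linear_tree.
End Linear.

Definition monotone (m n : nat) (f : 'I_m.+1 -> 'I_n.+1) :=
  {homo f : i j / i <= j}.
Definition mono (m n : nat) := {f : 'I_m.+1 -> 'I_n.+1 | monotone f}.

Definition mono_id n : mono n n := exist (@monotone n n) id (fun _ _ H => H).
Definition mono_comp l m n (f : mono m n) (g : mono l m) : mono l n :=
  exist (@monotone l n) (sval f \o sval g)
    (fun _ _ H => svalP f _ _ (svalP g _ _ H)).

(** Simplicial sets: [mono m n] is the set of maps from [m] to [n] in Delta. *)
Record sset := SSet {
  sob :> nat -> Type;
  sres : forall m n, mono m n -> sob n -> sob m;
  sres_id : forall n (x : sob n), sres (mono_id n) x = x;
  sres_comp : forall l m n (f : mono m n) (g : mono l m) (x : sob n),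
    sres (mono_comp f g) x = sres g (sres f x)
}.

Lemma linear_map_subproof m n (f : mono m n) s (e : linear m) :
  ble s e -> @ble (linear n) (mmap (sval f) s) (sval f e).
Proof.
move=> [i -> ie]; rewrite mmap1; exists (sval f i) => //.
exact: (svalP f).
Qed.
Definition linear_map m n (f : mono m n) : bmap (linear m) (linear n) :=
  BMap (@linear_map_subproof m n f).

Section Restriction.
Variable X : dset.

Lemma istar_id n (x : X (linear n)) : dres (linear_map (mono_id n)) x = x.
Proof. by rewrite -[RHS]dres_id; congr dres; exact: bmap_eq. Qed.
Lemma istar_comp l m n (f : mono m n) (g : mono l m) (x : X (linear n)) :
  dres (linear_map (mono_comp f g)) x =
  dres (linear_map g) (dres (linear_map f) x).
Proof. by rewrite -dres_comp; congr dres; exact: bmap_eq. Qed.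
Definition istar : sset :=
  @SSet (fun n => X (linear n)) (fun m n f => dres (linear_map f))
    istar_id istar_comp.
End Restriction.

Lemma lift_mono n (i : 'I_n.+2) : monotone (lift i).
Proof. by move=> x y xy /=; rewrite leq_bump2. Qed.
Definition coface n (i : 'I_n.+2) : mono n n.+1 := 
  exist (@monotone n n.+1) (lift i) (@lift_mono n i).
Definition to_pt n : mono n 0 :=
  exist (@monotone n 0) (fun=> ord0) (fun _ _ _ => leqnn 0).

Section Equivalence.
Variable X : sset.

Definition face n (i : 'I_n.+2) (x : X n.+1) : X n := sres (coface i) x.
Definition source (e : X 1) : X 0 := face (inord 1) e.
Definition target (e : X 1) : X 0 := face (inord 0) e.
Definition ident (x : X 0) : X 1 := sres (to_pt 1) x.

(** [h] is a composite of [f] followed by [g], i.e. [[h] = [g] [f]] in the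
    homotopy category when [X] is an infinity-category. *)
Definition is_composite (f g h : X 1) :=
  exists s : X 2,
    [/\ face (inord 2) s = f, face (inord 0) s = g & face (inord 1) s = h].

(** [f] is invertible in the homotopy category. *)
Definition is_equivalence (f : X 1) :=
  exists g : X 1, is_composite f g (ident (source f)) /\
                  is_composite g f (ident (target f)).
End Equivalence.

Section Fixed.
Variables (gT : finGroupType) (X : gdset gT).

Definition fix_ob (U : tree) := {x : X U | forall g, dact g x = x}.
Lemma fix_res_subproof (U V : tree) (f : bmap U V) (x : fix_ob V) g :
  dact g (dres f (sval x)) = dres f (sval x).
Proof. by rewrite dact_res (svalP x). Qed.
Definition fix_res (U V : tree) (f : bmap U V) (x : fix_ob V) : fix_ob U :=
  exist _ (dres f (sval x)) (fix_res_subproof f x).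
Lemma fix_id (U : tree) (x : fix_ob U) : fix_res (bid U) x = x.
Proof. by case: x => x p; apply: eq_exist; exact: dres_id. Qed.
Lemma fix_comp (U V W : tree) (f : bmap V W) (k : bmap U V) (x : fix_ob W) :
  fix_res (bcomp f k) x = fix_res k (fix_res f x).
Proof. by apply: eq_exist; exact: dres_comp. Qed.
Definition fixed : dset := DSet fix_id fix_comp.
End Fixed.

Definition vertices (S : tree) : {set S} :=
  [set e | `[< is_node e \/ is_stump e >]].

Record unary_root (S : tree) := UnaryRoot {
  ur_root : S;
  ur_edge : S;
  ur_rootP : is_root ur_root;
  ur_edgeP : is_up [mset ur_edge] ur_root
}.

Section OuterHorn.
Variables (gT : finGroupType) (S : tree_act gT) (v : unary_root S).
Let r := ur_root v.
Let a := ur_edge v.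

(** The edge sets of [S] and of the outer face obtained by removing [r]. *)
Definition outer_excl (A : {set S}) :=
  A = setT \/ A = [set e | `[< led e a >]].

Definition ohorn_mem (U : tree) (x : rep_tree S U) := in_horn outer_excl x.

Lemma simpleS : simple S. Proof. by case: (treeP S). Qed.

Lemma act_root g : ta_act S g r = r.
Proof.
apply: root_uniq (ur_rootP v) => e.
by rewrite -(gactKV (ta_act S) g e); apply: bmap_led; exact: ur_rootP.
Qed.

Lemma ur_neq : a <> r.
Proof. by case: (ur_edgeP v) => -[_ H] _ E; apply: H; rewrite -/a E. Qed.

Lemma act_edge_le g : ble [mset ta_act S g a] a.
Proof.
case: (ur_edgeP v) => -[ar _] H; apply: blem1; apply: H; split.
  by have := bmapP (ta_act S g) ar; rewrite mmap1 -/r -/a act_root.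
move=> /mset1_inj E; apply: ur_neq.
by apply: (@gact_inj _ _ (ta_act S) g); rewrite E act_root.
Qed.

Lemma act_edge g : ta_act S g a = a.
Proof.
apply: ble_anti (act_edge_le g) _.
have := bmapP (ta_act S g) (act_edge_le g^-1%g).
by rewrite mmap1 gactKV.
Qed.

Lemma outer_excl_act g A : outer_excl A -> outer_excl ((ta_act S g) @^-1: A).
Proof.
case=> ->; [left | right]; apply/setP => x; rewrite !inE //.
apply/asboolP/asboolP => [/(bmap_led (ta_act S g^-1%g))|/(bmap_led (ta_act S g))].
  by rewrite gactK act_edge.
by rewrite act_edge.
Qed.

Lemma ohorn_res (U V : tree) (f : bmap U V) (x : rep_tree S V) :
  ohorn_mem x -> ohorn_mem (dres f x).
Proof. exact: in_horn_res. Qed.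

Lemma ohorn_act (U : tree) g (x : rep_tree S U) :
  ohorn_mem x -> ohorn_mem (dact g x).
Proof.
move=> [F [i [k [iI iX ->]]]]; exists F, (bcomp (ta_act S g) i), k; split.
- by move=> y z /gact_inj/iI.
- move=> A /(outer_excl_act g)/iX nA [Asurj Afull]; apply: nA; split.
    move=> y; rewrite inE; split=> [/Asurj[z /gact_inj <-]|[z <-]].
      by exists z.
    by apply/Asurj; exists z.
  move=> s e H; apply: Afull.
  by rewrite -(mmap_comp (ta_act S g) i); exact: bmapP H.
- exact: bmap_eq.
Qed.

Definition outer_horn : gsub (rep_tree S) := GSub ohorn_res ohorn_act.

Definition root_vertex_fun (x : linear 1) : S :=
  if (x : 'I_2) == ord0 then a else r.
Lemma root_vertex_subproof s (e : linear 1) :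
  ble s e -> ble (mmap root_vertex_fun s) (root_vertex_fun e).
Proof.
move=> [i -> ie]; rewrite mmap1 /root_vertex_fun.
case: (e =P ord0) => [e0|ne].
  have -> : i == ord0 by rewrite e0 in ie; rewrite -val_eqE /= -leqn0.
  exact: ble_refl.
case: ifP => _; last exact: ble_refl.
by case: (ur_edgeP v) => -[].
Qed.

(** The map [v_r : Omega[1] -> Omega[S]], seen as an element of [Omega[S]([1])]
    by the Yoneda lemma. *)
Definition root_vertex : rep_tree S (linear 1) := BMap root_vertex_subproof.

Lemma root_vertex_act g : dact g root_vertex = root_vertex.
Proof.
by apply: bmap_eq => x /=; rewrite /root_vertex_fun; case: ifP;
  rewrite ?act_edge ?act_root.
Qed.

Hypothesis two_vertices : 1 < #|vertices S|.

Lemma root_vertex_inj : injective root_vertex.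
Proof.
move=> x y; rewrite /= /root_vertex_fun.
have H (z : linear 1) : (z : 'I_2) != ord0 -> z = (ord_max : 'I_2).
  by case: z => [[|[|m]] Hm] //= _; apply/val_inj.
case: ifPn => [/eqP->|/H->]; case: ifPn => [/eqP->|/H->] // E;
  by case: ur_neq.
Qed.

Lemma root_vertex_mem : ohorn_mem root_vertex.
Proof.
exists (linear 1), root_vertex, (bid _); split; last exact: bmap_eq.
  exact: root_vertex_inj.
move=> A [] -> [Asurj Afull].
- have im x : x = a \/ x = r.
    have /Asurj[y <-] : x \in [set: S] by rewrite inE.
    by rewrite /= /root_vertex_fun; case: ifP; [left | right].
  have [x xV xr] : exists2 x, x \in vertices S & x <> r.
    apply: contrapT => H; have : vertices S \subset [set r].
      apply/subsetP => x xV; rewrite inE; apply/eqP; apply: contrapT => xr.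
      by apply: H; exists x.
    by move=> /subset_leq_card; rewrite cards1 leqNgt two_vertices.
  have {xr} xa : x = a by case: (im x).
  have [s [sa ne]] : exists s, blt s a.
    move: xV; rewrite inE xa => /asboolP[[s [sa _] _]|H]; first by exists s.
    by exists mset0; apply/H.
  have [s' s'E] : exists s', mmap root_vertex s' = s.
    by apply: mmap_surj => y _; apply/Asurj; rewrite inE.
  have : ble s' (ord0 : linear 1) by apply: Afull; rewrite s'E.
  case=> i s'i i0; apply: ne; rewrite -s'E s'i mmap1; congr [mset _].
  have -> : i = ord0 by apply/val_inj/eqP; rewrite -leqn0.
  by [].
- have : r \in [set e | `[< led e a >]].
    by apply/Asurj; exists (ord_max : linear 1).
  rewrite inE => /asboolP ra; apply: ur_neq.
  by apply: (led_anti simpleS) ra; exact: ur_rootP.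
Qed.

Definition root_vertex_horn : sub_gdset outer_horn (linear 1) :=
  exist _ root_vertex root_vertex_mem.

Lemma image_fixed (X : gdset gT) (f : gmap (sub_gdset outer_horn) X) g :
  dact g (f (linear 1) root_vertex_horn) = f (linear 1) root_vertex_horn.
Proof.
rewrite -gm_act; congr (f _ _); apply: sub_eq; exact: root_vertex_act.
Qed.

(** [f(v_r)], as a 1-simplex of [i^*(X^G)] *)
Definition image_root_vertex (X : gdset gT) (f : gmap (sub_gdset outer_horn) X) :
    istar (fixed X) 1 :=
  exist _ (f (linear 1) root_vertex_horn) (image_fixed f).

End OuterHorn.

(* Main.v *)
Require Import Defs.
From mathcomp Require Import all_boot all_fingroup.
From mathcomp Require Import boolp.
From mathcomp Require Import finmap multiset.

(** Let [F] be the forest above the edge [a], so that [S] is the join [F * [1]]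
    with [a] and [r] as the vertices [0] and [1] of the linear part. In general
    [F * [n]] is the tree with the linear tree [n] grafted under [F]. Its faces are
    of the form [F' * J], with [J] a part of the linear tree and [F'] a part of
    [F]. The outer horn consists of the faces [F' * [1]] with [F'] different from
    [F], and of [F * {1}]. The missing datum is a lift over [F * [1]] with a
    prescribed value at its vertex [1].

    Since [S] has a second vertex, [a] is not a leaf, and for [i < n] the vertex
    [i] of [F * [n]] is an inner edge. Lifts with a prescribed value at the
    vertex [0] are therefore a matter of inner horns, and the idea, which goes
    back to Joyal, is to exchange the two ends by means of an inverse of [f(v_r)].

    An inverse gives a simplex [rho] of dimension 3 in the fixed points of [X],
    with [f(v_r)] on the edges [01] and [03], the inverse on [12], and
    degenerate on [013] and [02] ([equivalence_simplex]). It lies over the chain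
    of [F * [3]]. The data of the horn and the map to [Y], made degenerate, are
    used on the parts [013] and [02] of the chain. Inner horns then provide
    values on all of [F * [3]] in [Y], and after this on [F' * [3]] in [X] for all
    proper [F'] ([join_lift]). It remains to treat [F] itself in [X]
    ([outer_horn_lift]). The value on [F * {1}] given by the horn is spread over
    [13] by a degeneracy and extended to [12] and [123] by horns at the vertex
    [1]. The value at the vertex [2] thus obtained is spread over [02], and a
    horn of [F * [023]] at the vertex [2] yields a value on [03]. This is the lift.

    Each step adds all faces [F' * J] and [F' * (J - i)], for given [J] and [i] and
    for [F'] in a given set of faces of [F] ([cell_extension]). The group fixes
    the chain, so that such a pair is attached together with its orbit along a
    generating horn of the G-tree induced from the stabiliser of [F' * J]
    ([attach_orbit]). To see which faces are present, every map of trees is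
    factored through its image ([image_factor]), and [F' * J] is recovered from a
    face [F' * J'] as a completion ([compl]).

    In place of [F * [3]], the chain is grafted under the whole of [S], and only
    faces avoiding [a] and [r] are considered ([off_root]). *)

Set Implicit Arguments.
Unset Strict Implicit.
Unset Printing Implicit Defensive.

Local Open Scope mset_scope.
Local Open Scope nat_scope.

(** * Multisets and broad relations *)

Lemma mset_elim (T : choiceType) (P : {mset T} -> Prop) :
  P mset0 -> (forall x A, P A -> P (x +` A)) -> forall A, P A.
Proof.
move=> P0 PS A; rewrite -[A]seq_mset_id; elim: (A : seq T) => [|x s IH].
  by rewrite (_ : seq_mset _ = mset0) //; apply/msetP => x; rewrite mset_seqE mset0E.
by rewrite mset_cons; exact: PS.
Qed.

Lemma mset_empty (T : choiceType) (A : {mset T}) : (forall x, x \notin A) -> A = mset0.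
Proof.
elim/mset_elim: A => // x A _ H; by have := H x; rewrite mset1D1.
Qed.

Lemma mset1DI (T : choiceType) (x : T) (A B : {mset T}) : x +` A = x +` B -> A = B.
Proof. by move=> /(congr1 (fun C : {mset T} => C `\ x)); rewrite !msetD1K. Qed.

Lemma msetD_eq1 (T : choiceType) (x y : T) (A : {mset T}) :
  x +` A = [mset y] -> x = y /\ A = mset0.
Proof.
move=> E; have xy : x = y by apply/mset1P; rewrite -E mset1D1.
by split=> //; apply: (@mset1DI _ x); rewrite E xy msetD0.
Qed.

Lemma msetD_eq0 (T : choiceType) (A B : {mset T}) :
  A `+` B = mset0 -> A = mset0 /\ B = mset0.
Proof.
by move=> E; split; apply: mset_empty => x; apply/negP => xA;
  have := in_mset0 x; rewrite -E in_msetD xA ?orbT.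
Qed.

Lemma uniq_mset1D (T : choiceType) (x : T) (A : {mset T}) :
  uniq (x +` A) -> x \notin A.
Proof.
move=> U; have := count_mem_mset x (x +` A); rewrite (count_uniq_mem _ U) mset1DE.
by rewrite eqxx mset1D1 add1n => -[/esym/mset_eq0P].
Qed.

Lemma uniq_msetD (T : choiceType) (x : T) (A B : {mset T}) :
  uniq (A `+` B) -> x \in A -> x \notin B.
Proof.
move=> U xA; move: U; rewrite -(msetB1K xA) -msetDA => /uniq_mset1D.
by rewrite in_msetD negb_or => /andP[].
Qed.

Lemma mmap_eq0 (T U : choiceType) (f : T -> U) A : mmap f A = mset0 -> A = mset0.
Proof.
move=> E; apply: mset_empty => x; apply/negP => /(mmap_mem f).
by rewrite E in_mset0.
Qed.

Lemma mmap_eq1 (T U : choiceType) (f : T -> U) A y :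
  mmap f A = [mset y] -> exists2 x, A = [mset x] & f x = y.
Proof.
move=> E; have : y \in mmap f A by rewrite E mset11.
case/mem_mmap => x xA yE; exists x => //.
rewrite -(msetB1K xA) mmapS yE in E *; case/msetD_eq1: E => _ /mmap_eq0 ->.
exact: msetD0.
Qed.

Lemma uniq_mmap_inj (T U : choiceType) (f : T -> U) (A : {mset T}) x y :
  uniq (mmap f A) -> x \in A -> y \in A -> f x = f y -> x = y.
Proof.
move=> U0 xA yA fxy; apply: contrapT => ne.
move: U0; rewrite -(msetB1K xA) mmapS => /uniq_mset1D/negP; apply.
rewrite fxy; apply: mmap_mem; move: yA; rewrite -{1}(msetB1K xA) in_mset1D.
by case/orP => // /eqP E; case: ne.
Qed.

Lemma eq_in_mmap (T U : choiceType) (f g : T -> U) (A : {mset T}) :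
  (forall x, x \in A -> f x = g x) -> mmap f A = mmap g A.
Proof.
elim/mset_elim: A => [|x A IH] H; rewrite ?mmap0 // !mmapS H ?mset1D1 // IH //.
by move=> y yA; apply: H; rewrite in_mset1D yA orbT.
Qed.

Lemma seteq_uniq_mset (T : choiceType) (s t : {mset T}) :
  uniq s -> uniq t -> (s : seq T) =i (t : seq T) -> s = t.
Proof.
by move=> su tu st; rewrite -(seq_mset_id s) -(seq_mset_id t);
  apply/eq_seq_msetP/uniq_perm.
Qed.

Section Blem.
Variables (T : choiceType) (le : {mset T} -> T -> Prop).

Lemma blem_inv s t x : blem le s t -> x \in t ->
  exists s1 s2, [/\ s = s1 `+` s2, le s1 x & blem le s2 (t `\ x)].
Proof.
move=> H; elim: H x => [|f e fs es fe H IH] x; first by rewrite in_mset0.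
rewrite in_mset1D; case: (eqVneq x e) => [-> _|ne /= xes].
  by exists f, fs; rewrite msetD1K.
have [s1 [s2 [-> s1x s2es]]] := IH _ xes.
exists s1, (f `+` s2); split=> //; first by rewrite msetDCA.
rewrite (_ : _ `\ x = e +` (es `\ x)); first exact: blem_cons.
by rewrite -{1}(msetB1K xes) msetDCA msetD1K.
Qed.

Lemma blem_invS s t x : blem le s (x +` t) ->
  exists s1 s2, [/\ s = s1 `+` s2, le s1 x & blem le s2 t].
Proof. by move=> /blem_inv /(_ (mset1D1 x t)); rewrite msetD1K. Qed.

Lemma mem_blem s t y : blem le s t -> y \in s ->
  exists x s1, [/\ x \in t, y \in s1 & le s1 x].
Proof.
move=> H; elim: H => [|f e fs es fe H IH]; first by rewrite in_mset0.
rewrite in_msetD => /orP[yf|/IH[x [s1 [xes ys1 s1x]]]].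
  by exists e, f; rewrite mset1D1.
by exists x, s1; rewrite in_mset1D xes orbT.
Qed.

(** Relations that lift along [h] at each single edge lift along [h] at tuples
    of edges; this is how transitivity passes to image faces. *)
Lemma blem_mmap (V : choiceType) (leV : {mset V} -> V -> Prop) (h : V -> T) s t :
  (forall u x, le u (h x) -> exists2 v, u = mmap h v & leV v x) ->
  blem le s (mmap h t) -> exists2 v, s = mmap h v & blem leV v t.
Proof.
move=> H; elim/mset_elim: t s => [|x t IH] s.
  by rewrite mmap0 => /blem0 ->; exists mset0; [rewrite mmap0 | exact: blem_nil].
rewrite mmapS => /blem_invS[s1 [s2 [-> /H[v1 -> v1x] /IH[v2 -> v2t]]]].
by exists (v1 `+` v2); [rewrite mmapD | exact: blem_cons].
Qed.

End Blem.

Section Ble.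
Variable P : broad_poset.
Implicit Types (e x y z : P) (s t u : {mset P}).

Lemma ble_subst x s t e : ble s x -> ble (x +` t) e -> ble (s `+` t) e.
Proof. by move=> sx; apply: ble_trans; apply: blem_cons sx _; exact: blem_refl. Qed.

Lemma ble_trans1 s x e : ble s x -> ble [mset x] e -> ble s e.
Proof. by move=> sx; rewrite -[[mset x]]msetD0 => /(ble_subst sx); rewrite msetD0. Qed.

Lemma led_refl e : led e e.
Proof. by exists [mset e]; [rewrite mset11 | exact: ble_refl]. Qed.

Lemma led_trans x y z : led x y -> led y z -> led x z.
Proof.
move=> [s xs sy] [t yt]; rewrite -(msetB1K yt) => /(ble_subst sy) H.
by exists (s `+` (t `\ y)) => //; rewrite in_msetD xs.
Qed.

Hypothesis sP : simple P.

(** Iterating [s <= e] with [e] a letter of [s] would repeat the other letters. *)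
Lemma simple_loop s e : ble s e -> e \in s -> s = [mset e].
Proof.
move=> se es; rewrite -(msetB1K es) in se *; set t := s `\ e in se *.
have := ble_subst se se => H; have t0 : t = mset0.
  apply: mset_empty => x; apply/negP => xt.
  have := @uniq_msetD _ x _ _ (sP H); rewrite in_mset1D xt orbT.
  by move=> /(_ isT).
by rewrite t0 msetD0.
Qed.

End Ble.

(** * Trees *)

Section Tree.
Variable T : tree.
Implicit Types (e x y z : T) (s t u : {mset T}).

Lemma tree_simple : simple T. Proof. by case: (treeP T). Qed.

Lemma tree_cases e : (forall s, ble s e -> s = [mset e]) \/ exists u, is_up u e.
Proof.
have [_ /(_ e) H _] := treeP T; case: H => [H|[u uP _]|H].
- by left=> s se; apply: contrapT => ne; apply: H; exists s.
- by right; exists u.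
right; exists mset0; split; first by apply/H.
by move=> t /H ->; exact: blem_nil.
Qed.

Lemma up_led u e x : is_up u e -> x \in u -> led x e.
Proof. by move=> [[ue _] _] xu; exists u. Qed.

Lemma up_neq u e x : is_up u e -> x \in u -> x <> e.
Proof.
by move=> [[ue ne] _] xu xe; apply: ne; apply: (simple_loop tree_simple) => //;
  rewrite -xe.
Qed.

Lemma led_up x e : led x e -> x <> e ->
  exists u x1, [/\ is_up u e, x1 \in u & led x x1].
Proof.
move=> [s xs se] ne; case: (tree_cases e) => [H|[u uP]].
  by move: xs; rewrite (H _ se) => /mset1P.
have [_ uM] := uP; have /uM su : blt s e.
  by split=> // E; move: xs; rewrite E => /mset1P.
have [x1 [s1 [x1u xs1 s1x1]]] := mem_blem su xs.
by exists u, x1; split=> //; exists s1.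
Qed.

Lemma tree_ind (Q : T -> Prop) :
  (forall e, (forall x, led x e -> x <> e -> Q x) -> Q e) -> forall e, Q e.
Proof.
move=> H e; have [n] := ubnP #|[set y : T | `[< led y e >]]|.
elim: n e => // n IH e; rewrite ltnS => en; apply: H => x xe ne; apply: IH.
apply: leq_trans en; apply: proper_card; apply/properP; split.
  by apply/subsetP => y; rewrite !inE => /asboolP yx; apply/asboolP/(led_trans yx).
exists e; first by rewrite inE; apply/asboolP/led_refl.
by rewrite inE; apply/asboolP => ex; apply: ne; exact: (led_anti tree_simple).
Qed.

(** Two incomparable edges separate at the lowest vertex above both, so that
    they occur together in a single broad relation. *)
Lemma tree_compare x y : [\/ led x y, led y x |
  exists s e, [/\ ble s e, x \in s, y \in s & x <> y]].
Proof.
have [r rP] := root_exists T; move: (rP x) (rP y) => {rP}.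
elim/(@tree_ind): r => e IH xe ye.
have [E|xne] := pselect (x = e); first by subst e; apply: Or32.
have [E|yne] := pselect (y = e); first by subst e; apply: Or31.
have [u [x1 [uP x1u xx1]]] := led_up xe xne.
have [y1 y1u yy1] : exists2 y1, y1 \in u & led y y1.
  have [u' [z [u'P zu' yz]]] := led_up ye yne.
  have [u'e _] := u'P; have [_ /(_ u' u'e) H] := uP.
  have [y1 [s1 [y1u zs1 s1y1]]] := mem_blem H zu'.
  by exists y1 => //; apply: led_trans yz _; exists s1.
have [E|ne] := pselect (x1 = y1).
  by subst y1; apply: (IH x1) => //; [exact: up_led uP x1u | exact: up_neq uP x1u].
have [sx xsx sxx1] := xx1; have [sy ysy syy1] := yy1.
have y1u' : y1 \in u `\ x1.
  by move: y1u; rewrite -{1}(msetB1K x1u) in_mset1D => /orP[/eqP/esym|].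
have [[ue _] _] := uP.
have E : ble (sx `+` (sy `+` (u `\ x1 `\ y1))) e.
  apply: ble_subst sxx1 _; rewrite msetDCA; apply: ble_subst syy1 _.
  by rewrite msetDCA !msetB1K.
have xy : x <> y.
  move=> xy; subst y; have := uniq_msetD (tree_simple E) xsx.
  by rewrite in_msetD ysy.
by apply: Or33; exists (sx `+` (sy `+` (u `\ x1 `\ y1))), e;
  rewrite !in_msetD xsx ysy !orbT.
Qed.

(** The hypothesis makes all vertices between [e] and [x] unary: a side branch,
    even one that ends in stumps, would give a relation at [e] containing [x]
    and another edge. Going up from [e], a relation can therefore only stop on
    the path to [x] or pass through [x]. *)
Lemma unary_path x e s : led x e ->
  (forall t, ble t e -> x \in t -> t = [mset x]) -> ble s e ->
  ble s x \/ exists2 z, s = [mset z] & led x z.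
Proof.
elim/tree_ind: e s => e IH s xe unary se.
have [E|ne] := pselect (x = e); first by left; rewrite E.
have [u [x1 [uP x1u xx1]]] := led_up xe ne.
have uE : u = [mset x1].
  have [sx xsx sxx1] := xx1; have [[ue _] _] := uP.
  have : ble (sx `+` (u `\ x1)) e by apply: ble_subst sxx1 _; rewrite msetB1K.
  move=> /unary; rewrite in_msetD xsx => /(_ isT).
  rewrite -(msetB1K xsx) -msetDA => /msetD_eq1[_] /msetD_eq0[_ u0].
  by rewrite -(msetB1K x1u) u0 msetD0.
have [E|sne] := pselect (s = [mset e]); first by right; exists e.
have [[ue _] uM] := uP.
have := uM s (conj se sne); rewrite uE => /blem1 sx1.
apply: (IH x1) => //; first exact: up_led uP x1u.
  exact: up_neq uP x1u.
by move=> t tx1 xt; apply: unary => //; apply: ble_trans1 tx1 _; rewrite -uE.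
Qed.

End Tree.

(** * Images of maps of trees *)

(** The image face of [h], described by its relations. These also determine its
    edges: [e] is in the image if and only if [e <= e] is traced. *)
Definition traced (U T : tree) (h : bmap U T) (s : {mset T}) (e : T) :=
  exists s' e', [/\ s = mmap h s', e = h e' & ble s' e'].

(** Inclusion of image faces, for maps with different sources. *)
Definition image_le (U' U T : tree) (h' : bmap U' T) (h : bmap U T) :=
  forall s e, traced h' s e -> traced h s e.

Section Image.
Variables (U T : tree) (h : bmap U T).
Implicit Types (x y z : U).

Lemma traced_ble s e : traced h s e -> ble s e.
Proof. by move=> [s' [e' [-> -> /bmapP]]]. Qed.

Lemma traced_map s e : ble s e -> traced h (mmap h s) (h e).
Proof. by exists s, e. Qed.

Lemma traced_refl x : traced h [mset h x] (h x).
Proof. by rewrite -mmap1; apply/traced_map/ble_refl. Qed.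

Lemma traced_mem s e (x : T) : traced h s e -> x \in s -> exists u, h u = x.
Proof. by move=> [s' [e' [-> _ _]]] /mem_mmap[u _ ->]; exists u. Qed.

Lemma uniq_map_ble s e : ble s e -> uniq (mmap h s).
Proof. by move=> /(bmapP h)/tree_simple. Qed.

Lemma fib_compare x y : h x = h y -> led x y \/ led y x.
Proof.
move=> xy; case: (tree_compare x y) => [||[s [e [/uniq_map_ble U0 xs ys []]]]]; auto.
exact: uniq_mmap_inj U0 xs ys xy.
Qed.

Lemma fib_unary x y s : h x = h y -> ble s y -> x \in s -> s = [mset x].
Proof.
move=> xy sy xs; have /(simple_loop (@tree_simple T)) := bmapP h sy.
rewrite -{1}xy => /(_ (mmap_mem h xs)) /mmap_eq1[z sz _].
by move: xs; rewrite sz => /mset1P ->.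
Qed.

(** A fibre of [h] is a chain of unary vertices, so a relation at one of its
    edges has the same image as a relation at any other one. *)
Lemma traced_local s x : traced h s (h x) -> exists2 s', s = mmap h s' & ble s' x.
Proof.
move=> [s' [y [-> xy s'y]]].
have [yx|xy'] := fib_compare (esym xy); last first.
  have [H|[z sz xz]] := unary_path xy' (fun t => @fib_unary x y t xy) s'y.
    by exists s'.
  exists [mset x]; last exact: ble_refl.
  rewrite sz in s'y *.
  rewrite !mmap1; congr [mset _]; apply: (led_anti (@tree_simple T));
    last exact: bmap_led.
  by rewrite xy; apply: bmap_led; exists [mset z] => //; rewrite mset11.
exists s' => //; have [t yt tx] := yx.
by apply: ble_trans1 s'y _; rewrite -(fib_unary (esym xy) tx yt).
Qed.


Definition img_edge : finType := {y : T | y \in codom h}.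
Definition to_img (u : U) : img_edge := exist _ (h u) (codom_f h u).
Definition img_ble (s : {mset img_edge}) (e : img_edge) :=
  exists s' x, [/\ s = mmap to_img s', e = to_img x & ble s' x].

Lemma val_img_inj : injective (fun y : img_edge => val y). Proof. exact: val_inj. Qed.

Lemma img_local s x : img_ble s (to_img x) ->
  exists2 s', s = mmap to_img s' & ble s' x.
Proof.
move=> [s' [y [-> /(congr1 val)/= xy s'y]]].
have [|t tE tx] := @traced_local (mmap h s') x; first by rewrite xy; exact: traced_map.
exists t => //; apply: (mmap_inj val_img_inj); rewrite !mmap_comp.
exact: tE.
Qed.

Lemma to_img_surj (e : img_edge) : exists x, to_img x = e.
Proof. by case: e => y /[dup] /codomP[x yE] yc; exists x; apply: val_inj. Qed.

Lemma img_ble_refl e : img_ble [mset e] e.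
Proof.
have [x <-] := to_img_surj e; exists [mset x], x; rewrite mmap1; split=> //.
exact: ble_refl.
Qed.

Lemma img_ble_val s e : img_ble s e -> ble (mmap val s) (val e).
Proof. by move=> [s' [x [-> -> /(bmapP h)]]]; rewrite mmap_comp. Qed.

Lemma img_ble_anti e f : img_ble [mset e] f -> img_ble [mset f] e -> e = f.
Proof.
by move=> /img_ble_val + /img_ble_val; rewrite !mmap1 => ef fe; apply/val_inj/ble_anti.
Qed.

Lemma img_ble_blem s t : blem img_ble s (mmap to_img t) ->
  exists2 s', s = mmap to_img s' & blem (@ble U) s' t.
Proof. by apply: blem_mmap => u x; exact: img_local. Qed.

Lemma img_ble_trans gs fs e : blem img_ble gs fs -> img_ble fs e -> img_ble gs e.
Proof.
move=> H [f' [x [fE -> f'x]]]; move: H; rewrite fE => /img_ble_blem[g' -> H].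
by exists g', x; split=> //; exact: ble_trans f'x.
Qed.

Definition img_bp := BroadPoset img_ble_refl img_ble_anti img_ble_trans.

(** Within a fibre one descends until the vertex is no longer collapsed; that
    vertex, or leaf, is the one of the image. *)
Lemma img_cases (x : U) :
  (forall s, img_ble s (to_img x) -> s = [mset to_img x]) \/
  exists u, @is_up img_bp u (to_img x).
Proof.
elim/(@tree_ind): x => x IH; have [H|[u uP]] := tree_cases x.
  by left=> s /img_local[s' -> /H ->]; rewrite mmap1.
have [E|ne] := pselect (mmap to_img u = [mset to_img x]).
  have [z uz zx] := mmap_eq1 E; rewrite -zx; apply: IH.
    by apply: up_led uP _; rewrite uz mset11.
  by apply: up_neq uP _; rewrite uz mset11.
right; exists (mmap to_img u); have [[ux _] uM] := uP; split.
  by split=> //; exists u, x.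
move=> t [/img_local[t' -> t'x] tne].
have /uM : blt t' x by split=> // tE; apply: tne; rewrite tE mmap1.
elim=> [|f e fs es fe _ IH']; first by rewrite mmap0; exact: blem_nil.
by rewrite mmapD mmapS; apply: blem_cons => //; exists f, e.
Qed.

Lemma img_tree : is_tree img_bp.
Proof.
split=> [s e|e|].
- move=> /img_ble_val/tree_simple; rewrite (perm_uniq (perm_eq_seq_mset _)).
  exact: map_uniq.
- have [x <-] := to_img_surj e; have [H|[u uP]] := img_cases x.
    by apply: Or31 => -[s [sx]]; apply; exact: H.
  have [u0|ne] := pselect (u = mset0); last by apply: Or32; exists u.
  apply: Or33 => s; have [ux uM] := uP; split=> [/uM|->]; last by rewrite -u0.
  by rewrite u0 => /blem0.
exists (to_img (troot U)) => e; have [x <-] := to_img_surj e.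
have [s xs sr] := trootP x; exists (mmap to_img s); first exact: mmap_mem.
by exists s, (troot U).
Qed.

End Image.

(** The factorisation into a degeneracy and a face. All that is used of the
    degeneracy is that it reaches every relation. *)
Lemma image_factor (U T : tree) (h : bmap U T) :
  exists (A : tree) (i : bmap A T) (q : bmap U A),
    [/\ injective i, h = bcomp i q & forall s e, ble s e -> traced q s e].
Proof.
have iP s (e : img_bp h) : ble s e -> ble (mmap val s) (val e) by exact: img_ble_val.
have qP s (e : U) : ble s e -> @ble (img_bp h) (mmap (to_img h) s) (to_img h e).
  by exists s, e.
exists (Tree (img_tree h)), (@BMap (Tree (img_tree h)) T _ iP).
exists (@BMap U (Tree (img_tree h)) _ qP); split=> //; first exact: val_inj.
exact: bmap_eq.
Qed.

Lemma bcompA (P Q R Z : broad_poset) (a : bmap R Z) (b : bmap Q R) (c : bmap P Q) :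
  bcomp a (bcomp b c) = bcomp (bcomp a b) c.
Proof. exact: bmap_eq. Qed.

Lemma traced_comp (U V T : tree) (g : bmap V T) (k : bmap U V) s e :
  traced (bcomp g k) s e <-> exists s' e', [/\ s = mmap g s', e = g e' & traced k s' e'].
Proof.
split=> [[s' [e' [-> -> H]]]|[s' [e' [-> -> [t [x [-> -> H]]]]]]].
  by exists (mmap k s'), (k e'); rewrite mmap_comp; split=> //; exact: traced_map.
by exists t, x; rewrite mmap_comp.
Qed.

Section Tle.
Variables (T : tree).

Lemma image_le_trans (U V W : tree) (f : bmap U T) (g : bmap V T) (h : bmap W T) :
  image_le f g -> image_le g h -> image_le f h.
Proof. by move=> fg gh s e /fg/gh. Qed.

Lemma image_le_comp (U V : tree) (g : bmap V T) (k : bmap U V) : image_le (bcomp g k) g.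
Proof.
by move=> s e /traced_comp[s' [e' [-> -> /traced_ble]]]; exact: traced_map.
Qed.

Lemma image_le_post (U V T' : tree) (f : bmap U T) (g : bmap V T) (m : bmap T T') :
  image_le f g -> image_le (bcomp m f) (bcomp m g).
Proof.
move=> fg s e /traced_comp[s' [e' [-> -> /fg H]]].
by apply/traced_comp; exists s', e'.
Qed.

Lemma image_le_mem (U V : tree) (f : bmap U T) (g : bmap V T) u :
  image_le f g -> exists v, g v = f u.
Proof. by move=> /(_ _ _ (traced_refl f u))[s [e [_ ->]]]; exists e. Qed.

Lemma image_le_factor (U A : tree) (f : bmap U T) (i : bmap A T) :
  injective i -> image_le f i -> exists k, f = bcomp i k.
Proof.
move=> iI fi; have /choice[k kE] u : exists a, i a = f u by exact: image_le_mem fi.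
have kP s e : ble s e -> ble (mmap k s) (k e).
  move=> /(traced_map f)/fi[s' [e' [sE eE H]]].
  have -> : k e = e' by apply: iI; rewrite kE.
  suff -> : mmap k s = s' by [].
  by apply: (mmap_inj iI); rewrite mmap_comp -sE; apply: eq_mmap => u /=.
by exists (BMap kP); apply: bmap_eq => u /=; rewrite kE.
Qed.

(** The image face of a map outside the horn is itself an excluded face, because
    the map factors through it; this turns horn membership into a statement
    on traced relations. *)
Lemma not_in_horn (U : tree) (excl : {set T} -> Prop) (h : bmap U T) :
  ~ in_horn excl h -> exists A, [/\ excl A, forall x, x \in A <-> exists u, h u = x
    & forall s e, ble s e -> e \in A -> (forall x, x \in s -> x \in A) -> traced h s e].
Proof.
have [A [i [q [iI -> qF]]]] := image_factor h; move=> H.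
apply: contrapT => H'; apply: H; exists A, i, q; split=> // E exclE [im full].
have imq x : x \in E <-> exists u, bcomp i q u = x.
  split=> [/im[a <-]|[u <-]]; last by apply/im; exists (q u).
  by have [s [e [_ -> _]]] := qF _ _ (ble_refl a); exists e.
apply: H'; exists E; split=> // s e se /im[a ea] sE.
have [t tE] : exists t, mmap i t = s by apply: mmap_surj => y /sE/im.
apply/traced_comp; exists t, a; split=> //; apply: qF; apply: full.
by rewrite tE ea.
Qed.

End Tle.

Arguments image_le_comp {T U V} g k.
Arguments image_le_post {T U V T' f g} m fg.

(** * Partial lifts *)

(** Lifts defined on a part of [C] are encoded by their graphs: gluing becomes
    union, and the domains need not be made into presheaves. *)
Record partial_lift (gT : finGroupType) (C X Y : gdset gT) (p : gmap X Y)
    (y : gmap C Y) (G : forall U : tree, C U -> X U -> Prop) : Prop := PartialLift {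
  pl_fun : forall U c x x', G U c x -> G U c x' -> x = x';
  pl_res : forall (U V : tree) (f : bmap U V) c x, G V c x -> G U (dres f c) (dres f x);
  pl_act : forall U g c x, G U c x -> G U (dact g c) (dact g x);
  pl_over : forall U c x, G U c x -> p U x = y U c
}.

Definition defd (gT : finGroupType) (C X : gdset gT)
  (G : forall U : tree, C U -> X U -> Prop) (U : tree) (c : C U) :=
  exists x, G U c x.

Section PartialLift.
Variables (gT : finGroupType) (C X Y : gdset gT) (p : gmap X Y) (y : gmap C Y).
Implicit Types G : forall U : tree, C U -> X U -> Prop.

Lemma partial_lift_union G1 G2 :
  partial_lift p y G1 -> partial_lift p y G2 ->
  (forall U c x x', G1 U c x -> G2 U c x' -> x = x') ->
  partial_lift p y (fun U c x => G1 U c x \/ G2 U c x).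
Proof.
move=> P1 P2 H; split=> [U c x x' [H1|H1] [H2|H2]|U V f c x|U g c x|U c x].
- exact: (pl_fun P1 H1 H2).
- exact: (H _ _ _ _ H1 H2).
- exact/esym/(H _ _ _ _ H2 H1).
- exact: (pl_fun P2 H1 H2).
- by case=> H1; [left|right]; [exact: (pl_res P1 f H1)|exact: (pl_res P2 f H1)].
- by case=> H1; [left|right]; [exact: (pl_act P1 g H1)|exact: (pl_act P2 g H1)].
- by case=> H1; [exact: (pl_over P1 H1)|exact: (pl_over P2 H1)].
Qed.

Lemma partial_lift_fun (D : forall U : tree, C U -> Prop) (F : forall U : tree,
  C U -> X U) :
  (forall (U V : tree) (f : bmap U V) c, D V c ->
    D U (dres f c) /\ F U (dres f c) = dres f (F V c)) ->
  (forall (U : tree) g c, D U c -> D U (dact g c) /\ F U (dact g c) = dact g (F U c)) ->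
  (forall (U : tree) c, D U c -> p U (F U c) = y U c) ->
  partial_lift p y (fun U c x => D U c /\ x = F U c).
Proof.
move=> Hr Ha Ho; split=> [U c x x' [_ ->]
  [_ ->]|U V f c x [Dc ->]|U g c x [Dc ->]|U c x [Dc ->]] //.
- by have [] := Hr U V f c Dc.
- by have [] := Ha U g c Dc.
exact: Ho.
Qed.

Lemma partial_lift_restrict G (Q : forall U : tree, C U -> Prop) :
  (forall (U V : tree) (f : bmap U V) c, Q V c -> Q U (dres f c)) ->
  (forall U g c, Q U c -> Q U (dact g c)) ->
  partial_lift p y G -> partial_lift p y (fun U c x => Q U c /\ G U c x).
Proof.
move=> Qr Qa P; split=> [U c x x' [_ H1]
  [_ H2]|U V f c x [q H]|U g c x [q H]|U c x [_ H]].
- exact: (pl_fun P H1 H2).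
- by split; [exact: Qr | exact: (pl_res P f H)].
- by split; [exact: Qa | exact: (pl_act P g H)].
- exact: (pl_over P H).
Qed.

Lemma partial_lift_total (D : gdset gT) (m : gmap D C) G : partial_lift p y G ->
  (forall U d, defd G (m U d)) ->
  exists l : gmap D X, forall U d, G U (m U d) (l U d).
Proof.
move=> P H; pose l U d := sval (cid (H U d)); have lP U d := svalP (cid (H U d)).
have l_res (U V : tree) (f : bmap U V) d : l U (dres f d) = dres f (l V d).
  apply: (pl_fun P (lP _ _)); rewrite gm_res; exact: (pl_res P f (lP _ _)).
have l_act U g d : l U (dact g d) = dact g (l U d).
  apply: (pl_fun P (lP _ _)); rewrite gm_act; exact: (pl_act P g (lP _ _)).
by exists (GMap l_res l_act).
Qed.

(** The two conditions on [m] say that the union of the domain with the image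
    of [m] is the pushout of the domain and [B] along [A]. *)
Lemma partial_lift_push (B : gdset gT) (A : gsub B) (m : gmap B C) G :
  has_rlp (sub_incl A) p -> partial_lift p y G ->
  (forall U b, gs_mem A b <-> defd G (m U b)) ->
  (forall U b b', ~ gs_mem A b -> m U b = m U b' -> b = b') ->
  exists G', [/\ partial_lift p y G', forall U c x, G U c x -> G' U c x
    & forall U c, defd G' c <-> defd G c \/ exists b, c = m U b].
Proof.
move=> rlp P mA mI.
have mP U (b : sub_gdset A U) : defd G (m U (sub_incl A U b)).
  by apply/mA; exact: svalP.
have mj_res (U V : tree) (f : bmap U V) (b : sub_gdset A V) :
  m U (sub_incl A U (dres f b)) = dres f (m V (sub_incl A V b)) by rewrite -gm_res.
have mj_act U g (b : sub_gdset A U) :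
  m U (sub_incl A U (dact g b)) = dact g (m U (sub_incl A U b)) by rewrite -gm_act.
have [f fP] := @partial_lift_total _ (GMap mj_res mj_act) _ P mP.
have ym_res (U V : tree) (k : bmap U V) b : y U (m U (dres k b)) = dres k (y V (m V b)).
  by rewrite !gm_res.
have ym_act U g b : y U (m U (dact g b)) = dact g (y U (m U b)) by rewrite !gm_act.
have [|l [lA lB]] := rlp f (GMap ym_res ym_act).
  by move=> U b; exact: (pl_over P (fP U b)).
have lG U b x : G U (m U b) x -> l U b = x.
  move=> H; have bA : gs_mem A b by apply/mA; exists x.
  rewrite (lA U (exist _ b bA)); exact: (pl_fun P (fP U (exist _ b bA)) H).
exists (fun U c x => G U c x \/ exists2 b, c = m U b & x = l U b); split.
- apply: partial_lift_union => //.
    split=> [U c x x' [b -> ->] [b' bb' ->]|U V k c x [b -> ->]|U g c x [b ->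
      ->]|U c x [b -> ->]].
    + have [bA|bA] := pselect (gs_mem A b); last by rewrite (mI _ _ _ bA bb').
      have [z zP] := (mA U b).1 bA; rewrite (lG _ _ _ zP).
      by apply/esym/lG; rewrite -bb'.
    + by exists (dres k b); rewrite gm_res.
    + by exists (dact g b); rewrite gm_act.
    + by rewrite lB.
  by move=> U c x x' H [b cE ->]; apply/esym/lG; rewrite -cE.
- by move=> U c x; left.
- move=> U c; split=> [[x [H|[b -> _]]]|[[x H]|[b ->]]].
  + by left; exists x.
  + by right; exists b.
  + by exists x; left.
  + by exists (l U b); right; exists b.
Qed.

End PartialLift.

Lemma partial_lift_pull (gT : finGroupType) (C C' X Y : gdset gT) (p : gmap X Y) (y :
  gmap C Y) (y' : gmap C' Y)
    (m : gmap C' C) (D : forall U : tree, C' U -> Prop) (G : forall U : tree, C U ->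
      X U -> Prop) :
  (forall (U V : tree) (f : bmap U V) c, D V c -> D U (dres f c)) ->
  (forall U g c, D U c -> D U (dact g c)) ->
  (forall U c, D U c -> y U (m U c) = y' U c) ->
  partial_lift p y G -> partial_lift p y' (fun U c x => D U c /\ G U (m U c) x).
Proof.
move=> Dr Da Dy P; split=> [U c x x' [_ H1]
  [_ H2]|U V f c x [Dc H]|U g c x [Dc H]|U c x [Dc H]].
- exact: (pl_fun P H1 H2).
- by split; [exact: Dr | rewrite gm_res; exact: (pl_res P f H)].
- by split; [exact: Da | rewrite gm_act; exact: (pl_act P g H)].
- by rewrite (pl_over P H) Dy.
Qed.

(** * Attaching an orbit of inner horns *)

Section Attach.
Variables (gT : finGroupType) (W : tree_act gT) (A : tree) (i : bmap A W) (xi : A).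
Hypothesis iI : injective i.
Hypothesis xi_fixed : forall g, ta_act W g (i xi) = i xi.

(** The stabiliser of the face [i], with its action on the tree [A]. The orbit of
    the face is indexed by the cosets of the stabiliser; each coset contributes
    a copy of [A], placed in [W] by the chosen representative of the coset. *)
Definition stab : {set gT} :=
  [set g | `[< exists al : bmap A A, forall x, ta_act W g (i x) = i (al x) >]].

Lemma stab_act g h x : ta_act W (g * h)%g x = ta_act W g (ta_act W h x).
Proof. by rewrite Defs.gactM. Qed.

Lemma stab_group_set : group_set stab.
Proof.
apply/group_setP; split=> [|g h].
  by rewrite inE; apply/asboolP; exists (bid A) => x; rewrite Defs.gact1.
rewrite !inE => /asboolP[a aP] /asboolP[b bP]; apply/asboolP.
by exists (bcomp a b) => x; rewrite stab_act bP aP.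
Qed.
Canonical stab_group := Group stab_group_set.

Lemma stab_map_ex g : exists al : bmap A A,
  g \in stab -> forall x, ta_act W g (i x) = i (al x).
Proof.
have [|ng] := boolP (g \in stab); last by exists (bid A).
by rewrite inE => /asboolP[al alP]; exists al.
Qed.
Definition stab_map g : bmap A A := sval (cid (stab_map_ex g)).
Lemma stab_mapP g x : g \in stab -> i (stab_map g x) = ta_act W g (i x).
Proof. by move=> H; rewrite (svalP (cid (stab_map_ex g)) H). Qed.

Lemma stab_map_root g : g \in stab -> stab_map g (troot A) = troot A.
Proof.
move=> gH; apply: root_uniq (@trootP A) => e.
have -> : e = stab_map g (stab_map g^-1%g e).
  by apply: iI; rewrite !stab_mapP ?groupV // Defs.gactKV.
exact: bmap_led (trootP _).
Qed.

Lemma stab_map_xi g : g \in stab -> stab_map g xi = xi.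
Proof. by move=> gH; apply: iI; rewrite stab_mapP // xi_fixed. Qed.

Definition translate : finType := {C : {set gT} | C \in lcosets stab_group [set: gT]}.
Definition trepr (C : translate) : gT := repr (val C).

Lemma val_translate (C : translate) : val C = (trepr C *: stab_group)%g.
Proof.
rewrite /trepr; case: C => C /= /lcosetsP[x _ ->]; apply/esym/lcoset_eqP.
by apply: (mem_repr x); rewrite lcoset_refl.
Qed.

Lemma mem_trepr (C : translate) g : (g \in val C) = ((trepr C)^-1 * g \in stab)%g.
Proof. by rewrite val_translate mem_lcoset. Qed.

Lemma translate_act_subproof g (C : translate) :
  (g *: val C)%g \in lcosets stab_group [set: gT].
Proof.
case: C => C /= /lcosetsP[x _ ->]; apply/lcosetsP; exists (g * x)%g; rewrite ?inE //.
by rewrite lcosetM.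
Qed.
Definition translate_act g (C : translate) : translate :=
  exist (fun C : {set gT} => C \in lcosets stab_group [set: gT]) _
    (translate_act_subproof g C).

Definition translate_step g (C : translate) :=
  ((trepr (translate_act g C))^-1 * (g * trepr C))%g.
Lemma translate_step_stab g C : translate_step g C \in stab.
Proof.
rewrite -mem_trepr /= mem_lcoset mulKg mem_trepr mulVg; exact: group1.
Qed.

Definition orbit_forest : forest := Forest (fun _ : translate => A).
Definition oedge (C : translate) (x : A) : orbit_forest :=
  existT (fun _ : translate => edge A) C x.

Definition orbit_incl_fun (z : orbit_forest) : W :=
  ta_act W (trepr (tag z)) (i (tagged z)).
Lemma orbit_incl_subproof s z :
  ble s z -> ble (mmap orbit_incl_fun s) (orbit_incl_fun z).
Proof.
move=> [t -> tz]; rewrite mmap_comp.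
exact: (bmapP (bcomp (ta_act W (trepr (tag z))) i)).
Qed.
Definition orbit_incl : bmap orbit_forest W := BMap orbit_incl_subproof.

Lemma orbit_incl_inj z z' : tag z = tag z' -> orbit_incl z = orbit_incl z' -> z = z'.
Proof.
case: z z' => [C x] [C' x'] /= CC; subst C'.
by move=> /gact_inj/iI /= ->.
Qed.

Definition orbit_act_fun g (z : orbit_forest) : orbit_forest :=
  oedge (translate_act g (tag z)) (stab_map (translate_step g (tag z)) (tagged z)).
Lemma orbit_act_subproof g s z :
  ble s z -> ble (mmap (orbit_act_fun g) s) (orbit_act_fun g z).
Proof.
move=> [t -> tz].
exists (mmap (stab_map (translate_step g (tag z))) t); first by rewrite !mmap_comp.
exact: bmapP.
Qed.
Definition orbit_act g : bmap orbit_forest orbit_forest := BMap (@orbit_act_subproof g).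

Lemma orbit_incl_act g z : orbit_incl (orbit_act g z) = ta_act W g (orbit_incl z).
Proof.
rewrite /= /orbit_incl_fun /= stab_mapP ?translate_step_stab //.
by rewrite -!stab_act mulKVg.
Qed.

Lemma orbit_act1 : orbit_act 1%g = bid orbit_forest.
Proof.
apply: bmap_eq => z; apply: orbit_incl_inj; last by rewrite orbit_incl_act Defs.gact1.
by apply: val_inj; rewrite /= lcoset1.
Qed.

Lemma orbit_actM g h : orbit_act (g * h)%g = bcomp (orbit_act g) (orbit_act h).
Proof.
apply: bmap_eq => z; apply: orbit_incl_inj.
  by apply: val_inj; rewrite /= lcosetM.
by rewrite -[RHS]/(orbit_incl (orbit_act g (orbit_act h z))) !orbit_incl_act stab_act.
Qed.

Definition orbit_gaction := GAction orbit_act1 orbit_actM.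

Lemma translate1_subproof : stab \in lcosets stab_group [set: gT].
Proof. by apply/lcosetsP; exists 1%g; rewrite ?inE // lcoset1. Qed.
Definition translate1 : translate := 
  exist (fun C : {set gT} => C \in lcosets stab_group [set: gT]) _
    translate1_subproof.

Lemma translate1_trans (C : translate) : exists g, translate_act g translate1 = C.
Proof. by case: C => C /[dup] /lcosetsP[g _ E] CH; exists g; apply: val_inj. Qed.

Lemma orbit_roots (y : orbit_forest) :
  is_froot y <-> exists g, y = orbit_act g (oedge translate1 (troot A)).
Proof.
split=> [|[g ->]].
  case: y => C e eroot; have [g gC] := translate1_trans C; exists g.
  rewrite /= /orbit_act_fun /= gC stab_map_root ?translate_step_stab //.
  have eE : e = troot A := root_uniq eroot (@trootP A).
  by rewrite eE.
by rewrite /is_froot /= stab_map_root ?translate_step_stab //; exact: trootP.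
Qed.

Definition orbit_gtree : gtree gT :=
  @GTree gT orbit_forest orbit_gaction (ex_intro _ _ orbit_roots).

(** As [xi] is fixed in [W], its orbit meets every copy of [A] exactly in [xi], so
    that the horn of the induced G-tree is componentwise the horn of [A]. *)
Definition orbit_xi : orbit_gtree := oedge translate1 xi.

Lemma orbit_in_xi (C : translate) : @orbit_in _ orbit_gtree orbit_xi C = [set xi].
Proof.
apply/setP => x; rewrite !inE; apply/imsetP/eqP => [[g _ E]|->].
  have {}E : oedge C x = orbit_act g orbit_xi := E.
  have := congr1 (fun z : orbit_forest => tagged z) E => /= ->.
  by rewrite stab_map_xi // translate_step_stab.
have [g gC] := translate1_trans C; exists g => //.
rewrite /= /orbit_act_fun /= gC stab_map_xi // translate_step_stab //.
Qed.

Definition orbit_rep_fun (U : tree) (b : rep_gtree orbit_gtree U) : rep_tree W U :=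
  bcomp orbit_incl (fjoin b).
Lemma orbit_rep_res (U V : tree) (f : bmap U V) (b : rep_gtree orbit_gtree V) :
  orbit_rep_fun (dres f b) = dres f (orbit_rep_fun b).
Proof. exact: bmap_eq. Qed.
Lemma orbit_rep_act (U : tree) g (b : rep_gtree orbit_gtree U) :
  orbit_rep_fun (dact g b) = dact g (orbit_rep_fun b).
Proof.
rewrite (_ : dact g b = fsplit (bcomp (orbit_act g) (fjoin b))) // /orbit_rep_fun fsplitK.
by apply: bmap_eq => u; exact: orbit_incl_act.
Qed.
Definition orbit_rep := GMap orbit_rep_res orbit_rep_act.

(** The translates of the face [i] form the G-tree induced from the stabiliser,
    and attaching its inner horn attaches all translates at once. The last
    hypothesis keeps different translates from overlapping outside the horns. *)
Lemma attach_orbit (X Y : gdset gT) (p : gmap X Y) (y : gmap (rep_tree W) Y)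
    (G : forall U : tree, rep_tree W U -> X U -> Prop) :
  is_inner xi -> g_inner_fibration p -> partial_lift p y G ->
  (forall (U : tree) (k : bmap U A), in_horn (inner_excl [set xi]) k <->
    defd G (bcomp i k)) ->
  (forall (U : tree) g (k k' : bmap U A), ~ in_horn (inner_excl [set xi]) k ->
    bcomp (ta_act W g) (bcomp i k) = bcomp i k' -> 
    exists al : bmap A A, forall x, ta_act W g (i x) = i (al x)) ->
  exists G' : forall U : tree, rep_tree W U -> X U -> Prop, [/\ partial_lift p y G', 
    forall U c x, G U c x -> G' U c x
    & forall (U : tree) (c : bmap U W), defd G' c <-> 
        defd G c \/ exists g k, c = bcomp (ta_act W g) (bcomp i k)].
Proof.
move=> xi_inner pF P hA hS.
have Gact (U : tree) g (c : rep_tree W U) : defd G (dact g c) <-> defd G c.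
  split=> -[x H]; last by exists (dact g x); exact: (pl_act P g H).
  by exists (dact g^-1%g x); have := pl_act P g^-1%g H; rewrite -dactM mulVg dact1.
have repE (U : tree) C (k : bmap U A) :
  orbit_rep U (existT _ C k) = dact (trepr C) (bcomp i k : rep_tree W U).
  exact: bmap_eq.
have hornE (U : tree) C (k : bmap U A) :
    gs_mem (inner_horn orbit_xi) (existT _ C k : rep_gtree orbit_gtree U) <->
    in_horn (inner_excl [set xi]) k.
  by rewrite /= /ihorn_mem /= (_ : orbit_in orbit_xi C = [set xi]) // orbit_in_xi.
have mA (U : tree) (b : rep_gtree orbit_gtree U) :
    gs_mem (inner_horn orbit_xi) b <-> defd G (orbit_rep U b).
  by case: b => C k; rewrite repE Gact -hA hornE.
have mI (U : tree) (b b' : rep_gtree orbit_gtree U) :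
    ~ gs_mem (inner_horn orbit_xi) b -> orbit_rep U b = orbit_rep U b' -> b = b'.
  case: b b' => [C k] [C' k']; rewrite hornE !repE => nk E.
  have E' : bcomp (ta_act W ((trepr C')^-1 * trepr C)%g) (bcomp i k) = bcomp i k'.
    have := congr1 (dact (trepr C')^-1%g) E; rewrite -!dactM mulVg dact1 => <-.
    exact: bmap_eq.
  have sC : ((trepr C')^-1 * trepr C)%g \in stab.
    by rewrite inE; apply/asboolP; exact: hS E'.
  have CC : C = C'.
    apply: val_inj; rewrite (val_translate C) (val_translate C').
    by apply/lcoset_eqP; rewrite mem_lcoset.
  subst C'; congr existT; apply: bmap_eq => u; apply: iI.
  have := congr1 (fun h : bmap U W => h u) E'; rewrite /= mulVg Defs.gact1 /= => <-.
  by [].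
have [G' [P' sub G'E]] := partial_lift_push (pF orbit_gtree orbit_xi xi_inner) P mA mI.
exists G'; split=> // U c; rewrite G'E; split=> -[H|].
- by left.
- by move=> [[C k] ->]; right; exists (trepr C), k; exact: repE.
- by left.
move=> [g [k ->]]; right.
pose C := translate_act g translate1.
have H : ((trepr C)^-1 * g)%g \in stab.
  by rewrite -mem_trepr /= mem_lcoset mulVg; exact: (group1 stab_group).
exists (existT _ C (bcomp (stab_map ((trepr C)^-1 * g)%g) k)); rewrite repE.
apply: bmap_eq => u /=; rewrite stab_mapP // -stab_act mulKVg //.
Qed.

End Attach.

(** * Grafting a chain under the root *)

Section Ext.
Variables (n : nat) (T : tree).
Local Notation edges := (edge T + 'I_n.+1)%type.

(** The linear tree [0 < ... < n] is grafted under the root: [n] becomes the new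
    root, and each edge of the chain inherits the relations at the old one. *)
Definition ext_ble (s : {mset edges}) (e : edges) :=
  match e with
  | inl x => exists2 t, s = mmap inl t & ble t x
  | inr k => (exists2 l : 'I_n.+1, s = [mset inr l] & l <= k) \/
             (exists2 t, s = mmap inl t & ble t (troot T))
  end.

Lemma inl_mmap_inj : injective (mmap (@inl (edge T) 'I_n.+1)).
Proof. by apply: mmap_inj => x y []. Qed.

Lemma inr_notin_inl (t : {mset T}) (k : 'I_n.+1) :
  (inr k : edges) \in mmap (@inl (edge T) 'I_n.+1) t -> False.
Proof. by move=> /mem_mmap[]. Qed.

Lemma ext_ble_refl e : ext_ble [mset e] e.
Proof.
case: e => [x|k] /=; last by left; exists k.
by exists [mset x]; rewrite ?mmap1 //; exact: ble_refl.
Qed.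

Lemma ext_ble_anti e f : ext_ble [mset e] f -> ext_ble [mset f] e -> e = f.
Proof.
case: e f => [x|k] [y|l] /=.
- move=> [t /esym/mmap_eq1[_ -> [->]] xy] [t' /esym/mmap_eq1[_ -> [->]] yx].
  by congr inl; exact: ble_anti.
- by move=> _ [t E]; case: (@inr_notin_inl t l); rewrite -E mset11.
- by move=> [t E]; case: (@inr_notin_inl t k); rewrite -E mset11.
move=> [[k' /mset1_inj[<-] kl]|[t E]]; last by case: (@inr_notin_inl t k);
  rewrite -E mset11.
move=> [[l' /mset1_inj[<-] lk]|[t E]]; last by case: (@inr_notin_inl t l);
  rewrite -E mset11.
by congr inr; apply/val_inj/eqP; rewrite eqn_leq kl.
Qed.

Lemma ext_blem s t : blem ext_ble s (mmap inl t) -> exists2 s',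
  s = mmap inl s' & blem (@ble T) s' t.
Proof. by apply: blem_mmap. Qed.

Lemma ext_ble_trans gs fs e : blem ext_ble gs fs -> ext_ble fs e -> ext_ble gs e.
Proof.
case: e => [x|k] /= H.
  move=> [t fE tx]; move: H; rewrite fE => /ext_blem[t' -> H].
  by exists t' => //; exact: ble_trans tx.
move=> [[l fE lk]|[t fE tx]]; move: H; rewrite fE.
  move=> /blem1/= [[j -> jl]|?]; [left; exists j => //; exact: leq_trans lk | by right].
by move=> /ext_blem[t' -> H]; right; exists t' => //; exact: ble_trans tx.
Qed.

Definition ext_bp : broad_poset := 
  @BroadPoset edges ext_ble ext_ble_refl ext_ble_anti ext_ble_trans.

Lemma ext_up_inr (k : 'I_n.+1) : exists z : ext_bp, is_up [mset z] (inr k : ext_bp).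
Proof.
have upP (z : ext_bp) : ext_ble [mset z] (inr k) -> z <> inr k ->
    (forall s, ext_ble s (inr k) -> s <> [mset inr k] -> ext_ble s z) ->
    exists z : ext_bp, is_up [mset z] (inr k : ext_bp).
  move=> zk ne H; exists z => //; split; first by split=> // /mset1_inj.
  by move=> t [tk tne]; apply: blem_mset1; exact: H.
case: (posnP k) => k0.
  apply: (upP (inl (troot T))) => //=.
    by right; exists [mset troot T]; rewrite ?mmap1 //; exact: ble_refl.
  move=> s [[l -> lk]|//] []; congr [mset inr _]; apply/val_inj/eqP.
  by rewrite /= eqn_leq lk k0.
have k1 : k.-1 < n.+1 by apply: leq_ltn_trans (leq_pred _) (ltn_ord k).
apply: (upP (inr (Ordinal k1))) => /=.
- by left; exists (Ordinal k1) => //=; exact: leq_pred.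
- by move=> [] /(congr1 val)/= E; move: k0; rewrite -E; case: (val k) E => //= m /n_Sn.
move=> s [[l -> lk] ne|]; last by right.
left; exists l => //=; rewrite -ltnS (prednK k0) ltn_neqAle lk andbT.
by apply/eqP => /val_inj E; apply: ne; rewrite E.
Qed.

Lemma ext_is_tree : is_tree ext_bp.
Proof.
have inlI : injective (@inl (edge T) 'I_n.+1) by move=> ? ? [].
split=> [s [x|k]|[x|k]|].
- by move=> [t -> /tree_simple tu]; rewrite (perm_uniq (perm_eq_seq_mset _)) map_inj_uniq.
- move=> [[l -> _]|[t -> /tree_simple tu]]; first by rewrite enum_msetn.
  by rewrite (perm_uniq (perm_eq_seq_mset _)) map_inj_uniq.
- have [H|[u [[ux une] uM]]] := tree_cases x.
    by apply: Or31 => -[s [[t -> /H ->] ]]; apply; rewrite mmap1.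
  have up : @is_up ext_bp (mmap inl u) (inl x).
    split; first by split; [exists u | rewrite -mmap1 => /inl_mmap_inj].
    move=> s [[t -> tx] tne]; have /uM : blt t x.
      by split=> // tE; apply: tne; rewrite tE mmap1.
    elim=> [|f e fs es fe _ IH]; first by rewrite mmap0; exact: blem_nil.
    by rewrite mmapD mmapS; apply: blem_cons IH; exists f.
  have [u0|ne] := pselect (u = mset0).
    have E : @mmap T ext_bp inl u = mset0 by rewrite u0 mmap0.
    apply: Or33 => s; split=> [|->]; last by case: up; rewrite E.
    by case: up => _ uM' /uM'; rewrite E => /blem0.
  by apply: Or32; exists (mmap inl u) => // /mmap_eq0.
- have [z zP] := ext_up_inr k; apply: Or32; exists [mset z] => //.
  by move=> E; have := mset11 z; rewrite E in_mset0.
exists (inr ord_max : ext_bp) => -[x|k].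
  have [s xs sr] := trootP x; exists (mmap inl s); first exact: mmap_mem.
  by right; exists s.
by exists [mset (inr k : ext_bp)]; [rewrite mset11 | left; exists k => //;
  exact: leq_ord].
Qed.

Definition ext : tree := Tree ext_is_tree.

Lemma inl_bmap_subproof (s : {mset T}) e : ble s e -> @ble ext (mmap inl s) (inl e).
Proof. by exists s. Qed.
Definition ext_inl : bmap T ext := BMap inl_bmap_subproof.

Lemma troot_ext : troot ext = inr ord_max.
Proof.
apply: root_uniq (@trootP ext) _ => -[x|k].
  have [s xs sr] := trootP x; exists (mmap inl s); first exact: mmap_mem.
  by right; exists s.
by exists [mset (inr k : ext_bp)]; [rewrite mset11 | left; exists k => //;
  exact: leq_ord].
Qed.

Section ExtMap.
Variables (Z : broad_poset) (b : bmap T Z) (c : 'I_n.+1 -> Z).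
Hypothesis c_mono : forall i j : 'I_n.+1, i <= j -> ble [mset c i] (c j).
Hypothesis c_root : ble [mset b (troot T)] (c ord0).

Definition ext_map_fun (e : ext) : Z := match e with inl x => b x | inr k => c k end.
Lemma ext_map_subproof s e : ble s e -> ble (mmap ext_map_fun s) (ext_map_fun e).
Proof.
case: e => [x [t -> tx]|k [[l -> lk]|[t -> tr]]] /=.
- by rewrite mmap_comp; exact: (bmapP b).
- by rewrite mmap1; exact: c_mono.
rewrite mmap_comp; apply: ble_trans1 (bmapP b tr) _.
by apply: ble_trans1 c_root (c_mono _).
Qed.
Definition ext_map : bmap ext Z := BMap ext_map_subproof.
End ExtMap.

Lemma ext_chain_single (s : {mset ext}) e l : ble s e -> (inr l : ext) \in s ->
  s = [mset (inr l : ext)] /\ exists2 k : 'I_n.+1, e = inr k & l <= k.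
Proof.
case: e => [x [t -> _] /inr_notin_inl //|k [[j -> jk] /mset1P[->]|[t -> _]
  /inr_notin_inl //]].
by split=> //; exists k.
Qed.

Lemma ext_off (s : {mset ext}) e : ble s e ->
  (exists l : 'I_n.+1, s = [mset inr l]) \/ (forall z, z \in s -> exists x, z = inl x).
Proof.
move=> se; have [[l ls]|H] := pselect (exists l, (inr l : ext) \in s).
  by left; exists l; case: (ext_chain_single se ls).
by right=> -[x _|l ls]; [exists x | case: H; exists l].
Qed.

End Ext.

Section ExtAct.
Variables (gT : finGroupType) (n : nat) (S : tree_act gT).

Lemma act_troot g : ta_act S g (troot S) = troot S.
Proof.
apply: root_uniq (@trootP S) => e.
by rewrite -(Defs.gactKV (ta_act S) g e); apply: bmap_led; exact: trootP.
Qed.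

Lemma ext_act_subproof g : @ble (ext n S) 
  [mset bcomp (ext_inl n S) (ta_act S g) (troot S)] (inr ord0).
Proof.
right; exists [mset troot S]; last exact: ble_refl.
by rewrite mmap1 /= act_troot.
Qed.

Lemma ext_chain_mono (T : tree) (i j : 'I_n.+1) :
  i <= j -> @ble (ext n T) [mset (inr i : ext n T)] (inr j).
Proof. by move=> ij; left; exists i. Qed.

Definition ext_act_map g : bmap (ext n S) (ext n S) :=
  ext_map (@ext_chain_mono S) (ext_act_subproof g).

Lemma ext_act1 : ext_act_map 1%g = bid (ext n S).
Proof. by apply: bmap_eq => -[x|k] //=; rewrite Defs.gact1. Qed.

Lemma ext_actM g h : ext_act_map (g * h)%g = bcomp (ext_act_map g) (ext_act_map h).
Proof. by apply: bmap_eq => -[x|k] //=; rewrite Defs.gactM. Qed.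

Definition ext_act : tree_act gT := TreeAct (GAction ext_act1 ext_actM).

End ExtAct.

(** * Completing a face along a part of the chain *)

Section Completion.
Variables (n : nat) (S : tree).
Local Notation W := (ext n S).
Local Notation "'\c' k" := (inr k : edge W) (at level 8, k at level 2).
(** A part [J] of the chain is given by a monotone retraction onto it, whose fixed
    points it consists of. *)
Variable th : 'I_n.+1 -> 'I_n.+1.
Hypothesis th_mono : forall i j : 'I_n.+1, i <= j -> th i <= th j.
Hypothesis th_idem : forall i, th (th i) = th i.

Definition off_chain (s : {mset W}) := forall z, z \in s -> exists x, z = inl x.

Definition root_on_chain (U : tree) (h : bmap U W) := exists k, h (troot U) = inr k.
Definition in_part (U : tree) (h : bmap U W) := forall u k, h u = inr k -> th k = k.
Definition chain_only (U : tree) (h : bmap U W) := forall s e, ble s e ->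
  exists l k, mmap h s = [mset \c l] /\ h e = inr k.

Lemma squash_root : @ble W [mset ext_inl n S (troot S)] (inr (th ord0)).
Proof. by right; exists [mset troot S]; rewrite ?mmap1 //; exact: ble_refl. Qed.

Definition squash : bmap W W :=
  @ext_map n S W (ext_inl n S) (fun=> inr (th ord0)) (fun _ _ _ => ble_refl _)
    squash_root.

Section Compl.
Variables (U : tree) (h : bmap U W).

Lemma traced_chain_single s e l : traced h s e -> \c l \in s ->
  s = [mset \c l] /\ exists2 k : 'I_n.+1, e = inr k & l <= k.
Proof. by move=> /traced_ble; exact: ext_chain_single. Qed.

Lemma chain_single s e (u : U) l : ble s e -> u \in s -> h u = inr l ->
  s = [mset u] /\ exists2 k : 'I_n.+1, h e = inr k & l <= k.
Proof.
move=> se us hu; have := mmap_mem h us; rewrite hu => ls.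
have [E H] := traced_chain_single (traced_map h se) ls; split=> //.
by have [v sv _] := mmap_eq1 E; move: us; rewrite sv => /mset1P ->.
Qed.

Lemma led_chain u v l : led u v -> h u = inr l -> exists2 k : 'I_n.+1,
  h v = inr k & l <= k.
Proof. by move=> [s us sv] hu; case: (chain_single sv us hu). Qed.

Lemma chain_ble_root u l s : h u = inr l -> ble s u -> ble s (troot U).
Proof.
move=> hu su; have [t ut tr] := trootP u.
by have [tE _] := chain_single tr ut hu; apply: ble_trans1 su _; rewrite -tE.
Qed.

Hypothesis hr : root_on_chain h.

Lemma compl_mono (i j : 'I_n.+1) : i <= j -> @ble W [mset \c (th i)] \c (th j).
Proof. by move=> /th_mono; exact: ext_chain_mono. Qed.

Lemma compl_root : ble [mset bcomp squash h (troot U)] \c (th ord0).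
Proof. by case: hr => k hk; left; exists (th ord0) => //=; rewrite hk. Qed.

(** If the image of [h] is the join [F * J'] of a forest off the chain with a part
    [J'] of the chain, this map has the image [F * J], where [J] is the set of
    fixed points of [th]. Defining it on a grafted tree spares the proof that
    [F * J] is a tree. *)
Definition compl : bmap (ext n U) W := ext_map compl_mono compl_root.

Lemma compl_chain k : compl (inr k) = inr (th k). Proof. by []. Qed.

Lemma compl_inl t : mmap compl (mmap inl t) = mmap squash (mmap h t).
Proof. by rewrite !mmap_comp. Qed.

Lemma squash_off s : off_chain s -> mmap squash s = s.
Proof.
by move=> so; rewrite -[RHS](@mmap_id _ id) //; apply: eq_in_mmap => z /so[x ->].
Qed.

(** The join [F * J] in terms of the image face of [h] alone: a relation of [h]
    that leaves the chain may be moved to any edge of [J]. *)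
Definition compl_rel (s : {mset W}) (e : W) :=
  [\/ exists2 x, e = inl x & traced h s e,
      exists l j, [/\ th l = l, th j = j, l <= j, s = [mset \c l] & e = inr j]
    | exists j k, [/\ th j = j, e = inr j, off_chain s & traced h s \c k]].

Lemma traced_compl s e : traced compl s e <-> compl_rel s e.
Proof.
have [r0 r0E] := hr.
have root_rel t j : ble t (troot U) ->
    compl_rel (mmap squash (mmap h t)) (inr (th j)).
  move=> tr; have [[l tl]|to] := ext_off (bmapP h tr).
    apply: Or32; exists (th ord0), (th j); rewrite tl mmap1; split=> //.
    exact: th_mono.
  apply: Or33; exists (th j), r0; rewrite squash_off // th_idem; split=> //.
  by rewrite -r0E; exact: traced_map.
split=> [[s' [e' [-> ->]]]|].
  case: e' => [u|k] /=.
    move=> [t -> tu]; rewrite compl_inl.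
    case hu: (h u) => [x|k] /=; last by apply: root_rel; exact: chain_ble_root hu tu.
    apply: Or31; exists x => //; rewrite squash_off.
      by rewrite -hu; exact: traced_map.
    move=> z zt; case: z zt => [z|k] zt; first by exists z.
    by have [_ []] := traced_chain_single (traced_map h tu) zt; rewrite hu.
  move=> [[l -> lk]|[t -> tr]].
    by apply: Or32; exists (th l), (th k); rewrite mmap1; split=> //; exact: th_mono.
  by rewrite compl_inl; exact: root_rel.
case=> [[x -> [t [u [-> hu tu]]]]|[l [j [lJ jJ lj -> ->]]]|[j [k [jJ ->
  so [t [u [sE hu tu]]]]]]].
- exists (mmap inl t), (inl u); split; last by exists t.
    rewrite mmap_comp; apply: eq_in_mmap => v vt /=.
    case hv: (h v) => [z|l] //=.
    by have [_ []] := chain_single tu vt hv; rewrite -hu.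
  by rewrite /= -hu.
- exists [mset (inr l : ext n U)], (inr j); rewrite mmap1 /= lJ jJ; split=> //.
  exact: ext_chain_mono.
exists (mmap inl t), (inr j); split=> //=; first 1 last.
- by rewrite jJ.
- by right; exists t => //; exact: chain_ble_root (esym hu) tu.
by rewrite -(squash_off so) sE !mmap_comp.
Qed.

Lemma compl_root_on_chain : root_on_chain compl.
Proof. by exists (th ord_max); rewrite troot_ext. Qed.

Lemma compl_in_part : in_part compl.
Proof.
move=> [u|k] j /=; last by move=> [<-].
by case: (h u) => //= k [<-].
Qed.

Lemma image_le_compl : in_part h -> image_le h compl.
Proof.
move=> hJ s e H; apply/traced_compl; case: e H => [x|k] H; first by apply: Or31; exists x.
have [_ [u [_ hu _]]] := H; have kJ := hJ _ _ (esym hu).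
have [[l sl]|so] := ext_off (traced_ble H); last by apply: Or33; exists k, k.
have ls : \c l \in s by rewrite sl mset11.
have [_ [_ [<-] lk]] := traced_chain_single H ls.
have [v hv] := traced_mem H ls.
by apply: Or32; exists l, k; rewrite (hJ _ _ hv).
Qed.

(** The edges that [h] maps to the chain lie on a unary path to the root, so the
    relations which the completion puts on them were there before. *)
Lemma traced_compl_restrict s e : traced compl s e ->
  (exists v, h v = e) -> (forall z, z \in s -> exists u, h u = z) -> traced h s e.
Proof.
move=> /traced_compl[[] //|[l [j [_ _ lj -> ->]]] [v hv]|[j [k [_ ->
  so [t [x [sE hx tx]]]]]] [v hv]] sh.
  have [u hu] := sh _ (mset11 _).
  have [uv|vu|[s' [e' [H us vs ne]]]] := tree_compare u v.
  - have [s' us' s'v] := uv; have [s'E _] := chain_single s'v us' hu.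
    by exists s', v; rewrite s'E mmap1 hu -s'E.
  - have [k] := led_chain vu hv; rewrite hu => -[<-] jl.
    have -> : l = j by apply/val_inj/eqP; rewrite eqn_leq lj.
    by rewrite -hv; exact: traced_refl.
  have [sE _] := chain_single H us hu.
  by case: ne; move: vs; rewrite sE => /mset1P.
have tr := chain_ble_root (esym hx) tx.
have [|H|[z tz vz]] := @unary_path _ v (troot U) t (trootP v) _ tr.
- by move=> t' t'r vt'; case: (chain_single t'r vt' hv).
- by rewrite sE -hv; exact: traced_map.
have [k' hz _] := led_chain vz hv.
have : h z \in s by rewrite sE tz mmap1 mset11.
by move=> /so[w]; rewrite hz.
Qed.

End Compl.

Lemma compl_le (U V : tree) (f : bmap U W) (h : bmap V W) (fr : root_on_chain f) (hr :
  root_on_chain h) :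
  image_le f h -> image_le (compl fr) (compl hr).
Proof.
move=> fh s e /traced_compl H; apply/traced_compl.
case: H => [[x xE /fh]|?|[j [k [? ? ? /fh]]]]; [by move=> ?; apply: Or31;
  exists x|exact: Or32|].
by move=> ?; apply: Or33; exists j, k.
Qed.

Lemma compl_compl (U : tree) (h : bmap U W) (hr : root_on_chain h) (hr' : root_on_chain
  (compl hr)) :
  image_le (compl hr') (compl hr).
Proof.
move=> s e /traced_compl [[x -> //]|H|[j [k [jJ -> so /traced_compl H]]]];
  apply/traced_compl.
  exact: Or32.
case: H => [[]//|[l [j' [_ _ _ sl _]]]|[j' [k' [_ _ _ H]]]].
  have : \c l \in s by rewrite sl mset11.
  by move=> /so[].
by apply: Or33; exists j, k'.
Qed.

End Completion.

Arguments compl_le {n S th th_mono} th_idem {U V f h} fr hr fh.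
Arguments compl_compl {n S th th_mono} th_idem {U h} hr hr'.
Arguments image_le_compl {n S th th_mono} th_idem {U h} hr hJ.

Lemma compl_act (gT : finGroupType) n (S : tree_act gT) (th : 'I_n.+1 -> 'I_n.+1)
    (th_mono : forall i j : 'I_n.+1, i <= j -> th i <= th j)
    (U : tree) (h : bmap U (ext n S)) (hr : root_on_chain h) g (ghr : root_on_chain
      (bcomp (ta_act (ext_act n S) g) h)) :
  bcomp (ta_act (ext_act n S) g) (compl th_mono hr) = compl th_mono ghr.
Proof. by apply: bmap_eq => -[u|k] //=; case: (h u). Qed.

(** * Attaching the joins with a part of the chain *)

Section FaceRels.
Variables (U T : tree) (h : bmap U T).

(** The relations of the image face, encoded in a finite type in order to be
    counted. *)
Definition face_rels : {set {set T} * T} :=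
  [set q | `[< exists2 s : {mset T}, traced h s q.2 & q.1 = [set x in s] >]].
End FaceRels.

Lemma face_rels_sub (U V T : tree) (f : bmap U T) (h : bmap V T) :
  image_le f h -> face_rels f \subset face_rels h.
Proof.
move=> fh; apply/subsetP => q; rewrite !inE => /asboolP[s H qs]; apply/asboolP.
by exists s => //; exact: fh.
Qed.

Lemma face_rels_image_le (U V T : tree) (f : bmap U T) (h : bmap V T) :
  face_rels f \subset face_rels h -> image_le f h.
Proof.
move=> /subsetP sub s e H; have /sub : ([set x in s], e) \in face_rels f.
  by rewrite inE; apply/asboolP; exists s.
rewrite inE => /asboolP[t /= H' /setP st]; suff -> : s = t by [].
apply: seteq_uniq_mset => [||x]; [exact: tree_simple (traced_ble H)|exact: tree_simple
  (traced_ble H')|].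
by have := st x; rewrite !inE.
Qed.

Section CellExtension.
Variables (gT : finGroupType) (n : nat) (S : tree_act gT).
Local Notation W := (ext_act n S).
Local Notation "'\c' k" := (inr k : edge W) (at level 8, k at level 2).
Variables (th : 'I_n.+1 -> 'I_n.+1) (xi : 'I_n.+1).
Hypothesis th_mono : forall i j : 'I_n.+1, i <= j -> th i <= th j.
Hypothesis th_idem : forall i, th (th i) = th i.
Hypothesis th_xi : th xi = xi.
Hypothesis xi_max : xi <> th ord_max.
Local Notation in_part := (in_part th).
Local Notation compl := (compl th_mono).

(** Equivariant down-closed sets of faces of [W]. They are given as predicates on
    maps, since a face is the image of a map. *)
Record face_class (Q : forall U : tree, bmap U W -> Prop) : Prop := FaceClass {
  fc_le : forall (U V : tree) (f : bmap U W) (h : bmap V W), image_le f h -> Q V h ->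
    Q U f;
  fc_act : forall (U : tree) g (h : bmap U W), Q U h -> Q U (bcomp (ta_act W g) h)
}.

Variable Q : forall U : tree, bmap U W -> Prop.
Hypothesis Q_fc : face_class Q.
Hypothesis Q_compl : forall (U : tree) (h : bmap U W) (hr : root_on_chain h),
  Q h -> in_part h -> Q (compl hr).

Variables (X Y : gdset gT) (p : gmap X Y) (y : gmap (rep_tree W) Y).
Hypothesis pF : g_inner_fibration p.
Implicit Types G : forall U : tree, rep_tree W U -> X U -> Prop.
Local Notation dom G h := (@defd gT (rep_tree W) X G _ h).

(** A domain that is ready for attaching cells along the edge [xi]: the faces
    [F * J] with [J] the fixed points of [th] come in pairs with [F * (J - xi)],
    and a pair is either contained in the domain or disjoint from it. *)
Record extensible G : Prop := Extensible {
  ex_lift : partial_lift p y G;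
  ex_le : forall (U V : tree) (f : bmap U W) (h : bmap V W), image_le f h ->
    dom G h -> dom G f;
  ex_chain : forall (U : tree) (h : bmap U W), Q h -> in_part h -> chain_only h ->
    dom G h;
  ex_face : forall (U : tree) (h : bmap U W) j, Q h -> in_part h -> th j = j -> j <> xi ->
    (forall u, h u <> inr j) -> dom G h;
  ex_match : forall (U : tree) (h : bmap U W) (hr : root_on_chain h), Q h ->
    in_part h -> dom G h ->
    (forall j, th j = j -> j <> xi -> exists u, h u = inr j) -> ~ chain_only h ->
    dom G (compl hr)
}.

Section Step.
Variable G : forall U : tree, rep_tree W U -> X U -> Prop.
Hypothesis GE : extensible G.
Variables (U0 : tree) (h0 : bmap U0 W) (r0 : root_on_chain h0).
Hypothesis h0Q : Q h0.
Hypothesis h0J : in_part h0.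
Hypothesis h0G : ~ dom G h0.
Hypothesis h0min : forall (U : tree) (h : bmap U W) (hr : root_on_chain h), Q h ->
  in_part h ->
  ~ dom G h -> #|face_rels (compl r0)| <= #|face_rels (compl hr)|.
Local Notation m := (th ord_max).

Lemma th_max : th m = m. Proof. exact: th_idem. Qed.

(** The new cell has a vertex above the chain: faces inside the chain are already in
    the domain. This is what makes [xi] an inner edge of the cell, even if it is
    the first edge of the chain. *)
Lemma off_relation : exists2 t : {mset U0}, ble t (troot U0) & off_chain (mmap h0 t).
Proof.
apply: contrapT => H; apply: h0G; apply: (ex_chain GE) => // s e se.
have [t et tr] := trootP e.
have [[l tl]|to] := ext_off (bmapP h0 tr); last by case: H; exists t.
have hel : h0 e = inr l by apply/mset1P; rewrite -tl; exact: mmap_mem.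
have [[l' sl]|so] := ext_off (bmapP h0 se); first by exists l', l.
by case: H; exists s => //; exact: chain_ble_root hel se.
Qed.

Section Image.
Variables (A : tree) (i : bmap A W) (q : bmap (ext n U0) A) (a : A).
Hypothesis iI : injective i.
Hypothesis iq : compl r0 = bcomp i q.
Hypothesis qF : forall s e, ble s e -> traced q s e.
Hypothesis ia : i a = inr xi.

Lemma cell_le : image_le i (compl r0).
Proof.
move=> s e [s' [e' [-> -> /qF H]]]; rewrite iq.
by apply/traced_comp; exists s', e'.
Qed.

Lemma le_cell : image_le (compl r0) i.
Proof. rewrite iq; exact: image_le_comp. Qed.

Lemma cell_Q : Q i.
Proof. exact: (fc_le Q_fc cell_le (Q_compl r0 h0Q h0J)). Qed.

Lemma cell_part : in_part i.
Proof.
by move=> x k ix; have [u] := image_le_mem x cell_le; rewrite ix => /compl_in_part; apply.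
Qed.

Lemma cell_face_part (U : tree) (k : bmap U A) : in_part (bcomp i k).
Proof. by move=> u; exact: cell_part. Qed.

Lemma cell_face_Q (U : tree) (k : bmap U A) : Q (bcomp i k).
Proof. exact: (fc_le Q_fc (image_le_comp i k) cell_Q). Qed.

Lemma cell_edge_inner : is_inner a.
Proof.
split=> [/(_ (q (inr ord_max)))/(bmap_led i)|]; last apply.
  rewrite ia -[i _]/(bcomp i q _) -iq compl_chain => H.
  have [s ms sx] := H; have [_ [k [<-] mx]] := ext_chain_single sx ms.
  apply: xi_max; apply/val_inj/eqP; rewrite eqn_leq mx andbT -th_xi.
  by apply: th_mono; exact: leq_ord.
have [t tr to] := off_relation; exists (mmap q (mmap inl t)).
have aE : a = q (inr xi) by apply: iI; rewrite ia -[RHS]/(bcomp i q _) -iq compl_chain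
  th_xi.
split; first by rewrite aE; apply: bmapP; right; exists t.
move=> /(congr1 (mmap i)); rewrite mmap1 ia mmap_comp => iqt.
have E : mmap (compl r0) (mmap inl t) = [mset \c xi] by rewrite iq.
have [u ut uxi] := mmap_eq1 E; have := mset11 u; rewrite -ut => /mem_mmap[v vt uv].
have [x vx] := to _ (mmap_mem h0 vt).
by move: uxi; rewrite uv /= vx.
Qed.

Section OffHorn.
Variables (U : tree) (k : bmap U A).
Hypothesis nk : ~ in_horn (inner_excl [set a]) k.

(** The image of a map outside the horn is the cell or the cell without [xi], so it
    contains all relations which do not involve [xi]. *)
Lemma off_horn_traced s e : traced (compl r0) s e -> e <> inr xi -> \c xi \notin s ->
  traced (bcomp i k) s e.
Proof.
move=> /le_cell[s' [e' [-> -> H]]] ne ns.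
have [B [[E Ea BE] im full]] := not_in_horn nk.
have inB x : x <> a -> x \in B.
  by move=> xa; rewrite BE inE; apply/negP => /(subsetP Ea); rewrite inE => /eqP.
apply/traced_comp; exists s', e'; split=> //; apply: full => //.
  by apply: inB => ea; apply: ne; rewrite ea.
by move=> x xs; apply: inB => xa; move/negP: ns; apply; rewrite -ia -xa; exact: mmap_mem.
Qed.

Lemma off_horn_chain j : th j = j -> j <> xi -> exists u, bcomp i k u = inr j.
Proof.
move=> jJ jxi; have := traced_refl (compl r0) (inr j); rewrite compl_chain jJ => H.
have [||s [u [_ -> _]]] := off_horn_traced H; [by case| |by exists u].
by apply/mset1P => -[/esym].
Qed.

Lemma off_horn_root : root_on_chain (bcomp i k).
Proof.
have [u uE] := off_horn_chain th_max (nesym xi_max).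
by have [l lE _] := led_chain (trootP u) uE; exists l.
Qed.

Lemma off_horn_nonlinear : ~ chain_only (bcomp i k).
Proof.
have [t tr to] := off_relation; have [j jE] := r0.
have : traced (compl r0) (mmap h0 t) (inr m).
  apply/(traced_compl th_mono th_idem); apply: Or33; exists m, j; rewrite th_max -jE.
  by split=> //; exact: traced_map.
move=> /off_horn_traced[||s [u [sE uE su]] H]; first by case=> /esym.
  by apply/negP => /to[].
have [l [l' [sl _]]] := H _ _ su.
by have [|x] := to (inr l); rewrite // sE sl mset11.
Qed.

Lemma off_horn_le (hr : root_on_chain (bcomp i k)) : image_le (compl r0) (compl hr).
Proof.
move=> s e H; apply/(traced_compl th_mono th_idem).
move/(traced_compl th_mono th_idem): (H).
case=> [[x ex _]|?|[j [k' [jJ eE so Hk']]]]; [apply: Or31; exists x => // |exact: Or32|].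
  apply: off_horn_traced => //; first by rewrite ex.
  apply/negP => /(traced_chain_single H)[_ []]; by rewrite ex.
apply: Or33; exists j, m; split=> //; apply: off_horn_traced.
- by apply/(traced_compl th_mono th_idem); apply: Or33; exists m, k'; rewrite th_max.
- by case=> /esym.
by apply/negP => /so[].
Qed.

(** Otherwise, the domain would by the matching condition contain the completion of
    [i k], which is the whole cell. *)
Lemma off_horn_undefined : ~ dom G (bcomp i k).
Proof.
move=> H; have hr := off_horn_root; apply: h0G.
have := ex_match GE hr (cell_face_Q k) (@cell_face_part _ k) H off_horn_chain
  off_horn_nonlinear.
apply: (ex_le GE); apply: image_le_trans (off_horn_le hr).
exact: image_le_compl.
Qed.

End OffHorn.

(** A face of the new cell on which nothing is defined yet has, by minimality, the
    cell itself as its completion; hence it is the cell or the cell without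
    the edge [xi], and these are the two faces outside the horn. *)
Lemma in_horn_defined (U : tree) (k : bmap U A) :
  in_horn (inner_excl [set a]) k -> dom G (bcomp i k).
Proof.
move=> [F [f [k' [fI fX ->]]]]; apply: contrapT => nd.
pose g := bcomp i f.
have gG : ~ dom G g.
  by move=> H; apply: nd; apply: (ex_le GE _ H); exact: (image_le_comp g k').
have gQ : Q g by exact: cell_face_Q.
have gJ : in_part g by exact: cell_face_part.
have gj j : th j = j -> j <> xi -> exists u, g u = inr j.
  move=> jJ jxi; apply: contrapT => H; apply: gG; apply: (ex_face GE) jJ jxi _ => // u gu.
  by apply: H; exists u.
have gr : root_on_chain g.
  have [u uE] := gj _ th_max (nesym xi_max).
  by have [l lE _] := led_chain (trootP u) uE; exists l.
have le_g : image_le (compl r0) (compl gr).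
  apply: face_rels_image_le; have sub : face_rels (compl gr) \subset face_rels (compl r0).
    apply: face_rels_sub.
    have cc := compl_compl th_idem r0 (compl_root_on_chain th_mono r0).
    apply: image_le_trans cc; apply: (compl_le th_idem).
    exact: (image_le_trans (image_le_comp i f) cell_le).
  have /eqP -> // : face_rels (compl r0) == face_rels (compl gr).
  by rewrite eq_sym eqEcard sub; exact: h0min.
apply: (fX [set x | x \in codom f]).
  exists (~: [set x | x \in codom f]); last by rewrite setCK.
  apply/subsetP => x; rewrite !inE => /negP nx; apply/eqP; apply: contrapT => xa;
    apply: nx.
  have : traced (compl gr) [mset i x] (i x) by apply/le_g/cell_le/traced_refl.
  case ix: (i x) => [z|j] /(traced_compl th_mono th_idem) H.
    case: H => [[_ _ [s [u [_ gu _]]]]|[? [? [_ _ _ _ //]]]|[? [? [_ //]]]].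
    by rewrite (_ : x = f u) ?codom_f //; apply: iI; rewrite ix gu.
  have jxi : j <> xi by move=> E; apply: xa; apply: iI; rewrite ix E ia.
  have [u gu] := gj j (cell_part ix) jxi.
  by rewrite (_ : x = f u) ?codom_f //; apply: iI; rewrite ix -gu.
split=> [x|s e H].
  by rewrite inE; split=> [/codomP[u ->]|[u <-]]; [exists u | exact: codom_f].
have : traced (compl gr) (mmap g s) (g e).
  rewrite -(mmap_comp i f); exact/le_g/cell_le/(traced_map i H).
have gI : injective g by move=> u v /iI/fI.
move=> /(traced_compl_restrict th_idem)[||s' [e' [/(mmap_inj gI) -> /gI -> //]]].
  by exists e.
by move=> z /mem_mmap[u _ ->]; exists u.
Qed.

Lemma horn_defined (U : tree) (k : bmap U A) :
  in_horn (inner_excl [set a]) k <-> dom G (bcomp i k).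
Proof.
split; first exact: in_horn_defined.
by move=> H; apply: contrapT => /off_horn_undefined.
Qed.

(** A translate of the cell that meets the cell outside the horns has the same
    completion, so it is equal to the cell. *)
Lemma off_horn_stab (U : tree) g (k k' : bmap U A) : ~ in_horn (inner_excl [set a]) k ->
  bcomp (ta_act W g) (bcomp i k) = bcomp i k' ->
  exists al : bmap A A, forall x, ta_act W g (i x) = i (al x).
Proof.
move=> nk E; have hr := off_horn_root nk.
have ghr : root_on_chain (bcomp (ta_act W g) (bcomp i k)).
  by have [l lE] := hr; exists l; rewrite -[LHS]/(ta_act W g (bcomp i k (troot U))) lE.
have [al alE] : exists al, bcomp (ta_act W g) i = bcomp i al.
  apply: image_le_factor => //; apply: image_le_trans (image_le_post _ cell_le) _.
  apply: image_le_trans (image_le_post _ (off_horn_le nk hr)) _.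
  rewrite (compl_act th_mono hr ghr).
  have ir : root_on_chain i.
    by have [l lE _] := led_chain (trootP a) ia; exists l.
  have gi : image_le (bcomp (ta_act W g) (bcomp i k)) i by rewrite E;
    exact: image_le_comp.
  apply: image_le_trans (compl_le th_idem ghr ir gi) _; apply: image_le_trans le_cell.
  apply: image_le_trans (compl_compl th_idem r0 (compl_root_on_chain th_mono r0)).
  exact: (compl_le th_idem _ _ cell_le).
by exists al => x; exact: (congr1 (fun h : bmap A W => h x) alE).
Qed.

End Image.

Lemma cell_step : exists G', [/\ partial_lift p y G',
  forall (U : tree) (c : rep_tree W U) (x : X U), G c x -> G' U c x
  & forall (U : tree) (h : bmap U W), dom G' h <->
      dom G h \/ exists g, image_le h (bcomp (ta_act W g) (compl r0))].
Proof.
have [A [i [q [iI iq qF]]]] := image_factor (compl r0).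
have [a ia] : exists a, i a = inr xi.
  by exists (q (inr xi)); rewrite -[LHS]/(bcomp i q _) -iq compl_chain th_xi.
have a_fix g : ta_act W g (i a) = i a by rewrite ia.
have [G' [P' sub G'E]] := @attach_orbit gT W A i a iI a_fix _ _ _ y _ (cell_edge_inner
  iI iq ia) pF (ex_lift GE)
  (fun U k => horn_defined iI iq qF ia k) (@off_horn_stab _ _ _ _ iI iq qF ia).
exists G'; split=> // U h; rewrite G'E; split=> -[H|H]; [by left| |by left|]; right.
  have [g [k ->]] := H; exists g; apply: image_le_post.
  by apply: image_le_trans (image_le_comp _ _) (cell_le iq qF).
have [g gh] := H; exists g.
have [|k kE] := @image_le_factor _ _ _ h (bcomp (ta_act W g) i) _ (image_le_trans gh
  (image_le_post _ (le_cell iq))).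
  by move=> x z /gact_inj/iI.
by exists k; rewrite kE; exact: bmap_eq.
Qed.

End Step.

(** Indexing the missing faces by [face_rels] makes their number finite. *)
Definition missing G : {set {set {set W} * W}} :=
  [set t | `[< exists (U : tree) (h : bmap U W), [/\ Q h, in_part h,
    ~ dom G h & face_rels h = t] >]].

(** One attaches, together with its orbit, the completion of a missing face for
    which this completion is as small as possible. The domain remains
    extensible, and the number of missing faces drops. *)
Lemma cell_extension G : extensible G -> exists G',
  [/\ partial_lift p y G', forall U c x, G U c x -> G' U c x
    & forall (U : tree) (h : bmap U W), dom G' h <-> dom G h \/ Q h /\ in_part h].
Proof.
have [N] := ubnP #|missing G|; elim: N G => // N IH G; rewrite ltnS => GN GE.
have [[U [h [hQ hJ hG]]]|none] := pselect (exists (U : tree) (h : bmap U W),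
    [/\ Q h, in_part h & ~ dom G h]); last first.
  exists G; split=> //; [exact: ex_lift GE|] => U h; split=> [|[//|[hQ hJ]]];
    first by left.
  by apply: contrapT => nG; apply: none; exists U, h.
have rootP (V : tree) (f : bmap V W) : Q f -> in_part f -> ~ dom G f -> root_on_chain f.
  move=> fQ fJ; case fr: (f (troot V)) => [x|k]; last by exists k.
  case; apply: (ex_face GE (j := th ord_max)) => //; [exact/nesym|] => u fu.
  by have [l] := led_chain (trootP u) fu; rewrite fr.
pose size_missing k := `[< exists (V : tree) (f : bmap V W) (fr : root_on_chain f),
  [/\ Q f, in_part f, ~ dom G f & #|face_rels (compl fr)| = k] >].
have sizeP : exists k, size_missing k.
  exists #|face_rels (compl (rootP _ _ hQ hJ hG))|; apply/asboolP.
  by exists U, h, (rootP _ _ hQ hJ hG).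
case: (ex_minnP sizeP) => k /asboolP[V [f [fr [fQ fJ fG fk]]]] kmin {U h hQ hJ hG sizeP}.
have fmin (U : tree) (h : bmap U W) (hr : root_on_chain h) : Q h -> in_part h ->
  ~ dom G h ->
    #|face_rels (compl fr)| <= #|face_rels (compl hr)|.
  by move=> hQ hJ hG; rewrite fk; apply: kmin; apply/asboolP; exists U, h, hr.
have [G1 [P1 sub1 G1E]] := cell_step GE fQ fJ fG fmin.
have domG1 (U : tree) (h : bmap U W) : dom G h -> dom G1 h by move=> H; apply/G1E; left.
have G1x : extensible G1.
  split=> //.
  - move=> U U' h h' hh' /G1E[/(ex_le GE hh')/domG1 //|[g gh']]; apply/G1E; right.
    by exists g; exact: image_le_trans gh'.
  - by move=> U h hQ hJ hl; apply/domG1/(ex_chain GE).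
  - by move=> U h j hQ hJ jJ jxi hj; apply/domG1/(ex_face GE hQ hJ jJ jxi).
  move=> U h hr hQ hJ /G1E[hG ha hl|[g gh] _ _].
    by apply/domG1/(ex_match GE).
  apply/G1E; right; exists g.
  have ghr : root_on_chain (bcomp (ta_act W g) (compl fr)) by exists (th ord_max);
    rewrite /= troot_ext.
  apply: image_le_trans (compl_le th_idem hr ghr gh) _.
  rewrite -(compl_act th_mono (compl_root_on_chain th_mono fr)); apply: image_le_post.
  exact: compl_compl.
have [|G2 [P2 sub2 G2E]] := IH G1 _ G1x.
  apply: leq_trans GN; apply: proper_card; apply/properP; split.
    apply/subsetP => t; rewrite !inE => /asboolP[U [h [hQ hJ hG ht]]]; apply/asboolP.
    by exists U, h; split=> // /domG1.
  exists (face_rels f); rewrite inE; first by apply/asboolP; exists V, f.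
  apply/asboolP => -[U [h [hQ hJ hG hf]]]; apply: hG; apply/G1E; right; exists 1%g.
  have -> : bcomp (ta_act W 1%g) (compl fr) = compl fr.
    by apply: bmap_eq => u; exact: (congr1 (fun b : bmap W W => b (compl fr u))
      (@ext_act1 gT n S)).
  by apply: image_le_trans (image_le_compl th_idem fr fJ); apply: face_rels_image_le;
    rewrite hf.
exists G2; split=> // [U c x /sub1/sub2 //|U h]; rewrite G2E G1E.
split=> [[[|[g gh]]|]|[|]]; [by left|right|by right|by left; left|by right].
split; first exact: (fc_le Q_fc gh (fc_act Q_fc _ (Q_compl fr fQ fJ))).
move=> u k' hu; have [v] := image_le_mem u gh; rewrite hu => /=.
case vE: (ext_map_fun _ _ v) => [//|l] [<-].
by apply: (compl_in_part th_idem (hr := fr) (u := v)).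
Qed.

End CellExtension.

(** * The three-simplex of an equivalence *)

Section LinearMaps.

Definition seq_fun m n (s : seq nat) (i : 'I_m.+1) : 'I_n.+1 := inord (nth 0 s i).

Lemma seq_fun_mono m n s : size s == m.+1 -> all (fun k => k <= n) s -> sorted leq s ->
  monotone (@seq_fun m n s).
Proof.
move=> /eqP sz /allP sn ss i j ij.
have H (k : 'I_m.+1) : nth 0 s k < n.+1 by apply: sn; rewrite mem_nth // sz.
rewrite !inordK ?H //; apply: (sorted_leq_nth leq_trans leqnn) => //; rewrite inE sz //.
Qed.

Definition seq_bmap m n s (h1 : size s == m.+1) (h2 : all (fun k => k <= n) s)
    (h3 : sorted leq s) : bmap (linear m) (linear n) :=
  linear_map (exist (@monotone m n) _ (seq_fun_mono h1 h2 h3)).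

End LinearMaps.

Notation sbmap m n s := (@seq_bmap m n s isT isT isT).

Lemma linear_unary (U : tree) n (h : bmap U (linear n)) (s : {mset U}) (e : U) : ble s
  e ->
  exists x, s = [mset x].
Proof. by move=> /(bmapP h)[i /mmap_eq1[x -> _] _]; exists x. Qed.

Lemma linear_reflect (U : tree) n (h : bmap U (linear n)) (x e : U) :
  ble [mset h x] (h e) -> injective h -> ble [mset x] e.
Proof.
move=> [i /mset1_inj <- xe] hI.
have [[s xs se]|[s es sx]|[s [e' [H xs es]]]] := tree_compare x e.
- by have [z sz] := linear_unary h se; move: xs se; rewrite sz => /mset1P ->.
- have [z sz] := linear_unary h sx; move: es sx; rewrite sz => /mset1P <- ex.
  have [j] := bmapP h ex; rewrite mmap1 => /mset1_inj <- ex'.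
  have -> : x = e by apply/hI/val_inj/eqP; rewrite eqn_leq xe.
  exact: ble_refl.
by have [z sz] := linear_unary h H; move: xs es; rewrite sz => /mset1P -> /mset1P ->.
Qed.

Section Simplex.
Variables (gT : finGroupType) (X : gdset gT).
Hypothesis XO : g_inf_operad X.

Lemma trivial_act1 (T : tree) : bid T = bid T. Proof. by []. Qed.
Lemma trivial_actM (T : tree) : bid T = bcomp (bid T) (bid T).
Proof. exact: bmap_eq. Qed.
Definition trivial_act (T : tree) : tree_act gT :=
  TreeAct (@GAction gT T (fun=> bid T) (trivial_act1 T) (fun _ _ => trivial_actM T)).

Local Notation L := (trivial_act (linear 3)).

(** The map from the face opposite to [j] given by the simplex [s]. As
    [m] is defined on the whole simplex, no map into the face has to be
    factored through its inclusion. *)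
Definition face_graph n (j : 'I_4) (m : bmap (linear 3) (linear n)) (s : X (linear n))
    (U : tree) (k : rep_tree L U) (x : X U) : Prop :=
  (forall u, (k : bmap U (linear 3)) u <> j) /\ x = dres (bcomp m k) s.

Definition to_pt_rep : gmap (rep_tree L) (terminal gT) := to_terminal (rep_tree L).

Lemma face_graph_lift n j (m : bmap (linear 3) (linear n)) s : (forall g, dact g s = s) ->
  partial_lift (to_terminal X) to_pt_rep (face_graph j m s).
Proof.
move=> sF; apply: partial_lift_fun => [U V f c Dc|U g c Dc|//]; split.
- by move=> u; exact: Dc.
- by rewrite -dres_comp; congr dres; exact: bmap_eq.
- by move=> u; exact: Dc.
by rewrite dact_res sF; congr dres; exact: bmap_eq.
Qed.

(** Faces of a linear tree are full on their edges, so only edges matter. *)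
Lemma sub_linear_horn (U : tree) (k : bmap U (linear 3)) :
  in_horn (inner_excl [set (inord 1 : linear 3)]) k <->
  exists2 j : 'I_4, j <> inord 1 & forall u, k u <> j.
Proof.
split=> [[F [f [k' [fI fX ->]]]]|[j j1 kj]].
  apply: contrapT => H; apply: (fX [set x | x \in codom f]).
    exists (~: [set x | x \in codom f]); last by rewrite setCK.
    apply/subsetP => x; rewrite !inE => /negP nx; apply/eqP; apply: contrapT => x1.
    apply: H; exists x => // u kx; apply: nx; rewrite -kx; exact: codom_f.
  split=> [x|s e [i si ie]].
    by rewrite inE; split=> [/codomP[u ->]|[u <-]]; [exists u | exact: codom_f].
  have [x sx fx] := mmap_eq1 si; rewrite sx; apply: (linear_reflect (h := f)) => //.
  by rewrite fx; exists i.
apply: contrapT => /not_in_horn[A [[E /subsetP Ea AE] im _]].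
have : j \in A.
  by rewrite AE inE; apply/negP => /Ea; rewrite inE => /eqP.
by move=> /im[u]; exact: kj.
Qed.

Lemma edge1_inner : is_inner (inord 1 : linear 3).
Proof.
split=> [/(_ (inord 3))[s ms [i si i1]]|H].
  have : i = (inord 3 : 'I_4) by move: ms; rewrite si => /mset1P.
  by move=> iE; move: i1; rewrite iE !inordK.
apply: H; exists [mset (inord 0 : linear 3)]; split; first by exists (inord 0);
  rewrite // !inordK.
by move=> /mset1_inj/(congr1 val); rewrite /= !inordK.
Qed.

(** Let [d] be the inverse of [e]. The two simplices that witness this, placed on
    [012] and [123], and a degeneracy of [e] on [013] form an inner horn at the
    vertex [1]. Its filler is degenerate on [013] and on [02], which is what is
    recorded. *)
Lemma equivalence_simplex (e : istar (fixed X) 1) : is_equivalence e ->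
  exists rho : X (linear 3), [/\ forall g, dact g rho = rho,
    forall (U : tree) (k : bmap U (linear 3)), (forall u, k u <> inord 2) ->
      dres k rho = dres (bcomp (sbmap 3 1 [:: 0; 1; 1; 1]) k) (sval e)
    & forall (U : tree) (k : bmap U (linear 3)), (forall u, k u <> inord 1) -> 
      (forall u, k u <> inord 3) ->
      dres k rho = dres (bcomp (sbmap 3 1 [:: 0; 0; 0; 0]) k) (sval e)].
Proof.
move=> [d [[s1 [s1f s1g s1e]] [s2 [s2g s2f s2e]]]].
pose cf n (j : nat) : bmap (linear n) (linear n.+1) := linear_map (coface (inord j)).
pose pt : bmap (linear 1) (linear 0) := linear_map (to_pt 1).
have {}s1f : dres (cf 1 2) (sval s1) = sval e := congr1 sval s1f.
have {}s1g : dres (cf 1 0) (sval s1) = sval d := congr1 sval s1g.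
have {}s1e : dres (cf 1 1) (sval s1) = dres pt (dres (cf 0 1) (sval e)) :=
  congr1 sval s1e.
have {}s2g : dres (cf 1 2) (sval s2) = sval d := congr1 sval s2g.
have {}s2e : dres (cf 1 1) (sval s2) = dres pt (dres (cf 0 0) (sval e)) :=
  congr1 sval s2e.
clear s2f.
pose m1 := sbmap 3 2 [:: 0; 1; 2; 2]; pose m2 := sbmap 3 2 [:: 0; 0; 1; 2].
pose m3 := sbmap 3 1 [:: 0; 1; 1; 1].
have I4 (x : linear 3) : [\/ x = inord 0, x = inord 1 | x = inord 2 \/ x = inord 3].
  case: x => [[|[|[|[|//]]]] H]; [apply: Or31|apply: Or32|apply: Or33;
    left|apply: Or33; right];
    by apply/val_inj; rewrite /= inordK.
have avoid (U : tree) (k : bmap U (linear 3)) (j : nat) u : j < 4 ->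
  k u <> inord j -> (k u : 'I_4) != j :> nat.
  by move=> j4 ne; apply/eqP => E; apply: ne; apply: val_inj; rewrite /= inordK.
have lin_eq (U : tree) n (k : bmap U (linear 3)) (a b : bmap (linear 3) (linear n)) (P
  : pred nat) :
    (forall u, P (k u : 'I_4)) -> 
    (forall i : 'I_4, P i -> (a i : 'I_n.+1) = (b i : 'I_n.+1) :> nat) ->
      bcomp a k = bcomp b k.
  by move=> kP ab; apply: bmap_eq => u /=; apply: val_inj; exact: ab.
Local Ltac lin_cases := move=> [[|[|[|[|//]]]] ? //=]; rewrite /= /seq_fun ?inordK //=.
pose c1 := sbmap 3 1 [:: 1; 1; 1; 1]; pose c0 := sbmap 3 1 [:: 0; 0; 0; 0].
have E12 (U : tree) (k : bmap U (linear 3)) : (forall u, k u <> inord 3) ->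
  (forall u, k u <> inord 0) ->
    dres (bcomp m1 k) (sval s1) = dres (bcomp m2 k) (sval s2).
  move=> k3 k0; pose nu := sbmap 3 1 [:: 0; 0; 1; 1].
  have kP u : (k u != 3 :> nat) && (k u != 0 :> nat) by rewrite !avoid.
  have -> : bcomp m1 k = bcomp (cf 1 0) (bcomp nu k).
    by rewrite bcompA; apply: (lin_eq _ _ _ _ _ (fun x => (x != 3) && (x != 0)) kP);
      lin_cases.
  have -> : bcomp m2 k = bcomp (cf 1 2) (bcomp nu k).
    by rewrite bcompA; apply: (lin_eq _ _ _ _ _ (fun x => (x != 3) && (x != 0)) kP);
      lin_cases.
  by rewrite !dres_comp s1g s2g.
have E13 (U : tree) (k : bmap U (linear 3)) : (forall u, k u <> inord 3) ->
  (forall u, k u <> inord 2) ->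
    dres (bcomp m1 k) (sval s1) = dres (bcomp m3 k) (sval e).
  move=> k3 k2.
  have kP u : (k u != 3 :> nat) && (k u != 2 :> nat) by rewrite !avoid.
  have -> : bcomp m1 k = bcomp (cf 1 2) (bcomp m3 k).
    by rewrite bcompA; apply: (lin_eq _ _ _ _ _ (fun x => (x != 3) && (x != 2)) kP);
      lin_cases.
  by rewrite !dres_comp s1f.
have E23 (U : tree) (k : bmap U (linear 3)) : (forall u, k u <> inord 0) ->
  (forall u, k u <> inord 2) ->
    dres (bcomp m2 k) (sval s2) = dres (bcomp m3 k) (sval e).
  move=> k0 k2; pose nu := sbmap 3 1 [:: 0; 0; 0; 1].
  have kP u : (k u != 0 :> nat) && (k u != 2 :> nat) by rewrite !avoid.
  have -> : bcomp m2 k = bcomp (cf 1 1) (bcomp nu k).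
    by rewrite bcompA; apply: (lin_eq _ _ _ _ _ (fun x => (x != 0) && (x != 2)) kP);
      lin_cases.
  rewrite 2!dres_comp s2e -!dres_comp.
  have -> // : bcomp m3 k = bcomp (cf 0 0) (bcomp pt (bcomp nu k)).
  rewrite (bcompA pt nu) bcompA; apply: (lin_eq _ _ _ _ _ (fun x => (x != 0) && (x !=
    2)) kP); lin_cases.
have E02 (U : tree) (k : bmap U (linear 3)) : (forall u, k u <> inord 1) ->
  (forall u, k u <> inord 3) ->
    dres (bcomp m1 k) (sval s1) = dres (bcomp c0 k) (sval e).
  move=> k1 k3; pose nu := sbmap 3 1 [:: 0; 0; 1; 1].
  have kP u : (k u != 1 :> nat) && (k u != 3 :> nat) by rewrite !avoid.
  have -> : bcomp m1 k = bcomp (cf 1 1) (bcomp nu k).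
    by rewrite bcompA; apply: (lin_eq _ _ _ _ _ (fun x => (x != 1) && (x != 3)) kP);
      lin_cases.
  rewrite 2!dres_comp s1e -!dres_comp.
  have -> // : bcomp c0 k = bcomp (cf 0 1) (bcomp pt (bcomp nu k)).
  rewrite (bcompA pt nu) bcompA; apply: (lin_eq _ _ _ _ _ (fun x => (x != 1) && (x !=
    3)) kP); lin_cases.
pose G1 := face_graph (inord 3) m1 (sval s1); pose G2 :=
  face_graph (inord 0) m2 (sval s2).
pose G3 := face_graph (inord 2) m3 (sval e).
have P1 : partial_lift (to_terminal X) to_pt_rep G1 by apply: face_graph_lift => g;
  exact: (svalP s1 g).
have P2 : partial_lift (to_terminal X) to_pt_rep G2 by apply: face_graph_lift => g;
  exact: (svalP s2 g).
have P3 : partial_lift (to_terminal X) to_pt_rep G3 by apply: face_graph_lift => g;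
  exact: (svalP e g).
have P12 : partial_lift (to_terminal X) to_pt_rep (fun U k x => G1 U k x \/ G2 U k x).
  by apply: partial_lift_union => // U k x x' [k3 ->] [k0 ->]; exact: E12.
have P : partial_lift (to_terminal X) to_pt_rep (fun U k x => (G1 U k x \/ G2 U k x) \/
  G3 U k x).
  apply: partial_lift_union => // U k x x' [[k3 ->]|[k0 ->]] [k2 ->]; first exact: E13.
  exact: E23.
pose G U (k : rep_tree L U) x := (G1 U k x \/ G2 U k x) \/ G3 U k x.
have hA (U : tree) (k : bmap U (linear 3)) :
    in_horn (inner_excl [set (inord 1 : linear 3)]) k <->
      @defd gT (rep_tree L) X G U (bcomp (bid _) k).
  rewrite sub_linear_horn; split=> [[j j1 kj]|[x [[[kj _]|[kj _]]|[kj _]]]]; first last.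
  - by exists (inord 2) => [/(congr1 val)/=|u]; [rewrite !inordK | exact: kj].
  - by exists (inord 0) => [/(congr1 val)/=|u]; [rewrite !inordK | exact: kj].
  - by exists (inord 3) => [/(congr1 val)/=|u]; [rewrite !inordK | exact: kj].
  have [jE|jE|[jE|jE]] := I4 j.
  - eexists; left; right; split; last by []; by rewrite -jE.
  - by case: j1.
  - eexists; right; split; last by []; by rewrite -jE.
  - eexists; left; left; split; last by []; by rewrite -jE.
have [|||G' [P' sub G'E]] := @attach_orbit gT L (linear 3) (bid _) (inord 1) _ _ X _ _
  to_pt_rep G edge1_inner XO P hA.
- by move=> x z.
- by [].
- by move=> U g k k' _ _; exists (bid _).
have [rho rhoP] : @defd gT (rep_tree L) X G' _ (bid (linear 3)).
  by apply/G'E; right; exists 1%g, (bid _); exact: bmap_eq.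
have resG' (U : tree) (k : bmap U (linear 3)) : G' U k (dres k rho).
  have := pl_res P' k rhoP.
  by rewrite (_ : @dres (rep_tree L) _ _ k (bid _) = k) //; exact: bmap_eq.
exists rho; split=> [g|U k k2|U k k1 k3].
- have := pl_act P' g rhoP; rewrite (_ : @dact _ (rep_tree L) _ g (bid _) = bid _);
  last exact: bmap_eq.
  by move=> H; exact: (pl_fun P' H rhoP).
- by apply: (pl_fun P' (resG' U k)); apply: sub; right.
rewrite -E02 //; apply: (pl_fun P' (resG' U k)); apply: sub; left; left.
by [].
Qed.

End Simplex.

(** * Parts of the chain with four edges *)

Section Post.
Variables (gT : finGroupType) (A B : tree_act gT) (m : bmap A B).
Hypothesis mG : forall g x, m (ta_act A g x) = ta_act B g (m x).

Definition post_fun (U : tree) (h : rep_tree A U) : rep_tree B U := bcomp m h.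
Lemma post_res (U V : tree) (f : bmap U V) (h : rep_tree A V) :
  post_fun (dres f h) = dres f (post_fun h).
Proof. exact: bmap_eq. Qed.
Lemma post_act (U : tree) g (h : rep_tree A U) : post_fun (dact g h) = dact g (post_fun
  h).
Proof. by apply: bmap_eq => u; exact: mG. Qed.
Definition post := GMap post_res post_act.
End Post.

Section Within.
Variables (gT : finGroupType) (S : tree_act gT).
Local Notation W := (ext_act 3 S).

Definition within (P : pred nat) (U : tree) (h : bmap U W) :=
  forall u (k : 'I_4), h u = inr k -> P k.

Lemma within_le P (U V : tree) (f : bmap U W) (h : bmap V W) :
  image_le f h -> within P h -> within P f.
Proof. by move=> fh hP u k fu; have [w] := image_le_mem u fh; rewrite fu => /hP. Qed.

Lemma within_sub (P P' : pred nat) (U : tree) (h : bmap U W) :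
  (forall k, k < 4 -> P k -> P' k) -> within P h -> within P' h.
Proof. by move=> PP' hP u k /hP; apply: PP'. Qed.

Lemma within_act P (U : tree) g (h : bmap U W) : within P h ->
  within P (bcomp (ta_act W g) h).
Proof.
by move=> hP u k /=; case hu: (h u) => [x|l] //= [<-]; exact: hP hu.
Qed.

Definition fixed_by (s : seq nat) : pred nat := fun k => nth 0 s k == k.

(** The form of [cell_extension] used below: the part [J] of the chain is the set of
    fixed points of the list [s], and [R] is a set of faces in the domain closed
    under completion which contains all those that have to be matched. *)
Lemma cell_extension_seq (s : seq nat) (x : nat) (Q R : forall U : tree, bmap U W -> Prop)
    (X Y : gdset gT) (p : gmap X Y) (y : gmap (rep_tree W) Y)
    (G : forall U : tree, rep_tree W U -> X U -> Prop)
    (s4 : size s == 4) (s3 : all (fun k => k <= 3) s) (ss : sorted leq s) :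
  [&& x < 4, fixed_by s x, nth 0 s 3 != x & all (fun k => fixed_by s (nth 0 s k)) (iota
    0 4)] ->
  g_inner_fibration p -> face_class Q ->
  (forall (th : 'I_4 -> 'I_4) (th_mono : forall i j : 'I_4, i <= j -> th i <= th j)
     (th_idem : forall i, th (th i) = th i) (U : tree) (h : bmap U W) (hr :
       root_on_chain h),
     (Q U h -> Q _ (compl th_mono hr)) /\ (R U h -> R _ (compl th_mono hr))) ->
  partial_lift p y G ->
  (forall (U V : tree) (f : bmap U W) (h : bmap V W), image_le f h -> 
     defd G (h : rep_tree W V) -> defd G (f : rep_tree W U)) ->
  (forall (U : tree) (h : bmap U W), Q U h -> chain_only h ->
    defd G (h : rep_tree W U)) ->
  (forall (U : tree) (h : bmap U W) j, j < 4 -> j != x -> fixed_by s j -> Q U h ->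
     within (fun k => fixed_by s k && (k != j)) h -> defd G (h : rep_tree W U)) ->
  (forall (U : tree) (h : bmap U W), R U h -> defd G (h : rep_tree W U)) ->
  (forall (U : tree) (h : bmap U W), Q U h -> within (fixed_by s) h ->
    defd G (h : rep_tree W U) ->
     (forall j, j < 4 -> j != x -> fixed_by s j -> ~ within (fun k => k != j) h) ->
       ~ chain_only h ->
     R U h) ->
  exists G' : forall U : tree, rep_tree W U -> X U -> Prop, [/\ partial_lift p y G',
    forall U c z, G U c z -> G' U c z
    & forall (U : tree) (h : bmap U W), defd G' (h : rep_tree W U) <->
       defd G (h : rep_tree W U) \/ Q U h /\ within (fixed_by s) h].
Proof.
move=> /and4P[x4 sx s3x /allP sid] pF Qf QR P Gle Gchain Gface RG GR.
pose th := @seq_fun 3 3 s; have th_mono := @seq_fun_mono 3 3 s s4 s3 ss.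
have thE (k : 'I_4) : th k = nth 0 s k :> nat.
  by rewrite inordK // ltnS; apply: (allP s3); rewrite mem_nth // (eqP s4).
have th_fix (k : 'I_4) : th k = k <-> fixed_by s k.
  split=> [/(congr1 val)|/eqP E]; first by rewrite /= thE => /eqP.
  by apply: val_inj; rewrite /= thE.
have th_idem i : th (th i) = th i.
  by apply/th_fix; rewrite thE; apply: sid; rewrite mem_iota /=.
have within_part (U : tree) (h : bmap U W) : in_part th h <-> within (fixed_by s) h.
  by split=> H u k /H/th_fix.
have [||||G' [P' sub G'E]] := @cell_extension gT 3 S th (inord x) th_mono th_idem _ _ Q
  Qf _ X Y p y pF G.
- by apply/th_fix; rewrite inordK.
- by move=> /(congr1 val); rewrite /= thE inordK //= => /esym/eqP; apply/negP.
- by move=> U h hr hQ _; have [H _] := QR th th_mono th_idem U h hr; exact: H.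
- split=> //.
  + by move=> U h hQ _; exact: Gchain.
  + move=> U h j hQ hJ jJ jx hj; apply: (Gface U h j) => //; first last.
    * move=> u k hu; apply/andP; split; first by apply/th_fix; exact: hJ hu.
      by apply/eqP => kj; apply: (hj u); rewrite hu; congr inr; exact: val_inj.
    * exact/th_fix.
    * by apply/eqP => E; apply: jx; apply: val_inj; rewrite /= inordK.
  move=> U h hr hQ hJ hG hit nl; apply: RG; have [_ H] :=
    QR th th_mono th_idem U h hr; apply: H.
  apply: GR => //; first exact/within_part.
  move=> j j4 jx sj wj; have [||u hu] := hit (inord j).
  + by apply/th_fix; rewrite inordK.
  + by move=> /(congr1 val)/=; rewrite !inordK // => /eqP; apply/negP.
  by have := wj u _ hu; rewrite inordK // eqxx.
by exists G'; split=> // U h; rewrite G'E within_part.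
Qed.

End Within.

(** * Trees with a unary root vertex *)

Section UnaryRoot.
Variables (gT : finGroupType) (S : tree_act gT) (v : unary_root S).
Local Notation r := (ur_root v).
Local Notation a := (ur_edge v).
Local Notation W := (ext_act 3 S).

Lemma ar_neq : a <> r. Proof. exact: ur_neq. Qed.

Lemma ble_ar : ble [mset a] r. Proof. by case: (ur_edgeP v) => -[]. Qed.

Lemma troot_r : troot S = r. Proof. exact: root_uniq (@trootP S) (ur_rootP v). Qed.

Lemma ble_root_cases s : ble s r -> s = [mset r] \/ ble s a.
Proof.
move=> sr; have [E|ne] := pselect (s = [mset r]); [by left | right].
by case: (ur_edgeP v) => _ /(_ s (conj sr ne)) /blem1.
Qed.

Lemma led_cases x : x = r \/ led x a.
Proof.
have [s xs /ble_root_cases[sr|sa]] := ur_rootP v x; last by right; exists s.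
by left; apply/mset1P; rewrite -sr.
Qed.

Lemma led_a_neq x : led x a -> x <> r.
Proof.
by move=> xa xr; apply: ar_neq; apply: (led_anti (@tree_simple S)) (ur_rootP v a) _;
  rewrite -xr.
Qed.

Lemma mem_root s e : ble s e -> r \in s -> s = [mset r] /\ e = r.
Proof.
move=> se rs; have er : e = r.
  by apply: (led_anti (@tree_simple S)) (ur_rootP v e) _; exists s.
by split=> //; apply: (simple_loop (@tree_simple S)); rewrite -?er // er.
Qed.

Lemma mem_a s e : ble s e -> a \in s -> s = [mset a] /\ (e = a \/ e = r).
Proof.
move=> se as_; have ea : e = a \/ e = r.
  have [->|ea] := led_cases e; [by right | left].
  by apply: (led_anti (@tree_simple S)) ea _; exists s.
split=> //; apply: (simple_loop (@tree_simple S)) => //.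
case: ea se => -> // /ble_root_cases[sr|//].
by move: as_; rewrite sr => /mset1P/ar_neq.
Qed.

(** The degeneracy of [S] that contracts the root vertex. *)
Definition fold_fun (x : S) : S := if x == r then a else x.

Lemma fold_id x : x <> r -> fold_fun x = x.
Proof. by rewrite /fold_fun; case: eqP. Qed.

Lemma fold_r : fold_fun r = a. Proof. by rewrite /fold_fun eqxx. Qed.

Lemma fold_mset s : r \notin s -> mmap fold_fun s = s.
Proof.
move=> rs; rewrite -[RHS](@mmap_id _ id) //; apply: eq_in_mmap => x xs.
by apply: fold_id => xr; move: rs; rewrite -xr xs.
Qed.

Lemma fold_subproof s e : ble s e -> ble (mmap fold_fun s) (fold_fun e).
Proof.
move=> se; have [rs|rs] := boolP (r \in s).
  by have [-> ->] := mem_root se rs; rewrite mmap1; exact: ble_refl.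
rewrite fold_mset //; have [er|/fold_id -> //] := pselect (e = r).
rewrite er fold_r; move: se; rewrite er => /ble_root_cases[sr|//].
by move: rs; rewrite sr mset11.
Qed.
Definition fold : bmap S S := BMap fold_subproof.

Lemma foldK x : fold (fold x) = fold x.
Proof. by apply: fold_id; rewrite /= /fold_fun; case: eqP => // _; exact: ar_neq. Qed.

Lemma fold_act g x : fold (ta_act S g x) = ta_act S g (fold x).
Proof.
rewrite /= /fold_fun -{1}(act_root v g) (inj_eq (@gact_inj _ _ (ta_act S) g)).
by case: eqP => // _; rewrite act_edge.
Qed.

(** [spread] puts [S] into [W] with its root vertex along the chain, and
    [collapse] projects back, squashing the chain onto [a < r]. *)
Definition spread_fun (x : S) : W :=
  if x == r then inr (inord 3) else if x == a then inr (inord 0) else inl x.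

Lemma spread_r : spread_fun r = inr (inord 3). Proof. by rewrite /spread_fun eqxx. Qed.
Lemma spread_a : spread_fun a = inr (inord 0).
Proof. by rewrite /spread_fun eqxx; case: eqP => // /ar_neq. Qed.
Lemma spread_inl x : x <> r -> x <> a -> spread_fun x = inl x.
Proof. by move=> /eqP/negPf xr /eqP/negPf xa; rewrite /spread_fun xr xa. Qed.

Lemma spread_subproof s e : ble s e -> ble (mmap spread_fun s) (spread_fun e).
Proof.
move=> se; have [rs|/negP rs] := boolP (r \in s).
  by have [-> ->] := mem_root se rs; rewrite mmap1; exact: ble_refl.
have [as_|/negP as_] := boolP (a \in s).
  have [-> [->|->]] := mem_a se as_; rewrite mmap1 ?spread_a ?spread_r;
    first exact: ble_refl.
  by left; exists (inord 0) => //; rewrite !inordK.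
have -> : mmap spread_fun s = mmap inl s.
  apply: eq_in_mmap => x xs; apply: spread_inl => E; first by apply: rs; rewrite -E.
  by apply: as_; rewrite -E.
have [er|er] := pselect (e = r).
  by rewrite er spread_r; right; exists s => //; rewrite troot_r -er.
have [ea|ea] := pselect (e = a); last by rewrite spread_inl //; exists s.
rewrite ea spread_a; right; exists s => //; rewrite troot_r; apply: ble_trans1 ble_ar.
by rewrite -ea.
Qed.
Definition spread : bmap S W := BMap spread_subproof.

Definition collapse_chain (k : 'I_4) : S := if k == ord0 then a else r.
Lemma collapse_mono (i j : 'I_4) : i <= j -> ble [mset collapse_chain i]
  (collapse_chain j).
Proof.
rewrite /collapse_chain; case: eqP => [_|i0]; case: eqP => [E|_] ij; try exact: ble_refl.
  exact: ble_ar.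
by case: i0; apply: val_inj; apply/eqP; rewrite E in ij; rewrite /= -leqn0.
Qed.
Lemma collapse_root : ble [mset fold (troot S)] (collapse_chain ord0).
Proof. by rewrite troot_r /= fold_r; exact: ble_refl. Qed.
Definition collapse : bmap W S := ext_map collapse_mono collapse_root.

Definition collapse0 : bmap W S := bcomp fold collapse.

Lemma collapse0_inr k : collapse0 (inr k) = a.
Proof. by rewrite /= /collapse_chain; case: eqP => _;
  [exact/fold_id/ar_neq | exact: fold_r]. Qed.

Lemma collapse_pos (k : 'I_4) : 0 < k -> collapse (inr k) = r.
Proof. by rewrite /= /collapse_chain; case: eqP => // ->. Qed.

Lemma collapse_act g x : collapse (ta_act W g x) = ta_act S g (collapse x).
Proof.
case: x => [x|k]; first exact: fold_act.
by rewrite /= /collapse_chain; case: eqP => _; rewrite ?act_edge ?act_root.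
Qed.

Lemma collapse0_act g x : collapse0 (ta_act W g x) = ta_act S g (collapse0 x).
Proof. by rewrite -fold_act -collapse_act. Qed.

Lemma spread_act g x : spread (ta_act S g x) = ta_act W g (spread x).
Proof.
rewrite -[LHS]/(spread_fun _) -[spread x]/(spread_fun x).
have [->|xr] := pselect (x = r); first by rewrite act_root spread_r.
have [->|xa] := pselect (x = a); first by rewrite act_edge spread_a.
have ginj := @gact_inj _ _ (ta_act S) g.
rewrite !spread_inl // => E; [apply: xr | apply: xa]; apply: ginj.
  by rewrite E act_root.
by rewrite E act_edge.
Qed.

Lemma collapse_spread x : collapse (spread x) = x.
Proof.
have [->|xr] := pselect (x = r).
  by rewrite -[spread r]/(spread_fun r) spread_r collapse_pos // inordK.
have [->|xa] := pselect (x = a).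
  rewrite -[spread a]/(spread_fun a) spread_a /= /collapse_chain; case: eqP => // -[].
  by apply: val_inj; rewrite /= inordK.
by rewrite -[spread x]/(spread_fun x) spread_inl //= fold_id.
Qed.

(** Faces of [W] meeting neither [a] nor [r] stand for the faces [F * J] of
    the join of the forest above [a] with the chain. *)
Definition off_root (U : tree) (h : bmap U W) := forall u x, h u = inl x ->
  x <> a /\ x <> r.

Lemma to_off_root_root : @ble W [mset bcomp spread fold (troot S)] (inr ord0).
Proof.
rewrite troot_r /= fold_r spread_a; left; exists (inord 0) => //; by rewrite inordK.
Qed.
Definition to_off_root : bmap W W := ext_map (@ext_chain_mono 3 S) to_off_root_root.

Lemma to_off_root_act g x : to_off_root (ta_act W g x) = ta_act W g (to_off_root x).
Proof. by case: x => [x|//]; rewrite -[RHS]spread_act -[in RHS]fold_act. Qed.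

Lemma to_off_root_id (U : tree) (h : bmap U W) : off_root h -> bcomp to_off_root h = h.
Proof.
move=> hp; apply: bmap_eq => u; rewrite /=; case hu: (h u) => [x|k] //=.
by have [xa xr] := hp u x hu; rewrite fold_id // spread_inl.
Qed.

Lemma to_off_root_off (U : tree) (h : bmap U W) : off_root (bcomp to_off_root h).
Proof.
move=> u x /=; case: (h u) => [z|k] //=; rewrite /spread_fun.
by do 2 case: eqP => //; move=> ? ? [<-].
Qed.

Lemma off_root_fc : face_class off_root.
Proof.
split=> [U V f h fh hp u x fu|U g h hp u x /=].
  by have [w] := image_le_mem u fh; rewrite fu => /hp.
case hu: (h u) => [z|k] //= [<-]; have [za zr] := hp _ _ hu.
by split=> E; [apply: za | apply: zr]; apply: (@gact_inj _ _ (ta_act S) g);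
  rewrite E ?act_edge ?act_root.
Qed.

Lemma off_root_compl (th : 'I_4 -> 'I_4) (th_mono : forall i j : 'I_4, i <= j ->
  th i <= th j)
  (U : tree) (h : bmap U W) (hr : root_on_chain h) : off_root h ->
    off_root (compl th_mono hr).
Proof.
move=> hp [u|k] x //=; case hu: (h u) => [z|k] //= [<-]; exact: hp hu.
Qed.

(** The faces [F' * J] with [F'] equal to the whole forest [F]. *)
Definition full (U : tree) (h : bmap U W) :=
  forall s e, led e a -> ble s e -> traced (bcomp collapse0 h) s e.

Lemma full_le (U V : tree) (f : bmap U W) (h : bmap V W) : image_le f h -> full f ->
  full h.
Proof. by move=> fh ff s e ea se; apply: (image_le_post _ fh); exact: ff. Qed.

Lemma full_eq (U V : tree) (f : bmap U W) (h : bmap V W) :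
  image_le (bcomp collapse0 f) (bcomp collapse0 h) -> full f -> full h.
Proof. by move=> fh ff s e ea se; apply: fh; exact: ff. Qed.

Lemma full_act (U : tree) g (h : bmap U W) : full (bcomp (ta_act W g) h) -> full h.
Proof.
move=> hf s e ea se; have [||s' [e' [sE eE H]]] :=
  hf (mmap (ta_act S g) s) (ta_act S g e).
- by rewrite -(act_edge v g); exact: bmap_led.
- exact: bmapP.
exists s', e'; split=> //.
  apply: (mmap_inj (@gact_inj _ _ (ta_act S) g)); rewrite sE mmap_comp.
  by apply: eq_mmap => u /=; rewrite -collapse0_act.
by apply: (@gact_inj _ _ (ta_act S) g); rewrite eE -collapse0_act.
Qed.

Lemma nonfull_fc : face_class (fun U h => ~ @full U h).
Proof.
split=> [U V f h fh nh /(full_le fh) //|U g h nh /full_act //].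
Qed.

Lemma full_compl (th : 'I_4 -> 'I_4) (th_mono : forall i j : 'I_4, i <= j -> th i <= th j)
  (th_idem : forall i, th (th i) = th i)
  (U : tree) (h : bmap U W) (hr : root_on_chain h) : full (compl th_mono hr) -> full h.
Proof.
move=> hf s e ea se; have /traced_comp[s' [e' [-> -> H]]] := hf s e ea se.
have base k : traced (bcomp collapse0 h) [mset a] (collapse0 (inr k)).
  have [l hl] := hr; have := traced_refl (bcomp collapse0 h) (troot U).
  by rewrite -[bcomp collapse0 h _]/(collapse0 (h (troot U))) hl !collapse0_inr.
move/(traced_compl th_mono th_idem): H.
case=> [[x -> H]|[l [j [_ _ _ -> ->]]]|[j [k [_ -> _ H]]]].
- by apply/traced_comp; exists s', (inl x).
- by rewrite mmap1 collapse0_inr; exact: base.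
by rewrite collapse0_inr -(collapse0_inr k); apply/traced_comp; exists s', (inr k).
Qed.

Lemma chain_only_off_root (U : tree) (h : bmap U W) : chain_only h -> off_root h.
Proof. by move=> hl u x hu; have [l [k [_]]] := hl _ _ (ble_refl u); rewrite hu. Qed.

(** Since [S] has a second vertex, there is a vertex at [a]. *)
Lemma chain_only_nonfull (U : tree) (h : bmap U W) :
  1 < #|vertices S| -> chain_only h -> ~ full h.
Proof.
move=> two hl hf.
have [s [sa ne]] : exists s, blt s a.
  have [x xV xr] : exists2 x, x \in vertices S & x <> r.
    apply: contrapT => H; have : vertices S \subset [set r].
      apply/subsetP => x xV; rewrite inE; apply/eqP; apply: contrapT => xr.
      by apply: H; exists x.
    by move=> /subset_leq_card; rewrite cards1 leqNgt two.
  have [t tx] : exists t, blt t x.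
    by move: xV; rewrite inE => /asboolP[[t [tx _] _]|H]; [exists t | exists mset0;
      exact/H].
  have [//|xa] := led_cases x.
  have [<-|xa'] := pselect (x = a); first by exists t.
  have [u [_ [[[ua ne] _] _ _]]] := led_up xa xa'; by exists u.
have /traced_comp[s' [e' [sE _ H]]] := hf s a (led_refl a) sa.
have [t [x [s'E _ tx]]] := H; have [l [k [tl _]]] := hl _ _ tx.
by apply: ne; rewrite sE s'E tl mmap1 collapse0_inr.
Qed.

(** Both excluded faces contain the edge [a] and everything above it. *)
Lemma off_outer_horn (U : tree) (k : bmap U S) : ~ ohorn_mem v k ->
  (forall s e, led e a -> ble s e -> traced k s e) /\ exists u, k u = a.
Proof.
move=> /not_in_horn[A [AE im full]].
have inA x : led x a -> x \in A by case: AE => -> H; rewrite inE //; apply/asboolP.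
split=> [s e ea se|]; last by apply/im/inA/led_refl.
apply: full => // [|x xs]; first exact: inA.
by apply: inA; apply: led_trans ea; exists s.
Qed.

Lemma nonfull_horn (U : tree) (h : bmap U W) : ~ full h ->
  ohorn_mem v (bcomp collapse h) /\ ohorn_mem v (bcomp collapse0 h).
Proof.
move=> nf; split; apply: contrapT => /off_outer_horn[H _]; apply: nf => s e ea se.
  rewrite (_ : bcomp collapse0 h = bcomp fold (bcomp collapse h)); last exact: bmap_eq.
  have rs : r \notin s.
    by apply/negP => rs; have [_ er] := mem_root se rs; exact: (led_a_neq ea).
  apply/traced_comp; exists s, e; split; [by rewrite /= fold_mset| |exact: H].
  by rewrite /= fold_id //; exact: led_a_neq.
exact: H.
Qed.

Lemma avoid_a_horn (U : tree) (k : bmap U S) : (forall u, k u <> a) -> ohorn_mem v k.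
Proof. by move=> ka; apply: contrapT => /off_outer_horn[_ [u]]; exact: ka. Qed.

(** A face containing [a] and all relations above it is [S] or the outer face
    without [r], depending on whether it contains [r], since the
    non-trivial relations at [r] are those at [a]. Both are excluded from the horn. *)
Lemma outer_horn_nonfull (U : tree) (k : bmap U S) u : ohorn_mem v k -> k u = a ->
  ~ full (bcomp spread k).
Proof.
move=> [F [i [k' [iI iX ->]]]] ka hf; set b := k' u in ka.
have ib : i b = a by [].
have foldi s e : led e a -> ble s e -> traced (bcomp fold i) s e.
  move=> ea se; have := hf s e ea se.
  rewrite (_ : bcomp collapse0 _ = bcomp (bcomp fold i) k'); last first.
    by apply: bmap_eq => w; exact: (congr1 fold (collapse_spread (i (k' w)))).
  exact: (image_le_comp (bcomp fold i) k').
have r_root e : i e = r -> led b e.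
  move=> ie; have -> : e = troot F.
    apply: iI; rewrite ie; apply: (led_anti (@tree_simple S)) _ (ur_rootP v _).
    by rewrite -ie; exact: bmap_led (trootP e).
  exact: trootP.
have unary e t : i e = r -> ble t e -> b \in t -> t = [mset b].
  move=> ie te bt; have [|E _] := mem_a (bmapP i te); first by rewrite -ib mmap_mem.
  by have [w tw _] := mmap_eq1 E; move: bt; rewrite tw => /mset1P ->.
have full_i s e : led e a -> ble s e -> traced i s e.
  move=> ea se; have [s' [e' [sE eE H]]] := foldi s e ea se.
  have [rs|rs] := boolP (r \in mmap i s').
    have [s'r e'r] := mem_root (bmapP i H) rs.
    have -> : s = [mset a].
      by rewrite sE -(mmap_comp fold i) s'r mmap1 /= fold_r.
    by rewrite eE /= e'r fold_r -ib; exact: traced_refl.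
  have {}sE : s = mmap i s' by rewrite sE -(mmap_comp fold i) fold_mset.
  have [e'r|e'r] := pselect (i e' = r); last first.
    by exists s', e'; rewrite eE /= fold_id.
  have ea' : e = a by rewrite eE /= e'r fold_r.
  rewrite ea' -ib; have [H'|[z s'z bz]] :=
    unary_path (r_root _ e'r) (fun t => @unary e' t e'r) H.
    by exists s', b.
  have zb : z = b.
    apply: iI; rewrite ib; apply: (led_anti (@tree_simple S)).
      by exists s; [rewrite sE s'z mmap1 mset11 | rewrite -ea'].
    by rewrite -ib; exact: bmap_led.
  by rewrite sE s'z zb mmap1; exact: traced_refl.
have im x : led x a -> exists w, i w = x.
  by move=> xa; have [s [w [_ -> _]]] := full_i _ _ xa (ble_refl x); exists w.
have reflect s e : led (i e) a -> ble (mmap i s) (i e) -> ble s e.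
  by move=> ea /(full_i _ _ ea)[s' [e' [/(mmap_inj iI) -> /iI -> //]]].
have [[e0 ie0]|nr] := pselect (exists e, i e = r).
  apply: (iX setT); [by left | split=> [x|s e H]].
    rewrite inE; split=> // _; have [->|/im //] := led_cases x; by exists e0.
  have [ie|ea] := led_cases (i e); last exact: reflect.
  rewrite ie in H; have [/mmap_eq1[w -> iw]|sa] := ble_root_cases H.
    by have -> : w = e; [apply: iI; rewrite iw | exact: ble_refl].
  have sb : ble s b by apply: reflect; rewrite ib //; exact: led_refl.
  have [t bt te] := r_root e ie.
  by apply: ble_trans1 sb _; rewrite -(unary e t ie te bt).
apply: (iX [set e | `[< led e a >]]); [by right | split=> [x|s e H]].
  rewrite inE; split=> [/asboolP/im //|[w <-]]; apply/asboolP.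
  by have [iw|//] := led_cases (i w); case: nr; exists w.
by have [ie|ea] := led_cases (i e); [case: nr; exists e | exact: reflect].
Qed.

End UnaryRoot.

(** * Partial lifts on the join with a simplex *)

Section JoinLift.
Variables (gT : finGroupType) (S : tree_act gT) (v : unary_root S).
Local Notation W := (ext_act 3 S).

Lemma chain_subproof (s : {mset linear 3}) (e : linear 3) :
  ble s e -> @ble W (mmap inr s) (inr e).
Proof. by move=> [i -> ie]; rewrite mmap1; exact: ext_chain_mono. Qed.
Definition chain : bmap (linear 3) W := BMap chain_subproof.

Lemma chain_only_chain (U : tree) (k : bmap U (linear 3)) : chain_only (bcomp chain k).
Proof.
move=> s e /(bmapP k)[i sk _]; exists i, (k e); split=> //.
by rewrite -(mmap_comp chain k) sk mmap1.
Qed.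

Lemma chain_only_factor (U : tree) (h : bmap U W) : chain_only h ->
  exists k : bmap U (linear 3), h = bcomp chain k.
Proof.
move=> hl; have /choice[k kE] u : exists i : 'I_4, h u = inr i.
  by have [_ [i [_ ->]]] := hl _ _ (ble_refl u); exists i.
have kP (s : {mset U}) e : ble s e -> @ble (linear 3) (mmap k s) (k e).
  move=> se; have [l [_ [sl _]]] := hl _ _ se.
  have [u su hu] := mmap_eq1 sl; move: se; rewrite su mmap1 => ue.
  have ul : k u = l by move: hu; rewrite kE => -[].
  have [_ [j]] := chain_single ue (mset11 u) (kE u).
  by rewrite kE => -[<-] uj; exists (k u).
by exists (BMap kP); apply: bmap_eq => u; rewrite kE.
Qed.

Lemma chain_only_le (U V : tree) (f : bmap U W) (h : bmap V W) :
  image_le f h -> chain_only h -> chain_only f.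
Proof.
move=> fh hl s e /(traced_map f)/fh[s' [e' [-> -> H]]]; exact: hl.
Qed.

Lemma chain_bcompI (U : tree) (k k' : bmap U (linear 3)) :
  bcomp chain k = bcomp chain k' -> k = k'.
Proof.
move=> E; apply: bmap_eq => u.
by have := congr1 (fun h : bmap U W => h u) E => /= -[].
Qed.

Lemma off_root_eq (U : tree) (h : bmap U W) : off_root v h ->
  within (fun k => k == 0) h ->
  bcomp (collapse v) h = bcomp (collapse0 v) h.
Proof.
move=> ho h0; apply: bmap_eq => u /=; case hu: (h u) => [x|k] /=;
  first exact: (esym (foldK v x)).
have -> : k = ord0 by apply/val_inj/eqP; exact: h0 hu.
by rewrite /collapse_chain /= fold_id //; exact: ar_neq.
Qed.

Variables (X Y : gdset gT) (p : gmap X Y) (y : gmap (rep_tree W) Y) (yS : gmap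
  (rep_tree S) Y).
Variables (F : forall U : tree, rep_tree S U -> X U -> Prop) (rho : X (linear 3)).
Variable T : forall U : tree, bmap U W -> Prop.
Hypothesis pF : g_inner_fibration p.
Hypothesis FP : partial_lift p yS F.
Hypothesis rho_fixed : forall g, dact g rho = rho.
Hypothesis rho_over : forall (U : tree) (k : bmap U (linear 3)),
  p U (dres k rho) = y U (bcomp chain k : rep_tree W U).
Hypothesis rho013 : forall (U : tree) (k : bmap U (linear 3)), (forall u,
  k u <> inord 2) ->
  @F U (bcomp (collapse v) (bcomp chain k)) (dres k rho).
Hypothesis rho02 : forall (U : tree) (k : bmap U (linear 3)), (forall u,
  k u <> inord 1) ->
  (forall u, k u <> inord 3) -> @F U (bcomp (collapse0 v) (bcomp chain k)) (dres k rho).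
Local Notation P013 := (fun k : nat => k != 2).
Local Notation P02 := (fun k : nat => (k != 1) && (k != 3)).
Hypothesis over013 : forall (U : tree) (h : bmap U W), off_root v h -> within P013 h ->
  yS U (bcomp (collapse v) h : rep_tree S U) = y U (h : rep_tree W U).
Hypothesis over02 : forall (U : tree) (h : bmap U W), off_root v h -> within P02 h ->
  yS U (bcomp (collapse0 v) h : rep_tree S U) = y U (h : rep_tree W U).
Hypothesis T_fc : face_class T.
Hypothesis T_compl : forall (th : 'I_4 -> 'I_4) (th_mono : forall i j : 'I_4,
  i <= j -> th i <= th j),
  (forall i, th (th i) = th i) -> forall (U : tree) (h : bmap U W) (hr : root_on_chain h),
  T h -> T (compl th_mono hr).
Hypothesis T013 : forall (U : tree) (h : bmap U W), off_root v h -> T h ->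
  within P013 h ->
  defd F (bcomp (collapse v) h : rep_tree S U).
Hypothesis T02 : forall (U : tree) (h : bmap U W), off_root v h -> T h -> within P02 h ->
  defd F (bcomp (collapse0 v) h : rep_tree S U).

Definition chain_graph (U : tree) (h : rep_tree W U) (x : X U) : Prop :=
  exists2 k : bmap U (linear 3), h = bcomp chain k & x = dres k rho.

Lemma chain_graph_lift : partial_lift p y chain_graph.
Proof.
split=> [U c x x' [k -> ->] [k' /chain_bcompI -> ->] //|U V f c x [k ->
  ->]|U g c x [k -> ->]|U c x [k -> ->]].
- by exists (bcomp k f); [exact: bmap_eq | rewrite dres_comp].
- by exists k; [exact: bmap_eq | rewrite dact_res rho_fixed].
exact: rho_over.
Qed.

Definition stage_class (U : tree) (h : bmap U W) := off_root v h /\ T h.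

Lemma stage_class_fc : face_class stage_class.
Proof.
split=> [U V f h fh [ho hT]|U g h [ho hT]]; split.
- exact: (fc_le (off_root_fc v) fh ho).
- exact: (fc_le T_fc fh hT).
- exact: (fc_act (off_root_fc v) g ho).
- exact: (fc_act T_fc g hT).
Qed.

Definition collapse_rep := post (@collapse_act gT S v).
Definition collapse0_rep := post (@collapse0_act gT S v).

Lemma stage_within_res P (U V : tree) (f : bmap U V) (h : bmap V W) : stage_class h /\
  within P h ->
  stage_class (bcomp h f) /\ within P (bcomp h f).
Proof.
move=> [hQ hP]; split; first exact: (fc_le stage_class_fc (image_le_comp h f) hQ).
exact: within_le (image_le_comp h f) hP.
Qed.

Lemma stage_within_act P (U : tree) g (h : bmap U W) : stage_class h /\ within P h ->
  stage_class (bcomp (ta_act W g) h) /\ within P (bcomp (ta_act W g) h).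
Proof.
by move=> [hQ hP]; split; [exact: (fc_act stage_class_fc g hQ) | exact: within_act].
Qed.

Definition graph013 (U : tree) (h : rep_tree W U) (x : X U) : Prop :=
  (stage_class h /\ within P013 h) /\ F (collapse_rep U h) x.
Definition graph02 (U : tree) (h : rep_tree W U) (x : X U) : Prop :=
  (stage_class h /\ within P02 h) /\ F (collapse0_rep U h) x.

Lemma graph013_lift : partial_lift p y graph013.
Proof.
apply: (@partial_lift_pull gT (rep_tree S) (rep_tree W) X Y p yS y collapse_rep
  (fun U h => stage_class h /\ within P013 h) F) FP => [U V f c|U g c|U c [[co _] cP]].
- exact: stage_within_res.
- exact: stage_within_act.
exact: over013.
Qed.

Lemma graph02_lift : partial_lift p y graph02.
Proof.
apply: (@partial_lift_pull gT (rep_tree S) (rep_tree W) X Y p yS y collapse0_rep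
  (fun U h => stage_class h /\ within P02 h) F) FP => [U V f c|U g c|U c [[co _] cP]].
- exact: stage_within_res.
- exact: stage_within_act.
exact: over02.
Qed.

Definition base_graph (U : tree) (h : rep_tree W U) (x : X U) : Prop :=
  (chain_graph h x \/ graph013 h x) \/ graph02 h x.

Lemma chain_avoid P (U : tree) (k : bmap U (linear 3)) (j : nat) : j < 4 -> ~~ P j ->
  within P (bcomp chain k) -> forall u, k u <> inord j.
Proof. by move=> j4 nP kP u ku; have := kP u _ (congr1 inr ku);
  rewrite inordK // (negPf nP). Qed.

Lemma base_graph_lift : partial_lift p y base_graph.
Proof.
apply: partial_lift_union; [apply: partial_lift_union| |].
- exact: chain_graph_lift.
- exact: graph013_lift.
- move=> U c x x' [k -> ->] [[_ kP] H].
  by apply: (pl_fun FP _ H); apply: rho013; exact: chain_avoid kP.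
- exact: graph02_lift.
move=> U c x x' [[k -> ->]|[[[co _] c013] H]] [[_ c02] H'].
  by apply: (pl_fun FP _ H'); apply: rho02; exact: chain_avoid c02.
apply: (pl_fun FP H); rewrite -[collapse_rep U c]/(bcomp _ c) off_root_eq // => u k hu.
by have := c013 u k hu; have := c02 u k hu; case: k {hu} => [[|[|[|[|]]]]].
Qed.

Lemma base_graph_defd (U : tree) (h : bmap U W) : defd base_graph (h : rep_tree W U) <->
  chain_only h \/ stage_class h /\ (within P013 h \/ within P02 h).
Proof.
split=> [[x [[[k -> _]|[[hQ hP] _]]|[[hQ hP]
  _]]]|[/chain_only_factor[k ->]|[hQ [hP|hP]]]].
- by left; exact: chain_only_chain.
- by right; split=> //; left.
- by right; split=> //; right.
- by exists (dres k rho); left; left; exists k.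
- by have [x H] := T013 hQ.1 hQ.2 hP; exists x; left; right.
by have [x H] := T02 hQ.1 hQ.2 hP; exists x; right.
Qed.

Lemma stage_class_compl (th : 'I_4 -> 'I_4) (th_mono : forall i j : 'I_4, i <= j ->
  th i <= th j)
  (th_idem : forall i, th (th i) = th i) (U : tree) (h : bmap U W) (hr : root_on_chain
    h) :
  (stage_class h -> stage_class (compl th_mono hr)) /\ (False -> False).
Proof.
split=> // -[ho hT]; split; first exact: off_root_compl.
exact: T_compl.
Qed.

Lemma stage_within_le P (U V : tree) (f : bmap U W) (h : bmap V W) : image_le f h ->
  stage_class h /\ within P h -> stage_class f /\ within P f.
Proof.
by move=> fh [hQ hP]; split; [exact: (fc_le stage_class_fc fh hQ) | exact: within_le fh
  hP].
Qed.

Local Ltac within_case H := apply: (within_sub _ H) => -[|[|[|[|?]]]].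

(** Starting from the chain and from the parts [013] and [02], one adds the parts
    [012], [123] and [0123] of the chain, along horns at [0], [1] and [1]. No
    face has to be matched, as the faces opposite to these vertices are
    missing at each time. *)
Lemma join_lift : exists G : forall U : tree, rep_tree W U -> X U -> Prop,
  [/\ partial_lift p y G, forall U c x, base_graph c x -> G U c x
    & forall (U : tree) (h : bmap U W), defd G (h : rep_tree W U) <->
      chain_only h \/ stage_class h].
Proof.
have base_le (U V : tree) (f : bmap U W) (h : bmap V W) : image_le f h ->
    defd base_graph (h : rep_tree W V) -> defd base_graph (f : rep_tree W U).
  move=> fh /base_graph_defd[hl|[hQ hP]]; apply/base_graph_defd.
    by left; exact: chain_only_le hl.
  right; split; first exact: (fc_le stage_class_fc fh hQ).
  by case: hP => hP; [left|right]; exact: within_le fh hP.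
have [|||||G1 [P1 sub1 G1E]] := @cell_extension_seq gT S [:: 0; 1; 2; 2]
  0 stage_class (fun _ _ => False)
  X Y p y base_graph isT isT isT isT pF stage_class_fc stage_class_compl base_graph_lift.
- exact: base_le.
- by move=> U h _ hl; apply/base_graph_defd; left.
- move=> U h [|[|[|[|j]]]] // _ _ _ hQ hP; apply/base_graph_defd; right; split=> //.
    by right; within_case hP.
  by left; within_case hP.
- by [].
- move=> U h hQ hP /base_graph_defd[//|[_ [h013|h02]]] hit nl.
    by case: (hit 2 isT isT isT); within_case h013.
  by case: (hit 1 isT isT isT); within_case h02.
have [|||||G2 [P2 sub2 G2E]] := @cell_extension_seq gT S [:: 1; 1; 2; 3]
  1 stage_class (fun _ _ => False)
  X Y p y G1 isT isT isT isT pF stage_class_fc stage_class_compl P1.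
- move=> U V f h fh /G1E[/(base_le _ _ _ _ fh) H|H]; apply/G1E; [by left | right].
  exact: stage_within_le H.
- by move=> U h _ hl; apply/G1E; left; apply/base_graph_defd; left.
- move=> U h [|[|[|[|j]]]] // _ _ _ hQ hP; apply/G1E.
    by left; apply/base_graph_defd; right; split=> //; left; within_case hP.
  by right; split=> //; within_case hP.
- by [].
- move=> U h hQ hP /G1E[/base_graph_defd[//|[_ [h013|h02]]]|[_ h012]] hit nl.
  + by case: (hit 2 isT isT isT); within_case h013.
  + by case: (hit 3 isT isT isT); within_case h02.
  by case: (hit 3 isT isT isT); within_case h012.
have [|||||G3 [P3 sub3 G3E]] := @cell_extension_seq gT S [:: 0; 1; 2; 3]
  1 stage_class (fun _ _ => False)
  X Y p y G2 isT isT isT isT pF stage_class_fc stage_class_compl P2.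
- move=> U V f h fh /G2E[/G1E[/(base_le _ _ _ _ fh) H|H]|H]; apply/G2E; [left;
  apply/G1E; by left | left; apply/G1E; right | right].
    exact: stage_within_le H.
  exact: stage_within_le H.
- by move=> U h _ hl; apply/G2E; left; apply/G1E; left; apply/base_graph_defd; left.
- move=> U h [|[|[|[|j]]]] // _ _ _ hQ hP; apply/G2E.
  + by right; split=> //; within_case hP.
  + left; apply/G1E; left; apply/base_graph_defd; right; split=> //; left;
    within_case hP => //.
  by left; apply/G1E; right; split=> //; within_case hP.
- by [].
- move=> U h hQ hP /G2E[/G1E[/base_graph_defd[//|[_ [h013|h02]]]|[_ h012]]|[_ h123]]
  hit nl.
  + by case: (hit 2 isT isT isT); within_case h013.
  + by case: (hit 3 isT isT isT); within_case h02.
  + by case: (hit 3 isT isT isT); within_case h012.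
  by case: (hit 0 isT isT isT); within_case h123.
exists G3; split=> // [U c x H|U h]; first exact/sub3/sub2/sub1.
rewrite G3E G2E G1E base_graph_defd; split=> [[[[[|[]]|[]]|[]]|[]]|[hl|hQ]]; auto.
  by right; split=> // u k _; case: k => [[|[|[|[|]]]]].
Qed.

End JoinLift.

(** * Lifting against the outer horn *)

Section OuterHornLift.
Variables (gT : finGroupType) (S : tree_act gT) (v : unary_root S).
Local Notation W := (ext_act 3 S).
Hypothesis two_vertices : 1 < #|vertices S|.
Variables (X Y : gdset gT) (p : gmap X Y).
Hypothesis pF : g_inner_fibration p.
Variables (f : gmap (sub_gdset (outer_horn v)) X) (y : gmap (rep_tree S) Y).
Hypothesis square : commutes (sub_incl (outer_horn v)) p f y.

Definition horn_graph (U : tree) (k : rep_tree S U) (x : X U) : Prop :=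
  exists H : gs_mem (outer_horn v) k, x = f U (exist _ k H).

Lemma horn_graph_lift : partial_lift p y horn_graph.
Proof.
split=> [U c x x' [H ->] [H' ->]|U V k c x [H ->]|U g c x [H ->]|U c x [H ->]].
- by congr (f U _); apply: sub_eq.
- by exists (gs_res k H); rewrite -gm_res; congr (f U _); apply: sub_eq.
- by exists (gs_act g H); rewrite -gm_act; congr (f U _); apply: sub_eq.
by rewrite square.
Qed.

Lemma horn_graph_defd (U : tree) (k : bmap U S) :
  ohorn_mem v k -> defd horn_graph (k : rep_tree S U).
Proof. by move=> H; exists (f U (exist _ (k : rep_tree S U) H)); exists H. Qed.

Lemma squash2_root : @ble W [mset ext_inl 3 S (troot S)] (inr (inord 2)).
Proof. by right; exists [mset troot S]; rewrite ?mmap1 //; exact: ble_refl. Qed.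
Definition squash2 : bmap W W :=
  @ext_map 3 S W (ext_inl 3 S) (fun=> inr (inord 2)) (fun _ _ _ => ble_refl _)
    squash2_root.

Lemma squash2_act g x : squash2 (ta_act W g x) = ta_act W g (squash2 x).
Proof. by case: x. Qed.

Lemma collapse0_squash2 (U : tree) (h : bmap U W) :
  bcomp (collapse0 v) (bcomp squash2 h) = bcomp (collapse0 v) h.
Proof.
apply: bmap_eq => u; rewrite -[LHS]/(collapse0 v (squash2 (h u))) -[RHS]/(collapse0 v
  (h u)).
by case: (h u) => [x //|k]; rewrite -[squash2 _]/(inr _) !collapse0_inr.
Qed.

Definition spread_rep := post (@spread_act gT S v).
Definition squash2_rep := post squash2_act.
Definition to_off_root_rep := post (@to_off_root_act gT S v).

Local Notation P013 := (fun k : nat => k != 2).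
Local Notation P02 := (fun k : nat => (k != 1) && (k != 3)).
Local Notation off := (@off_root gT S v).
Local Notation nonfull h := (~ full v h).
Local Ltac within_case H := apply: (within_sub _ H) => -[|[|[|[|?]]]].

Hypothesis YO : g_inf_operad Y.
Variable rho : X (linear 3).
Hypothesis rho_fixed : forall g, dact g rho = rho.
Hypothesis rho013 : forall (U : tree) (k : bmap U (linear 3)), (forall u,
  k u <> inord 2) ->
  @horn_graph U (bcomp (collapse v) (bcomp (chain S) k)) (dres k rho).
Hypothesis rho02 : forall (U : tree) (k : bmap U (linear 3)), (forall u,
  k u <> inord 1) ->
  (forall u, k u <> inord 3) -> @horn_graph U (bcomp (collapse0 v) (bcomp (chain S) k))
    (dres k rho).

(** On [F * [3]] the map to [Y] must agree with the simplex on the chain, and be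
    degenerate on the parts [013] and [02]. *)
Lemma base_lift : exists z : gmap (rep_tree W) Y, [/\
  forall (U : tree) (k : bmap U (linear 3)),
    p U (dres k rho) = z U (bcomp (chain S) k : rep_tree W U),
  forall (U : tree) (h : bmap U W), off h -> within P013 h ->
    y U (bcomp (collapse v) h : rep_tree S U) = z U (h : rep_tree W U)
  & forall (U : tree) (h : bmap U W), off h -> within P02 h ->
    y U (bcomp (collapse0 v) h : rep_tree S U) = z U (h : rep_tree W U)].
Proof.
(* The data of the lifting problem, seen in [Y], come from [y] and [p rho]. *)
pose F (U : tree) (k : rep_tree S U) (x : Y U) := x = y U k.
have FP : partial_lift (to_terminal Y) (to_terminal (rep_tree S)) F.
  split=> [U c x x' -> -> //|U V k c x ->|U g c x ->|//]; first by rewrite /F gm_res.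
  by rewrite /F gm_act.
have hF (U : tree) (k : rep_tree S U) x : horn_graph k x -> F U k (p U x).
  by move=> H; rewrite /F (pl_over horn_graph_lift H).
have [G [GP sub GE]] := @join_lift gT S v Y (terminal gT) (to_terminal Y) (to_terminal
  (rep_tree W))
  (to_terminal (rep_tree S)) F (p _ rho) (fun _ _ => True) YO FP
  (fun g => etrans (esym (gm_act p g rho)) (congr1 (p (linear 3)) (rho_fixed g)))
  (fun _ _ => erefl)
  (fun U k k2 => etrans (esym (gm_res p k rho)) (hF _ _ _ (rho013 k2)))
  (fun U k k1 k3 => etrans (esym (gm_res p k rho)) (hF _ _ _ (rho02 k1 k3)))
  (fun _ _ _ _ => erefl) (fun _ _ _ _ => erefl)
  (FaceClass (fun _ _ _ _ _ _ => I) (fun _ _ _ _ => I)) (fun _ _ _ _ _ _ _ => I)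
  (fun U h _ _ _ => ex_intro _ _ erefl) (fun U h _ _ _ => ex_intro _ _ erefl).
have [|z zP] := @partial_lift_total gT (rep_tree W) Y _ _ _ (rep_tree W)
  to_off_root_rep G GP.
  by move=> U h; apply/GE; right; split=> //; exact: to_off_root_off.
have zE (U : tree) (h : bmap U W) : off h -> G U h (z U h).
  by move=> ho; have := zP U h; rewrite [to_off_root_rep U h](to_off_root_id ho).
exists z; split=> [U k|U h ho hP|U h ho hP].
- apply: (pl_fun GP) (zE _ _ _).
    by apply: sub; left; left; exists k => //; rewrite gm_res.
  exact/chain_only_off_root/chain_only_chain.
- by apply: (pl_fun GP) (zE _ _ ho); apply: sub; left; right.
by apply: (pl_fun GP) (zE _ _ ho); apply: sub; right.
Qed.

(** In [X], the construction for [Y] can only be repeated on the boundary of [F],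
    where the horn provides values. On [F] itself, the horn gives the part [13],
    as a degeneracy of its face without [a]; two horns at [1] add [12] and
    [123]. The value found at [2] is the source of the lift to be constructed:
    it is spread over [02] by a degeneracy, and a horn at [2] produces [03]. *)
Lemma outer_horn_lift : has_lift (sub_incl (outer_horn v)) p f y.
Proof.
have [z [z_rho z013 z02]] := base_lift.
have hdef (U : tree) (h : bmap U W) : nonfull h ->
    defd horn_graph (bcomp (collapse v) h : rep_tree S U) /\
    defd horn_graph (bcomp (collapse0 v) h : rep_tree S U).
  by move=> /nonfull_horn[H H']; split; exact: horn_graph_defd.
(* The boundary of the forest, over the whole simplex. *)
have [G3 [P3 base3 G3E]] := @join_lift gT S v X Y p z y horn_graph rho (fun U h =>
  nonfull h) pF
  horn_graph_lift rho_fixed z_rho rho013 rho02 z013 z02 (nonfull_fc v)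
  (fun th th_mono th_idem U h hr (nf : nonfull h) H => nf (full_compl th_idem H))
  (fun U h _ nf _ => (hdef U h nf).1) (fun U h _ nf _ => (hdef U h nf).2).
have {G3E}G3E (U : tree) (h : bmap U W) : defd G3 (h : rep_tree W U) <->
  off h /\ nonfull h.
  rewrite G3E; split=> [[hl|//]|]; last by right.
  by split; [exact: chain_only_off_root | exact: chain_only_nonfull].
pose R (U : tree) (h : bmap U W) := off h /\ nonfull h.
have QR (th : 'I_4 -> 'I_4) (th_mono : forall i j : 'I_4, i <= j -> th i <= th j)
    (th_idem : forall i, th (th i) = th i) (U : tree) (h : bmap U W) (hr :
      root_on_chain h) :
    (off h -> off (compl th_mono hr)) /\ (R U h -> R _ (compl th_mono hr)).
  split=> [|[ho nf]]; [exact: off_root_compl | split; first exact: off_root_compl].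
  by move=> /(full_compl th_idem).
have R_le (U V : tree) (g : bmap U W) (h : bmap V W) : image_le g h -> R V h -> R U g.
  by move=> gh [ho nf]; split; [exact: (fc_le (off_root_fc v) gh ho) | move=> /(full_le
    gh)].
have ow_le P (U V : tree) (g : bmap U W) (h : bmap V W) : image_le g h ->
    off h /\ within P h -> off g /\ within P g.
  by move=> gh [ho hP]; split; [exact: (fc_le (off_root_fc v) gh ho) | exact: within_le
    gh hP].
have ow_act P (U : tree) g (h : bmap U W) : off h /\ within P h ->
    off (bcomp (ta_act W g) h) /\ within P (bcomp (ta_act W g) h).
  by move=> [ho hP]; split; [exact: (fc_act (off_root_fc v) g ho) | exact: within_act].
(* The collapse sends faces over [13] to faces of [S] without [a]. *)
pose P13 k := (k != 0) && (k != 2).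
pose GC (U : tree) (h : rep_tree W U) (x : X U) :=
  (off h /\ within P13 h) /\ horn_graph (collapse_rep v U h) x.
have PC : partial_lift p z GC.
  apply: (@partial_lift_pull gT (rep_tree S) (rep_tree W) X Y p y z (collapse_rep v)
    (fun U h => off h /\ within P13 h) horn_graph) horn_graph_lift.
  - by move=> U V g c; apply: ow_le; exact: (image_le_comp c g).
  - by move=> U g c; exact: ow_act.
  by move=> U c [co cP]; apply: z013 => //; within_case cP.
have GCdef (U : tree) (h : bmap U W) : off h -> within P13 h ->
  defd GC (h : rep_tree W U).
  move=> ho hP; have [|x xP] := @horn_graph_defd U (bcomp (collapse v) h);
    last by exists x.
  apply: avoid_a_horn => u /=; case hu: (h u) => [x|k] /=.
    by have [xa xr] := ho u x hu; rewrite fold_id.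
  by rewrite -[collapse_chain _ _]/(collapse v (inr k)) collapse_pos; 
    [move=> ra; exact: (ar_neq (esym ra)) | have := hP u k hu; case: k {hu} => [[|k]]].
have P4 : partial_lift p z (fun U h x => G3 U h x \/ GC U h x).
  apply: partial_lift_union => // U c x x' H [[co cP] H'].
  apply: (pl_fun P3 H); apply: base3; left; right; split=> //; split.
    by split=> //; apply: ((G3E U c).1 _).2; exists x.
  by within_case cP.
set G4 := (fun U h x => _) in P4.
have G4E (U : tree) (h : bmap U W) : defd G4 (h : rep_tree W U) <->
  R U h \/ off h /\ within P13 h.
  split=> [[x [H|[H _]]]|[/G3E[x H]|[ho hP]]]; [left|by right|by exists x; left|].
    by apply/G3E; exists x.
  by have [x H] := GCdef U h ho hP; exists x; right.
have [|||||G5 [P5 sub5 G5E]] := @cell_extension_seq gT S [:: 1; 1; 2; 2]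
  1 (fun U h => off h) R
  X Y p z G4 isT isT isT isT pF (off_root_fc v) QR P4.
- move=> U V g h gh /G4E[H|H]; apply/G4E; [left|right]; [exact: R_le H|exact: ow_le H].
- move=> U h ho hl; apply/G4E; left; split=> //; exact: chain_only_nonfull.
- move=> U h [|[|[|[|j]]]] // _ _ _ ho hP; apply/G4E; right; split=> //;
  by within_case hP.
- by move=> U h H; apply/G4E; left.
- move=> U h ho hP /G4E[//|[_ h13]] hit _.
  by case: (hit 2 isT isT isT); within_case h13.
have [|||||G6 [P6 sub6 G6E]] := @cell_extension_seq gT S [:: 1; 1; 2; 3]
  1 (fun U h => off h) R
  X Y p z G5 isT isT isT isT pF (off_root_fc v) QR P5.
- move=> U V g h gh /G5E[/G4E[H|H]|H]; apply/G5E; 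
    [left; apply/G4E; left|left; apply/G4E; right|right]; 
    [exact: R_le H|exact: ow_le H|exact: ow_le H].
- move=> U h ho hl; apply/G5E; left; apply/G4E; left; split=> //;
  exact: chain_only_nonfull.
- move=> U h [|[|[|[|j]]]] // _ _ _ ho hP; apply/G5E.
    by left; apply/G4E; right; split=> //; within_case hP.
  by right; split=> //; within_case hP.
- by move=> U h H; apply/G5E; left; apply/G4E; left.
- move=> U h ho hP /G5E[/G4E[//|[_ h13]]|[_ h12]] hit _.
    by case: (hit 2 isT isT isT); within_case h13.
  by case: (hit 3 isT isT isT); within_case h12.
(* The part of the domain needed for the last horn, with its value at the edge [2]
   then repeated on [02]. *)
pose P23 k := (k != 0) && (k != 1).
pose D7 (U : tree) (h : bmap U W) := R U h \/ off h /\ within P23 h.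
have D7_le (U V : tree) (g : bmap U W) (h : bmap V W) : image_le g h -> D7 V h -> D7 U g.
  by move=> gh [H|H]; [left; exact: R_le H | right; exact: ow_le H].
have P7 : partial_lift p z (fun U h x => D7 U h /\ G6 U h x).
  apply: partial_lift_restrict => // [U V g c|U g c [[co nf]|H]].
  - by apply: D7_le; exact: (image_le_comp c g).
  - by left; split; [exact: (fc_act (off_root_fc v)) | exact: (fc_act (nonfull_fc v))].
  by right; exact: ow_act.
set G7 := (fun U h x => _) in P7.
have sub36 U h x : G3 U h x -> G6 U h x by move=> H; apply/sub6/sub5; left.
have G7def (U : tree) (h : bmap U W) : D7 U h -> defd G7 (h : rep_tree W U).
  move=> hD; suff [x H] : defd G6 (h : rep_tree W U) by exists x.
  apply/G6E; case: hD => [H|[ho hP]]; last by right; split=> //; within_case hP.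
  by left; apply/G5E; left; apply/G4E; left.
have sq_off (U : tree) (h : bmap U W) : off h -> off (bcomp squash2 h).
  by move=> ho u x /=; case hu: (h u) => [w|k] //= [<-]; exact: ho hu.
have sq_within (U : tree) (h : bmap U W) : within (fun k => k == 2) (bcomp squash2 h).
  by move=> u k /=; case: (h u) => [w|l] //= [<-]; rewrite inordK.
pose GD (U : tree) (h : rep_tree W U) (x : X U) :=
  (off h /\ within P02 h) /\ G6 U (squash2_rep U h) x.
have PD : partial_lift p z GD.
  apply: (@partial_lift_pull gT (rep_tree W) (rep_tree W) X Y p z z squash2_rep
    (fun U h => off h /\ within P02 h) G6) P6.
  - by move=> U V g c; apply: ow_le; exact: (image_le_comp c g).
  - by move=> U g c; exact: ow_act.
  move=> U c [co cP]; have c2 : within P02 (bcomp squash2 c) by within_case (@sq_within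
    U c).
  have := z02 U (bcomp squash2 c) (@sq_off U c co) c2.
  by rewrite collapse0_squash2 (z02 U c co cP) => ->.
have GDdef (U : tree) (h : bmap U W) : off h -> within P02 h ->
  defd GD (h : rep_tree W U).
  move=> ho hP; have [x H] : defd G6 (bcomp squash2 h : rep_tree W U); last by exists x.
  by apply/G6E; right; split; [exact: sq_off | within_case (@sq_within U h)].
have P8 : partial_lift p z (fun U h x => G7 U h x \/ GD U h x).
  apply: partial_lift_union => // U c x x' [[[co nf]|[co c23]] H] [[_ c02] H'].
    have [x0 H0] := (hdef U c nf).2.
    have base0 (h : bmap U W) : off h -> nonfull h -> within P02 h ->
        bcomp (collapse0 v) h = bcomp (collapse0 v) c -> G6 U h x0.
      move=> ho hnf hP hc; apply: sub36; apply: base3; right; split=> //.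
      by rewrite [collapse0_rep v U h]hc.
    rewrite (pl_fun P6 H (base0 c co nf c02 erefl)).
    apply: (pl_fun P6) H'; apply: base0; [exact: sq_off| |by within_case (@sq_within U
      c)|].
      by move=> H'; apply: nf; apply: full_eq H'; rewrite collapse0_squash2.
    exact: collapse0_squash2.
  apply: (pl_fun P6 H); move: H'; rewrite (_ : squash2_rep U c = c) //.
  apply: bmap_eq => u /=; case cu: (c u) => [w|k] //=; congr inr; apply: val_inj;
    rewrite /= inordK //.
  by have := c23 u k cu; have := c02 u k cu; case: k {cu} => [[|[|[|[|]]]]].
set G8 := (fun U h x => _) in P8.
have G8E (U : tree) (h : bmap U W) : defd G8 (h : rep_tree W U) <->
    D7 U h \/ off h /\ within P02 h.
  split=> [[x [[H _]|[H _]]]|[/G7def[x H]|[ho hP]]]; [by left|by right|by exists x;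
    left|].
  by have [x H] := GDdef U h ho hP; exists x; right.
have [|||||G9 [P9 sub9 G9E]] := @cell_extension_seq gT S [:: 0; 0; 2; 3]
  2 (fun U h => off h) R
  X Y p z G8 isT isT isT isT pF (off_root_fc v) QR P8.
- move=> U V g h gh /G8E[H|H]; apply/G8E; [left; exact: D7_le H|right; exact: ow_le H].
- move=> U h ho hl; apply/G8E; left; left; split=> //; exact: chain_only_nonfull.
- move=> U h [|[|[|[|j]]]] // _ _ _ ho hP; apply/G8E.
    by left; right; split=> //; within_case hP.
  by right; split=> //; within_case hP.
- by move=> U h H; apply/G8E; left; left.
- move=> U h ho hP /G8E[[//|[_ h23]]|[_ h02]] hit _.
    by case: (hit 0 isT isT isT); within_case h23.
  by case: (hit 3 isT isT isT); within_case h02.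
have sp_off (U : tree) (k : bmap U S) : off (bcomp (spread v) k).
  move=> u x /=; rewrite /spread_fun; case: eqP => // kr; case: eqP => // ka [<-].
  by split.
have sp_within (U : tree) (k : bmap U S) : within (fun k => (k == 0) || (k == 3))
  (bcomp (spread v) k).
  move=> u l /=; rewrite /spread_fun; case: eqP => [_ [<-]|_]; first by rewrite inordK.
  by case: eqP => [_ [<-]|//]; rewrite inordK.
have sp_collapse (U : tree) (k : bmap U S) : bcomp (collapse v) (bcomp (spread v) k) = k.
  by apply: bmap_eq => u; exact: collapse_spread.
have [|l lP] := @partial_lift_total gT (rep_tree W) X _ _ _ (rep_tree S) spread_rep G9 P9.
  move=> U k; apply/G9E; right; split; first exact: sp_off.
  by within_case (@sp_within U k).
exists l; split=> [U [k kH]|U k]; last first.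
  rewrite (pl_over P9 (lP U k)) -z013; first by rewrite sp_collapse.
    exact: sp_off.
  by within_case (@sp_within U k).
apply: (pl_fun P9 (lP _ _)); apply: sub9; left.
have kx : horn_graph (collapse_rep v U (spread_rep U k)) (f U (exist _ k kH)).
  by rewrite [collapse_rep v U _](sp_collapse U k); exists kH.
(* A face of the horn misses a part of the forest, or it misses [a]. *)
have [[u ku]|na] := pselect (exists u, (k : bmap U S) u = ur_edge v).
  have nf := outer_horn_nonfull kH ku.
  split; first by left; split=> //; exact: sp_off.
  apply: sub36; apply: base3; left; right; split=> //; split; first (split=> //;
    exact: sp_off).
  by within_case (@sp_within U k).
have w3 : within (fun k => k == 3) (bcomp (spread v) k).
  move=> u l' /=; rewrite /spread_fun; case: eqP => [_ [<-]|_]; first by rewrite inordK.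
  by case: eqP => // ka; case: na; exists u.
split; first by right; split; [exact: sp_off | within_case w3].
apply/sub6/sub5; right; split=> //; split; first exact: sp_off.
by within_case w3.
Qed.

End OuterHornLift.

Theorem theorem7p4 (gT : finGroupType) (S : tree_act gT) (v : unary_root S)
    (two_vertices : (1 < #|vertices S|)%N)
    (X Y : gdset gT) (p : gmap X Y)
    (X_operad : g_inf_operad X) (Y_operad : g_inf_operad Y)
    (p_fib : g_inner_fibration p)
    (f : gmap (sub_gdset (outer_horn v)) X) (y : gmap (rep_tree S) Y)
    (square : commutes (sub_incl (outer_horn v)) p f y)
    (f_equiv : is_equivalence (image_root_vertex two_vertices f)) :
  has_lift (sub_incl (outer_horn v)) p f y.
Proof.
have [rho [rho_fixed rho013 rho02]] := equivalence_simplex X_operad f_equiv.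
have root_graph : horn_graph f (root_vertex v : rep_tree S (linear 1))
    (sval (image_root_vertex two_vertices f)).
  by exists (root_vertex_mem v two_vertices).
apply: (outer_horn_lift two_vertices p_fib square Y_operad rho_fixed) => [U k k2|U k k1 k3].
  rewrite rho013 //.
  have := pl_res (horn_graph_lift square) (bcomp (sbmap 3 1 [:: 0; 1; 1; 1]) k) root_graph.
  rewrite (_ : @dres (rep_tree S) _ _ _ _ = bcomp (collapse v) (bcomp (chain S) k)) //.
  apply: bmap_eq => u /=; rewrite /root_vertex_fun /collapse_chain /seq_fun.
  by case: (k u) => [[|[|[|[|]]]]] //= ?; rewrite -!val_eqE /= inordK.
rewrite rho02 //.
have := pl_res (horn_graph_lift square) (bcomp (sbmap 3 1 [:: 0; 0; 0; 0]) k) root_graph.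
rewrite (_ : @dres (rep_tree S) _ _ _ _ = bcomp (collapse0 v) (bcomp (chain S) k)) //.
apply: bmap_eq => u; rewrite -[RHS]/(collapse0 v (inr (k u))) collapse0_inr.
rewrite /= /root_vertex_fun /seq_fun.
by case: (k u) => [[|[|[|[|]]]]] //= ?; rewrite -!val_eqE /= inordK.
Qed.
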